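(* Let $\Omega\subset\mathbb{C}$ be a Jordan domain, let $\gamma\subset\Omega$ be a hyperbolic line, let $c\ge 0$, and let $\alpha\subset\Omega$ be a $c$-level line of $\gamma$. Then there is a $K$-quasiconformal homeomorphism $f:\Omega\to\Omega$ (onto $\Omega$), extending homeomorphically to $\overline{\Omega}$, such that (i) $f(\gamma)=\alpha$; (ii) $f|_{\partial\Omega}$ is the identity; (iii) $K\le e^{c}$.
   Context: A Jordan domain is a bounded domain in $\mathbb{C}$ whose boundary is a topological circle (the interior of a Jordan curve). $\rho_\Omega$ denotes the hyperbolic distance of $\Omega$, of constant curvature $-1$ (on the unit disk $\mathbb{D}$ the metric is $2|dz|/(1-|z|^2)$, transferred to $\Omega$ by a Riemann map). A hyperbolic line $\gamma\subset\Omega$ is a complete hyperbolic geodesic, i.e. $\gamma=\varphi((-1,1))$ for some conformal homeomorphism $\varphi:\mathbb{D}\to\Omega$. It has two endpoints $\gamma_-,\gamma_+\in\partial\Omega$. For $c\ge0$, a $c$-level line of $\gamma$ is a full arc $\alpha\subset\Omega$ on which $\rho_\Omega(z,\gamma)=c$, where $\rho_\Omega(z,\gamma)=\inf_{w\in\gamma}\rho_\Omega(z,w)$; that is, $\alpha$ is a connected component of $\{z\in\Omega:\rho_\Omega(z,\gamma)=c\}$. Such an arc has endpoints $\gamma_\pm$ on $\partial\Omega$. A homeomorphism $f:\Omega\to\Omega'$ between planar domains is $K$-quasiconformal, $1\le K<\infty$, if $f\in W^{1,2}_{loc}(\Omega,\mathbb{C})$ and $|Df(z)|^2\le K\,J(z,f)$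 for almost every $z\in\Omega$, where $Df$ is the Jacobian matrix, $|\cdot|$ the operator norm, and $J(z,f)=\det Df(z)$. Quasiconformal homeomorphisms between Jordan domains extend homeomorphically to the closures. *)

(* Defs.v *)
From HB Require Import structures.
From mathcomp Require Import all_boot all_order all_algebra.
From mathcomp Require Import complex.
From mathcomp Require Import all_classical all_reals all_analysis.
Import numFieldNormedType.Exports.
Import Order.TTheory GRing.Theory Num.Theory.

Set Implicit Arguments.
Unset Strict Implicit.
Unset Printing Implicit Defensive.

Local Open Scope classical_set_scope.
Local Open Scope ring_scope.
Local Open Scope complex_scope.

(* R[i], ascribed as a numFieldType so that it receives the generic norm,
   topology and differential structure of numeric fields; [derivable f z 1] for
   f : cplx R -> cplx R is thus differentiability with respect to the complex
   variable. *)
Definition cplx (R : realType) : numFieldType := R[i].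

(* R * R carries the product topology, Borel sets and Lebesgue measure. *)
Definition toC (R : realType) (p : R * R) : cplx R := p.1 +i* p.2.

Definition enorm (R : realType) (p : R * R) : R :=
  Num.sqrt (p.1 ^+ 2 + p.2 ^+ 2).

Definition area (R : realType) :
    {measure set (measurableTypeR R * measurableTypeR R) -> \bar R} :=
  (lebesgue_measure \x lebesgue_measure)%E.

Definition homeo_on (T U : topologicalType) (A : set T) (B : set U)
    (f : T -> U) : Prop :=
  exists g : U -> T,
    [/\ forall x, A x -> B (f x) /\ g (f x) = x,
        forall y, B y -> A (g y) /\ f (g y) = y,
        {within A, continuous f} & {within B, continuous g}].

Definition frontier (T : topologicalType) (A : set T) : set T :=
  closure A `\` A°.

Definition unit_disk (R : realType) : set (cplx R) := [set z | `|z| < 1].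

Definition unit_circle (R : realType) : set (cplx R) := [set z | `|z| = 1].

Definition domain (R : realType) (Omega : set (cplx R)) : Prop :=
  [/\ Omega !=set0, open Omega & connected Omega].

Definition jordan_domain (R : realType) (Omega : set (cplx R)) : Prop :=
  [/\ domain Omega, bounded_set Omega &
      exists h : cplx R -> cplx R, homeo_on (@unit_circle R) (frontier Omega) h].

Definition conformal_homeo (R : realType) (A B : set (cplx R))
    (f : cplx R -> cplx R) : Prop :=
  homeo_on A B f /\
  forall z, A z -> derivable f z (1 : cplx R) /\ 'D_(1 : cplx R) f z != 0.

Definition hyperbolic_line (R : realType) (Omega gamma : set (cplx R)) : Prop :=
  exists phi : cplx R -> cplx R, conformal_homeo (@unit_disk R) Omega phi /\
    gamma = [set phi (toC (x, 0)) | x in [set x : R | -1 < x < 1]].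

(* Only the restriction of sigma to [0, 1] matters. A piecewise C^1 curve can be
   reparametrized as a C^1 one which slows down to zero speed at the corners. *)
Definition disk_curve (R : realType) (z w : cplx R) (sigma : R -> R * R) : Prop :=
  [/\ (forall t, derivable sigma t 1), continuous (derive1 sigma),
      (forall t, 0 <= t <= 1 -> unit_disk (toC (sigma t))),
      toC (sigma 0) = z & toC (sigma 1) = w].

Definition hyp_length (R : realType) (sigma : R -> R * R) : R :=
  (\int[lebesgue_measure]_(t in `[0%R, 1%R])
    (2 * enorm (derive1 sigma t) / (1 - enorm (sigma t) ^+ 2)))%R.

Definition hyp_dist_disk (R : realType) (z w : cplx R) : R :=
  inf [set hyp_length sigma | sigma in disk_curve z w].

(* The inverse of a Riemann map of Omega; the distance below does not depend on
   the choice since conformal automorphisms of the disk are hyperbolic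
   isometries. *)
Definition to_disk (R : realType) (Omega : set (cplx R)) : cplx R -> cplx R :=
  get [set psi : cplx R -> cplx R | conformal_homeo Omega (@unit_disk R) psi].

Definition hyp_dist (R : realType) (Omega : set (cplx R)) (z w : cplx R) : R :=
  hyp_dist_disk (to_disk Omega z) (to_disk Omega w).

Definition hyp_dist_set (R : realType) (Omega : set (cplx R)) (z : cplx R)
    (A : set (cplx R)) : R :=
  inf [set hyp_dist Omega z w | w in A].

Definition level_line (R : realType) (Omega gamma : set (cplx R)) (c : R)
    (alpha : set (cplx R)) : Prop :=
  let L := [set z | Omega z /\ hyp_dist_set Omega z gamma = c] in
  exists2 z, L z & alpha = connected_component L z.

Definition iter_derive (R : realType) (phi : R * R -> R) (s : seq (R * R)) :
    R * R -> R :=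
  foldr (fun v g => 'D_v g) phi s.

(* C^oo : every iterated directional derivative is Frechet differentiable. *)
Definition smooth (R : realType) (phi : R * R -> R) : Prop :=
  forall (s : seq (R * R)) (p : R * R), differentiable (iter_derive phi s) p.

Definition test_function (R : realType) (U : set (R * R)) (phi : R * R -> R) :
    Prop :=
  let supp := closure [set p | phi p != 0] in
  [/\ smooth phi, compact supp & supp `<=` U].

Definition L2_loc (R : realType) (U : set (R * R)) (g : R * R -> R) : Prop :=
  measurable_fun U g /\
  forall A : set (R * R), compact A -> A `<=` U ->
    (\int[@area R]_(p in A) (g p ^+ 2)%:E < +oo)%E.

Definition weak_derive (R : realType) (U : set (R * R)) (v : R * R)
    (u g : R * R -> R) : Prop :=
  forall phi, test_function U phi ->
    (\int[@area R]_(p in U) (u p * 'D_v phi p)%:E =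
     - \int[@area R]_(p in U) (g p * phi p)%:E)%E.

Definition coord (R : realType) (i : 'I_2) (z : cplx R) : R :=
  if i == 0 then complex.Re z else complex.Im z.

Definition dir (R : realType) (j : 'I_2) : R * R :=
  if j == 0 then (1, 0) else (0, 1).

(* f is in W^{1,2}_loc(Omega, C) with weak Jacobian matrix Df. *)
Definition W12_loc (R : realType) (Omega : set (cplx R)) (f : cplx R -> cplx R)
    (Df : R * R -> 'M[R]_2) : Prop :=
  let U := @toC R @^-1` Omega in
  forall i j : 'I_2,
    [/\ L2_loc U (fun p => coord i (f (toC p))), L2_loc U (fun p => Df p i j) &
        weak_derive U (dir R j) (fun p => coord i (f (toC p)))
          (fun p => Df p i j)].

Definition l2norm (R : realType) (n : nat) (v : 'cV[R]_n) : R :=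
  Num.sqrt (\sum_i v i 0 ^+ 2).

Definition opnorm (R : realType) (n : nat) (A : 'M[R]_n) : R :=
  sup [set l2norm (A *m v) | v in [set v : 'cV[R]_n | l2norm v <= 1]].

Definition quasiconformal (R : realType) (K : R) (Omega Omega' : set (cplx R))
    (f : cplx R -> cplx R) : Prop :=
  [/\ 1 <= K, homeo_on Omega Omega' f &
      exists2 Df : R * R -> 'M[R]_2, W12_loc Omega f Df &
        {ae @area R, forall p, Omega (toC p) ->
           opnorm (Df p) ^+ 2 <= K * \det (Df p)}].

(* Main.v *)
Require Import Defs.
From mathcomp Require Import all_boot all_order all_algebra.
From mathcomp Require Import all_classical all_reals all_analysis.
From mathcomp Require Import measurable_realfun.
From mathcomp Require Import complex ring lra.
Import numFieldNormedType.Exports.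
Import Order.TTheory GRing.Theory Num.Theory.
Local Open Scope classical_set_scope.
Local Open Scope ring_scope.

Set Implicit Arguments.
Unset Strict Implicit.
Unset Printing Implicit Defensive.

(** The map is the flow along the geodesics orthogonal to [gamma].  Let [Phi]
    be a conformal map of the right half plane onto [Omega] that carries the
    positive real axis to [gamma], and let [s] be the signed hyperbolic
    distance to that axis; a point of the half plane is determined by its
    modulus [r] and by [s], as [r (sech s + i tanh s)].  The shift
    [(r, s) |-> (r, s + e)] moves every point along a geodesic orthogonal to
    the axis and carries the axis to the line [s = e].  In the frame given by
    the radial and angular directions its differential is conformal up to the
    diagonal matrix with entries [1] and [cosh s / cosh (s + e)], and this ratio
    lies between [exp (- |e|)] and [exp |e|]; hence the conjugate of the shift
    by [Phi] is a smooth [exp |e|]-quasiconformal map ([push_distortion]).  Being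
    continuously differentiable it has weak derivatives, by Fubini and the
    fundamental theorem of calculus ([weak_derive_C1]).

    Three facts about conformal maps are needed, and all follow from one
    estimate ([gradient_bound]): a positive harmonic function [A] on the unit
    disk whose differential is [Re (k dz)] satisfies
    [|k| (1 - |z|^2) <= 2 A].  It is proved as in Ahlfors' lemma, by maximizing
    [|k| (r^2 - |z|^2) / A] over a smaller disk and adding the second
    derivatives of its logarithm along the two axes.
    - With [A = Re f] for a conformal map [f] onto the half plane it is the
      Schwarz-Pick inequality.  It shows that the hyperbolic distance does not
      depend on the Riemann map, and then that the distance of [Phi w] to
      [gamma] is [|s w|] ([dist_to_axis]); so the set of points at distance [c]
      is the image of the two lines [s = c] and [s = - c], and a level line is
      one of the two images ([level_component]).
    - With [A = log (M / |Phi - zeta|)], where [zeta] is a boundary point and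
      [M] bounds the distance from [zeta] to the points of [Omega], it bounds
      the speed of [log A] in the hyperbolic metric.  Since the shift moves
      every point by the hyperbolic distance [|e|], it can divide [A] by at most
      [exp |e|] ([push_near_omitted]).  Points that converge to [zeta]
      therefore have images that converge to [zeta], so the map extended by the
      identity is continuous on the closure ([ctsat_push_ext]).

    The estimate uses that derivatives of holomorphic functions are holomorphic
    ([holo_deriv]).  This is derived from Goursat's theorem for rectangles
    ([goursat]) and Cauchy's formula on squares ([cauchy_formula]); the formula
    is used in the form of a quotient of two Cauchy transforms, so that the
    winding number of the square only has to be nonzero. *)

(** * Complex numbers, real modulus and topology *)

Section ComplexModulus.
Context {R : realType}.
Local Notation C := (cplx R).
Implicit Types z w : C.

(** The modulus is taken with values in [R]; the norm of the field [cplx R] is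
    itself a complex number. *)
Definition re z : R := complex.Re z.
Definition im z : R := complex.Im z.
Definition mkc (x y : R) : C := Complex x y.
Definition inC (x : R) : C := mkc x 0.
Definition iC : C := mkc 0 1.
Definition cm z : R := Num.sqrt (re z ^+ 2 + im z ^+ 2).

Lemma reD z w : re (z + w) = re z + re w. Proof. by case: z; case: w. Qed.
Lemma imD z w : im (z + w) = im z + im w. Proof. by case: z; case: w. Qed.
Lemma reN z : re (- z) = - re z. Proof. by case: z. Qed.
Lemma imN z : im (- z) = - im z. Proof. by case: z. Qed.
Lemma reB z w : re (z - w) = re z - re w. Proof. by rewrite reD reN. Qed.
Lemma imB z w : im (z - w) = im z - im w. Proof. by rewrite imD imN. Qed.
Lemma reM z w : re (z * w) = re z * re w - im z * im w.
Proof. by case: z; case: w. Qed.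
Lemma imM z w : im (z * w) = re z * im w + im z * re w.
Proof. by case: z; case: w. Qed.
Lemma re0 : re 0 = 0. Proof. by []. Qed.
Lemma im0 : im 0 = 0. Proof. by []. Qed.
Lemma re1 : re 1 = 1. Proof. by []. Qed.
Lemma im1 : im 1 = 0. Proof. by []. Qed.
(** Real and imaginary parts of the ring operations. *)
Definition reimE := (reD, imD, reN, imN, reM, imM, re0, im0, re1, im1).

Lemma cplx_eqP z w : re z = re w -> im z = im w -> z = w.
Proof. by case: z => a b; case: w => c d /= -> ->. Qed.

Lemma mkcK z : mkc (re z) (im z) = z. Proof. by case: z. Qed.

Lemma inCD x y : inC (x + y) = inC x + inC y.
Proof. by apply: cplx_eqP; rewrite !reimE //= addr0. Qed.
Lemma inCN x : inC (- x) = - inC x.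
Proof. by apply: cplx_eqP; rewrite !reimE //= oppr0. Qed.
Lemma inCB x y : inC (x - y) = inC x - inC y.
Proof. by rewrite inCD inCN. Qed.
Lemma inCM x y : inC (x * y) = inC x * inC y.
Proof. by apply: cplx_eqP; rewrite !reimE /= ?mulr0 ?mul0r ?subr0 ?addr0. Qed.
Lemma inC0 : inC 0 = 0. Proof. by []. Qed.
Lemma inC1 : inC 1 = 1. Proof. by []. Qed.
Lemma mkcE x y : mkc x y = inC x + iC * inC y.
Proof. by apply: cplx_eqP; rewrite !reimE /=; ring. Qed.

Lemma cmE z : cm z = complex.ComplexField.Normc.normc z. Proof. by case: z. Qed.
Lemma normE z : `|z| = inC (cm z). Proof. by rewrite cmE. Qed.
Lemma cm2 z : cm z ^+ 2 = re z ^+ 2 + im z ^+ 2.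
Proof. by rewrite /cm sqr_sqrtr// addr_ge0 ?sqr_ge0. Qed.
Lemma cm_ge0 z : 0 <= cm z. Proof. exact: sqrtr_ge0. Qed.
Hint Resolve cm_ge0 : core.
Lemma cm0 : cm 0 = 0.
Proof. by rewrite cmE complex.ComplexField.Normc.normc0. Qed.
Lemma cm1 : cm 1 = 1.
Proof. by rewrite cmE complex.ComplexField.Normc.normc1. Qed.
Lemma cm_eq0 z : (cm z == 0) = (z == 0).
Proof.
apply/eqP/eqP => [|->]; last exact: cm0.
by rewrite cmE => /complex.ComplexField.Normc.eq0_normc.
Qed.
Lemma cm_gt0 z : (0 < cm z) = (z != 0).
Proof. by rewrite lt_def cm_eq0 cm_ge0 andbT. Qed.
Lemma cmM z w : cm (z * w) = cm z * cm w.
Proof. by rewrite !cmE complex.ComplexField.Normc.normcM. Qed.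
Lemma cmN z : cm (- z) = cm z.
Proof. by rewrite /cm reN imN !sqrrN. Qed.
Lemma cmBC z w : cm (z - w) = cm (w - z).
Proof. by rewrite -cmN opprB. Qed.
Lemma cmV z : cm z^-1 = (cm z)^-1.
Proof. by rewrite !cmE complex.ComplexField.Normc.normcV. Qed.
Lemma cmD z w : cm (z + w) <= cm z + cm w.
Proof. by rewrite !cmE complex.le_normcD. Qed.
Lemma cmB z w : cm (z - w) <= cm z + cm w.
Proof. by rewrite (le_trans (cmD _ _))// cmN. Qed.
Lemma cm_inC x : cm (inC x) = `|x|.
Proof. by rewrite /cm /= expr0n /= addr0 sqrtr_sqr. Qed.
Lemma cm_iC : cm iC = 1.
Proof. by rewrite /cm /= expr0n /= add0r expr1n sqrtr1. Qed.
Lemma re_le_cm z : `|re z| <= cm z.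
Proof. by rewrite -sqrtr_sqr ler_sqrt ?lerDl ?sqr_ge0// addr_ge0 ?sqr_ge0. Qed.
Lemma im_le_cm z : `|im z| <= cm z.
Proof. by rewrite -sqrtr_sqr ler_sqrt ?lerDr ?sqr_ge0// addr_ge0 ?sqr_ge0. Qed.
Lemma cm_le z : cm z <= `|re z| + `|im z|.
Proof.
rewrite -[leRHS]ger0_norm ?addr_ge0// -sqrtr_sqr ler_sqrt ?sqr_ge0//.
rewrite sqrrD !real_normK ?num_real// addrAC lerDl mulrn_wge0 ?mulr_ge0//.
Qed.
Lemma cmBB z w : cm z - cm w <= cm (z - w).
Proof. by rewrite lerBlDr (le_trans _ (cmD _ _))// subrK. Qed.
Lemma cmX z n : cm (z ^+ n) = cm z ^+ n.
Proof. by elim: n => [|n IH]; rewrite ?expr0 ?cm1// !exprS cmM IH. Qed.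

Lemma unit_diskE z : unit_disk z <-> cm z < 1.
Proof. by rewrite /unit_disk /= normE -inC1; apply: iff_refl || rewrite complex.ltcR. Qed.

Lemma ltC_inC x (e : C) : 0 < e -> (inC x < e) = (x < re e).
Proof. by case: e => a b; rewrite !complex.ltcE /= => /andP[/eqP -> _]; rewrite eqxx. Qed.

Lemma nbhsC z (A : set C) :
  nbhs z A <-> exists2 e : R, 0 < e & forall w, cm (w - z) < e -> A w.
Proof.
split.
  move=> /nbhs_ballP[e /= e0 eA]; exists (re e).
    by move: e0; rewrite complex.ltcE => /andP[].
  by move=> w wz; apply: eA; rewrite -ball_normE /= normE ltC_inC// cmBC.
move=> [e e0 eA]; apply/nbhs_ballP; exists (inC e) => /=.
  by rewrite -inC0 complex.ltcR.
move=> w; rewrite -ball_normE /= normE complex.ltcR cmBC; exact: eA.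
Qed.

Lemma cvgC {T : Type} (F : set_system T) {FF : Filter F} (f : T -> C) (l : C) :
  f @ F --> l <-> forall e : R, 0 < e -> \forall x \near F, cm (f x - l) < e.
Proof.
split=> [fl e e0|H A /nbhsC[e e0 eA]].
  by apply: (fl [set w | cm (w - l) < e]); apply/nbhsC; exists e.
by have := H e e0; apply: filterS => x; exact: eA.
Qed.

Lemma cvg_re {T : Type} (F : set_system T) {FF : Filter F} (f : T -> C) (l : C) :
  f @ F --> l -> re (f x) @[x --> F] --> re l.
Proof.
move=> /cvgC fl; apply/cvgrPdist_lt => e e0.
have := fl e e0; apply: filterS => x; rewrite cmBC; apply: le_lt_trans.
by rewrite -reB re_le_cm.
Qed.

Lemma cvg_im {T : Type} (F : set_system T) {FF : Filter F} (f : T -> C) (l : C) :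
  f @ F --> l -> im (f x) @[x --> F] --> im l.
Proof.
move=> /cvgC fl; apply/cvgrPdist_lt => e e0.
have := fl e e0; apply: filterS => x; rewrite cmBC; apply: le_lt_trans.
by rewrite -imB im_le_cm.
Qed.

Lemma cvg_cm {T : Type} (F : set_system T) {FF : Filter F} (f : T -> C) (l : C) :
  f @ F --> l -> cm (f x) @[x --> F] --> cm l.
Proof.
move=> /cvgC fl; apply/cvgrPdist_lt => e e0.
have := fl e e0; apply: filterS => x; apply: le_lt_trans.
rewrite ler_norml; apply/andP; split; first by rewrite lerNl opprB cmBB.
by rewrite cmBC cmBB.
Qed.

Lemma cvg_mkc {T : Type} (F : set_system T) {FF : Filter F} (f g : T -> R) (a b : R) :
  f @ F --> a -> g @ F --> b -> mkc (f x) (g x) @[x --> F] --> mkc a b.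
Proof.
move=> /cvgrPdist_lt fa /cvgrPdist_lt gb; apply/cvgC => e e0.
have e20 : 0 < e / 2 by rewrite divr_gt0.
have := fa _ e20; have := gb _ e20; apply: filterS2 => x gx fx.
rewrite (le_lt_trans (cm_le _))// reB imB [ltRHS]splitr ltrD//.
  by rewrite distrC.
by rewrite distrC.
Qed.

Lemma inC_cont : continuous inC.
Proof.
move=> x; apply: (@cvg_mkc _ (nbhs x) _ id (fun=> 0) x 0); first exact: cvg_id.
exact: cvg_cst. Qed.
Lemma cm_cont : continuous cm. Proof. by move=> z; exact: (@cvg_cm _ (nbhs z) _ id z cvg_id). Qed.
Lemma toC_cont : continuous (@toC R).
Proof. by move=> -[a b]; apply: (@cvg_mkc _ (nbhs (a, b)) _ fst snd a b); [exact: cvg_fst|exact: cvg_snd]. Qed.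
End ComplexModulus.
#[local] Hint Extern 0 (is_true (@Order.le _ _ _ (cm _))) => exact: cm_ge0 : core.
(* Unification would otherwise unfold the field structure of [cplx R]. *)
#[local] Opaque cplx.

(** * Derivatives by Caratheodory's criterion *)

(** Continuity at a point. It is a one-constructor type so that unification
    never unfolds it to statements about filters. *)
Variant ctsat {T U : topologicalType} (f : T -> U) (t : T) : Prop :=
  Ctsat of f @ t --> f t.

Lemma ctsat_comp {T U V : topologicalType} (f : T -> U) (g : U -> V) t :
  ctsat f t -> ctsat g (f t) -> ctsat (fun s => g (f s)) t.
Proof. by move=> [fc] [gc]; apply: Ctsat; exact: (@continuous_comp _ _ _ f g). Qed.

Lemma ctsat_near {T U : topologicalType} (f g : T -> U) t :
  (\forall s \near t, f s = g s) -> ctsat f t -> ctsat g t.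
Proof.
move=> fg [fc]; apply: Ctsat; rewrite -(nbhs_singleton fg); apply: cvg_trans fc.
by apply: near_eq_cvg; apply: filterS fg => s ->.
Qed.

Section PointwiseContinuity.
Context {C : numFieldType} {T : topologicalType}.
Implicit Types (f g : T -> C) (t : T).

Lemma contC_cst (a : C) t : ctsat (fun=> a : C) t.
Proof. by apply: Ctsat; exact: cvg_cst. Qed.
Lemma contC_D f g t : ctsat f t -> ctsat g t -> ctsat (fun s => f s + g s) t.
Proof. by move=> [fc] [gc]; apply: Ctsat; exact: (@cvgD C C T (nbhs t) _ f g). Qed.
Lemma contC_N f t : ctsat f t -> ctsat (fun s => - f s) t.
Proof. by move=> [fc]; apply: Ctsat; exact: (@cvgN C C T (nbhs t) _ f). Qed.
Lemma contC_B f g t : ctsat f t -> ctsat g t -> ctsat (fun s => f s - g s) t.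
Proof. by move=> [fc] [gc]; apply: Ctsat; exact: (@cvgB C C T (nbhs t) _ f g). Qed.
Lemma contC_M f g t : ctsat f t -> ctsat g t -> ctsat (fun s => f s * g s) t.
Proof. by move=> [fc] [gc]; apply: Ctsat; exact: (@cvgM C T (nbhs t) _ f g). Qed.
Lemma contC_V f t : f t != 0 -> ctsat f t -> ctsat (fun s => (f s)^-1) t.
Proof. by move=> ? [fc]; apply: Ctsat; exact: (@cvgV C T (nbhs t) _ f). Qed.
End PointwiseContinuity.

Section PointwiseContinuityCoordinates.
Context {R : realType} {T : topologicalType}.
Local Notation C := (cplx R).
Implicit Types (f g : T -> C) (t : T).

Lemma contC_re f t : ctsat f t -> ctsat (fun s => re (f s)) t.
Proof. by move=> [fc]; apply: Ctsat; exact: cvg_re. Qed.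
Lemma contC_im f t : ctsat f t -> ctsat (fun s => im (f s)) t.
Proof. by move=> [fc]; apply: Ctsat; exact: cvg_im. Qed.
Lemma contC_cm f t : ctsat f t -> ctsat (fun s => cm (f s)) t.
Proof. by move=> [fc]; apply: Ctsat; exact: cvg_cm. Qed.
Lemma contC_mkc (f g : T -> R) t : ctsat f t -> ctsat g t ->
  ctsat (fun s => mkc (f s) (g s)) t.
Proof. by move=> [fc] [gc]; apply: Ctsat; exact: cvg_mkc. Qed.
Lemma contC_inC (f : T -> R) t : ctsat f t -> ctsat (fun s => inC (f s)) t.
Proof. by move=> fc; apply: contC_mkc => //; apply: Ctsat; exact: cvg_cst. Qed.
End PointwiseContinuityCoordinates.

Section CaratheodoryDerivative.
Context {C : numFieldType} {T : topologicalType}.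
Variable iota : T -> C.
Implicit Types (f g : T -> C) (t : T) (d : C).

(** [f] has derivative [d] at [t] with respect to the embedding [iota] of the
    parameter space into the field: [f s - f t] is, near [t], a multiple of
    [iota s - iota t] by a function that is continuous at [t] with value [d].
    The embedding is the identity for complex derivatives and the inclusion of
    the reals for derivatives of curves. *)
Definition cderiv f t d := exists q : T -> C,
  [/\ ctsat q t, q t = d &
      \forall s \near t, f s - f t = q s * (iota s - iota t)].

Lemma cderiv_cst (a : C) t : cderiv (fun=> a) t 0.
Proof.
exists (fun=> 0); split=> //; first exact: contC_cst.
by apply: nearW => s; rewrite subrr mul0r.
Qed.

Lemma cderiv_emb t : cderiv iota t 1.
Proof.
exists (fun=> 1); split=> //; first exact: contC_cst.
by apply: nearW => s; rewrite mul1r.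
Qed.

Lemma cderiv_eq f t d d' : cderiv f t d -> d = d' -> cderiv f t d'.
Proof. by move=> + <-. Qed.

Lemma cderiv_near f g t d : (\forall s \near t, f s = g s) ->
  cderiv f t d -> cderiv g t d.
Proof.
move=> fg [q [qc qt fq]]; exists q; split=> //.
have fgt : f t = g t by exact: nbhs_singleton fg.
by apply: filterS2 fg fq => s -> <-; rewrite fgt.
Qed.

Lemma cderivD f g t d e : cderiv f t d -> cderiv g t e ->
  cderiv (fun s => f s + g s) t (d + e).
Proof.
move=> [p [pc pt fp]] [q [qc qt gq]]; exists (fun s => p s + q s); split.
- exact: contC_D.
- by rewrite pt qt.
- apply: filterS2 fp gq => s fp gq.
  by rewrite mulrDl -fp -gq opprD addrACA.
Qed.

Lemma cderivM f g t d e : ctsat g t ->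
  cderiv f t d -> cderiv g t e ->
  cderiv (fun s => f s * g s) t (d * g t + f t * e).
Proof.
move=> gc [p [pc pt fp]] [q [qc qt gq]].
exists (fun s => p s * g s + f t * q s); split.
- by apply: contC_D; apply: contC_M => //; exact: contC_cst.
- by rewrite pt qt.
- apply: filterS2 fp gq => s fp gq.
  have -> : f s * g s - f t * g t = (f s - f t) * g s + f t * (g s - g t) by ring.
  by rewrite fp gq; ring.
Qed.

Lemma cderivZ f t d (a : C) : cderiv f t d -> cderiv (fun s => a * f s) t (a * d).
Proof.
move=> [p [pc pt fp]]; exists (fun s => a * p s); split.
- by apply: contC_M => //; exact: contC_cst.
- by rewrite pt.
- by apply: filterS fp => s fp; rewrite -mulrBr fp mulrA.
Qed.

Lemma cderivN f t d : cderiv f t d -> cderiv (fun s => - f s) t (- d).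
Proof.
move=> /(cderivZ (-1)); rewrite mulN1r; apply: cderiv_near.
by apply: nearW => s; rewrite mulN1r.
Qed.

Lemma cderivB f g t d e : cderiv f t d -> cderiv g t e ->
  cderiv (fun s => f s - g s) t (d - e).
Proof. by move=> fd /cderivN; exact: cderivD. Qed.

Lemma cderivV f t d : ctsat f t -> f t != 0 ->
  cderiv f t d -> cderiv (fun s => (f s)^-1) t (- d / (f t) ^+ 2).
Proof.
move=> fc ft0 [p [pc pt fp]]; exists (fun s => - p s * ((f s)^-1 / f t)); split.
- apply: contC_M; first exact: contC_N.
  by apply: contC_M; [exact: contC_V|exact: contC_cst].
- by rewrite pt -invfM expr2.
- have fn0 : \forall s \near t, f s != 0.
    by case: fc => fc; exact: (cvgr_neq0 (f t) fc).
  apply: filterS2 fp fn0 => s fp fs0.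
  rewrite mulrAC mulNr -fp opprB.
  by field; rewrite fs0 ft0.
Qed.

Hypothesis iota_cont : forall t, ctsat iota t.

Lemma cderiv_cont f t d : cderiv f t d -> ctsat f t.
Proof.
move=> [q [qc qt fq]].
have H : ctsat (fun s => q s * (iota s - iota t) + f t) t.
  apply: contC_D; last exact: contC_cst.
  apply: contC_M => //; apply: contC_B; last exact: contC_cst.
  exact: iota_cont.
by apply: ctsat_near H; apply: filterS fq => s <-; rewrite subrK.
Qed.
End CaratheodoryDerivative.

Section CaratheodoryComposition.
Context {C : numFieldType}.

Lemma cderiv_comp {T : topologicalType} (iota : T -> C) (f : T -> C) (g : C -> C)
    t d e : ctsat f t ->
  cderiv iota f t d -> cderiv id g (f t) e -> cderiv iota (fun s => g (f s)) t (e * d).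
Proof.
move=> fc [p [pc pt fp]] [q [qc qt gq]]; exists (fun s => q (f s) * p s); split.
- apply: contC_M => //; exact: ctsat_comp.
- by rewrite pt qt.
- have gq' : \forall s \near t, g (f s) - g (f t) = q (f s) * (f s - f t).
    case: fc => fc; exact: (fc [set w | g w - g (f t) = q w * (w - f t)]).
  by apply: filterS2 fp gq' => s fp ->; rewrite fp mulrA.
Qed.

(** Over a numeric field, this is differentiability in the usual sense. *)
Lemma is_derive_cderivP (f : C -> C) z d :
  is_derive z (1 : C) f d <-> cderiv id f z d.
Proof.
split=> [[fz fd]|[q [qc qz fq]]].
- pose q w := if w == z then d else (f w - f z) / (w - z).
  exists q; split; rewrite /q ?eqxx//.
  + apply: Ctsat; apply/continuous_withinNx; rewrite eqxx.
    have : (fun h : C => h^-1 *: (f (h *: (1 : C) + z) - f z)) @ 0^' --> d.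
      by rewrite -fd; exact: fz.
    move=> /cvgrPdist_lt H; apply/cvgrPdist_lt => e /H; rewrite !near_withinE => /nbhs_ballP.
    move=> [r /= r0 rH]; apply/nbhs_ballP; exists r => //= w /= wr wz.
    rewrite (negbTE wz).
    have := rH (w - z); rewrite /= subr_eq0 wz /= => /(_ _ isT).
    rewrite -ball_normE /= sub0r normrN -normrN opprB.
    move: wr; rewrite -ball_normE /= => wr /(_ wr).
    by rewrite /GRing.scale /= mulr1 subrK mulrC.
  + apply: (@filterE _ (nbhs z)) => w; case: eqVneq => [->|wz]; first by rewrite !subrr mulr0.
    by rewrite divfK// subr_eq0.
- have H : (fun h : C => h^-1 *: (f (h *: (1 : C) + z) - f z)) @ 0^' --> d.
    have qh : q (h + z) @[h --> 0^'] --> d.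
      apply: cvg_within_filter.
      have : ctsat (fun h => q (h + z)) 0.
        apply: ctsat_comp; last by rewrite add0r.
        apply: contC_D; last exact: contC_cst.
        by apply: Ctsat; exact: cvg_id.
      by case; rewrite add0r qz.
    apply: cvg_trans qh; apply: near_eq_cvg.
    have sh : (h + z) @[h --> (0:C)] --> z.
      have : ctsat (fun h => h + z) 0.
        apply: contC_D; last exact: contC_cst.
        by apply: Ctsat; exact: cvg_id.
      by case; rewrite add0r.
    have := sh _ fq; rewrite /= => /nbhs_ballP[r /= r0 rH].
    apply/nbhs_ballP; exists r => //= h hr h0.
    have := rH _ hr; rewrite /= addrK => Hh.
    by rewrite /GRing.scale /= mulr1 Hh mulrC mulfK.
  split; first by apply/cvg_ex; exists d.
  exact: cvg_lim H.
Qed.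

End CaratheodoryComposition.

Section ComplexDerivative.
Context {R : realType}.
Local Notation C := (cplx R).

(** Complex derivatives ([cder]) and derivatives of plane curves ([rder]). *)
Definition cder : (C -> C) -> C -> C -> Prop := cderiv id.
Definition rder : (R -> C) -> R -> C -> Prop := cderiv (@inC R).

Lemma cder_cont f z d : cder f z d -> ctsat f z.
Proof. by apply: cderiv_cont => z'; apply: Ctsat; exact: cvg_id. Qed.
Lemma rder_cont f t d : rder f t d -> ctsat f t.
Proof. by apply: cderiv_cont => z'; apply: Ctsat; exact: inC_cont. Qed.

Lemma cderM f g z d e : cder f z d -> cder g z e ->
  cder (fun s => f s * g s) z (d * g z + f z * e).
Proof. by move=> fd gd; apply: cderivM => //; exact: cder_cont gd. Qed.
Lemma rderM f g z d e : rder f z d -> rder g z e ->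
  rder (fun s => f s * g s) z (d * g z + f z * e).
Proof. by move=> fd gd; apply: cderivM => //; exact: rder_cont gd. Qed.
Lemma cderV f z d : f z != 0 -> cder f z d ->
  cder (fun s => (f s)^-1) z (- d / (f z) ^+ 2).
Proof. by move=> f0 fd; apply: cderivV => //; exact: cder_cont fd. Qed.
Lemma cder_comp f g z d e : cder f z d -> cder g (f z) e ->
  cder (fun s => g (f s)) z (e * d).
Proof. by move=> fd; apply: cderiv_comp => //; exact: cder_cont fd. Qed.
Lemma rder_comp f g z d e : rder f z d -> cder g (f z) e ->
  rder (fun s => g (f s)) z (e * d).
Proof. by move=> fd; apply: cderiv_comp => //; exact: rder_cont fd. Qed.

Lemma is_derive_cderP (f : C -> C) z d :
  is_derive z (1 : C) f d <-> cder f z d.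
Proof. exact: is_derive_cderivP. Qed.

Lemma derivable_cder (f : C -> C) z :
  derivable f z (1 : C) -> cder f z ('D_(1 : C) f z).
Proof. by move=> fz; apply/is_derive_cderP; split. Qed.

Lemma is_derive_caratheodory (f q : R -> R) (t d : R) : ctsat q t ->
  q t = d -> (\forall s \near t, f s - f t = q s * (s - t)) ->
  is_derive t 1 f d.
Proof.
move=> qc qt fq.
have H : (fun h : R => h^-1 *: (f (h *: 1 + t) - f t)) @ 0^' --> d.
  have qh : q (h + t) @[h --> 0^'] --> d.
    apply: cvg_within_filter.
    have : ctsat (fun h => q (h + t)) 0.
      apply: ctsat_comp; last by rewrite add0r.
      apply: contC_D; last exact: contC_cst.
      by apply: Ctsat; exact: cvg_id.
    by case; rewrite add0r qt.
  apply: cvg_trans qh; apply: near_eq_cvg.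
  have sh : (h + t) @[h --> (0:R)] --> t.
    have : ctsat (fun h => h + t) 0.
      apply: contC_D; last exact: contC_cst.
      by apply: Ctsat; exact: cvg_id.
    by case; rewrite add0r.
  have := sh _ fq; rewrite /= => /nbhs_ballP[r /= r0 rH].
  apply/nbhs_ballP; exists r => //= h hr h0.
  have := rH _ hr; rewrite /= addrK => Hh.
  by rewrite /GRing.scale /= mulr1 Hh mulrC mulfK.
split; first by apply/cvg_ex; exists d.
exact: cvg_lim H.
Qed.

Lemma caratheodory_is_derive (f : R -> R) (t d : R) : is_derive t 1 f d ->
  exists q : R -> R, [/\ ctsat q t, q t = d &
     forall s, f s - f t = q s * (s - t)].
Proof.
move=> [fz fd].
pose q w := if w == t then d else (f w - f t) / (w - t).
exists q; split; rewrite /q ?eqxx//.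
+ apply: Ctsat; apply/continuous_withinNx; rewrite eqxx.
  have : (fun h : R => h^-1 *: (f (h *: 1 + t) - f t)) @ 0^' --> d.
    by rewrite -fd; exact: fz.
  move=> /cvgrPdist_lt H; apply/cvgrPdist_lt => e /H; rewrite !near_withinE.
  move=> /nbhs_ballP[r /= r0 rH]; apply/nbhs_ballP; exists r => //= w /= wr wz.
  rewrite (negbTE wz).
  have := rH (w - t); rewrite /= subr_eq0 wz /= => /(_ _ isT).
  rewrite -ball_normE /= sub0r normrN -normrN opprB.
  move: wr; rewrite -ball_normE /= => wr /(_ wr).
  by rewrite /GRing.scale /= mulr1 subrK mulrC.
+ move=> w; case: eqVneq => [->|wz]; first by rewrite !subrr mulr0.
  by rewrite divfK// subr_eq0.
Qed.

Lemma rder_re f t d : rder f t d -> is_derive t 1 (fun s => re (f s)) (re d).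
Proof.
move=> [q [qc qt fq]]; apply: (@is_derive_caratheodory _ (re \o q)).
- exact: contC_re.
- by rewrite /= qt.
- by apply: filterS fq => s fq; rewrite -reB fq -inCB reM /= mulr0 subr0.
Qed.

Lemma rder_im f t d : rder f t d -> is_derive t 1 (fun s => im (f s)) (im d).
Proof.
move=> [q [qc qt fq]]; apply: (@is_derive_caratheodory _ (im \o q)).
- exact: contC_im.
- by rewrite /= qt.
- by apply: filterS fq => s fq; rewrite -imB fq -inCB imM /= mulr0 add0r.
Qed.

Lemma rder_mkc (f g : R -> R) (t a b : R) : is_derive t 1 f a -> is_derive t 1 g b ->
  rder (fun s => mkc (f s) (g s)) t (mkc a b).
Proof.
move=> /caratheodory_is_derive[p [pc pt fp]] /caratheodory_is_derive[q [qc qt gq]].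
exists (fun s => mkc (p s) (q s)); split; [|by rewrite pt qt|].
- exact: contC_mkc.
- apply: (@filterE _ (nbhs t)) => s; rewrite -inCB; apply: cplx_eqP; rewrite !reimE /=.
    by rewrite mulr0 subr0 fp.
  by rewrite mulr0 add0r gq.
Qed.

Lemma rder_line (p e : C) t : rder (fun s => p + inC s * e) t e.
Proof.
exists (fun=> e); split=> //; first exact: contC_cst.
by apply: (@filterE _ (nbhs t)) => s; rewrite opprD addrACA subrr add0r -mulrBl mulrC.
Qed.

Lemma rder_compR (f : R -> C) (h : R -> R) (t : R) (d : C) (a : R) :
  is_derive t 1 h a -> rder f (h t) d -> rder (fun s => f (h s)) t (inC a * d).
Proof.
move=> ha; have := caratheodory_is_derive ha => -[p [pc pt hp]] [q [qc qt fq]].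
have hc : ctsat h t.
  apply: Ctsat; apply: differentiable_continuous; apply/derivable1_diffP.
  by case: ha.
exists (fun s => inC (p s) * q (h s)); split.
- by apply: contC_M; [exact: contC_inC|exact: ctsat_comp].
- by rewrite pt qt.
- have fq' : \forall s \near t, f (h s) - f (h t) = q (h s) * (inC (h s) - inC (h t)).
    case: hc => hc; exact: (hc [set w | f w - f (h t) = q w * (inC w - inC (h t))]).
  by apply: filterS fq' => s ->; rewrite -!inCB hp inCM; ring.
Qed.

End ComplexDerivative.

(** * Integrals over segments *)

Section RealSegmentIntegral.
Context {R : realType}.
Local Notation mu := (@lebesgue_measure R).
Implicit Types (u v : R -> R) (a b c : R).

(** Continuity, in the whole line, at every point of a segment. *)
Definition contI {U : topologicalType} (f : R -> U) a b :=
  forall t, a <= t <= b -> ctsat f t.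

Lemma contI_sub {U : topologicalType} (f : R -> U) a b c d :
  a <= c -> d <= b -> contI f a b -> contI f c d.
Proof.
move=> ac db fab t /andP[ct td]; apply: fab.
by rewrite (le_trans ac ct) (le_trans td db).
Qed.

(** The integral of a real function over a segment. *)
Definition rint u a b : R := \int[mu]_(t in `[a, b]) u t.

Lemma contI_within u a b : contI u a b -> {within `[a, b], continuous u}.
Proof.
move=> uc; apply: continuous_in_subspaceT => t.
by rewrite inE /= in_itv /= => /uc[].
Qed.

Lemma rint_integrable u a b : contI u a b -> mu.-integrable `[a, b] (EFin \o u).
Proof.
move=> uc; apply: continuous_compact_integrable; first exact: segment_compact.
exact: contI_within.
Qed.

Lemma rint_cat u a b c : a <= b -> b <= c -> contI u a c ->
  rint u a c = rint u a b + rint u b c.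
Proof.
move=> ab bc uc; have iu := rint_integrable uc.
apply/eqP; rewrite addrC -subr_eq; apply/eqP.
rewrite /rint Rintegral_itvB//.
rewrite Rintegral_itv_obnd_cbnd//.
apply: integrableS (rint_integrable (contI_sub ab (lexx c) uc)) => //.
by apply: subset_itv; rewrite // bnd_simp.
Qed.

Lemma rintD u v a b : contI u a b -> contI v a b ->
  rint (fun t => u t + v t) a b = rint u a b + rint v a b.
Proof. by move=> uc vc; rewrite /rint RintegralD//; exact: rint_integrable. Qed.

Lemma rintZ u a b k : contI u a b -> rint (fun t => k * u t) a b = k * rint u a b.
Proof. by move=> uc; rewrite /rint RintegralZl//; exact: rint_integrable. Qed.

Lemma contI_cst a b k : contI (fun=> k : R) a b.
Proof. by move=> t _; apply: Ctsat; exact: cvg_cst. Qed.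

Lemma rint_cst a b k : a <= b -> rint (fun=> k) a b = k * (b - a).
Proof.
move=> ab; rewrite /rint Rintegral_cst//=.
by rewrite lebesgue_measure_itv /= lte_fin; case: ltgtP ab => //= -> _; rewrite subrr.
Qed.

Lemma le_rint u v a b : contI u a b -> contI v a b ->
  (forall t, a <= t <= b -> u t <= v t) -> rint u a b <= rint v a b.
Proof.
move=> uc vc uv; apply: le_Rintegral; [by []|exact: rint_integrable|exact: rint_integrable|].
by move=> t /=; rewrite in_itv /=; exact: uv.
Qed.

Lemma rint_bound u a b M : a <= b -> contI u a b ->
  (forall t, a <= t <= b -> `|u t| <= M) -> `|rint u a b| <= M * (b - a).
Proof.
move=> ab uc uM; rewrite -[M * _](rint_cst M ab).
rewrite ler_norml; apply/andP; split.
  rewrite rint_cst// -mulNr -rint_cst//; apply: le_rint => //; first exact: contI_cst.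
  by move=> t /uM; rewrite ler_norml => /andP[].
apply: le_rint => //; first exact: contI_cst.
by move=> t /uM; rewrite ler_norml => /andP[].
Qed.

Lemma is_derive_ctsat u (t d : R) : is_derive t 1 u d -> ctsat u t.
Proof.
move=> [ud _]; apply: Ctsat; apply: differentiable_continuous.
exact/derivable1_diffP.
Qed.

Lemma rint_ftc u (U : R -> R) a b : a <= b -> contI u a b ->
  (forall t, a <= t <= b -> is_derive t 1 U (u t)) -> rint u a b = U b - U a.
Proof.
move=> ab uc dU; have Uc : contI U a b by move=> t /dU; exact: is_derive_ctsat.
move: ab; rewrite le_eqVlt => /predU1P[<-|ab].
  by rewrite /rint set_itv1 Rintegral_set1 subrr.
rewrite /rint /Rintegral (@continuous_FTC2 _ u U)//.
- exact: contI_within.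
- split.
  + by move=> t; rewrite in_itv /= => /andP[/ltW at_ /ltW tb]; case: (dU t); rewrite ?at_.
  + by apply: cvg_at_right_filter; case: (Uc a); rewrite ?lexx ?ltW.
  + by apply: cvg_at_left_filter; case: (Uc b); rewrite ?lexx ?ltW.
- move=> t; rewrite in_itv /= => /andP[/ltW at_ /ltW tb]; rewrite derive1E.
  by case: (dU t); rewrite ?at_.
Qed.
End RealSegmentIntegral.

Section ComplexSegmentIntegral.
Context {R : realType}.
Local Notation C := (cplx R).
Implicit Types (f g : R -> C) (a b c : R).

(** The integral of a complex-valued function over a segment. *)
Definition cint f a b : C :=
  mkc (rint (fun t => re (f t)) a b) (rint (fun t => im (f t)) a b).

Lemma contI_re f a b : contI f a b -> contI (fun t => re (f t)) a b.
Proof. by move=> fc t /fc; exact: contC_re. Qed.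
Lemma contI_im f a b : contI f a b -> contI (fun t => im (f t)) a b.
Proof. by move=> fc t /fc; exact: contC_im. Qed.

Lemma cint_cat f a b c : a <= b -> b <= c -> contI f a c ->
  cint f a c = cint f a b + cint f b c.
Proof.
move=> ab bc fc; rewrite /cint; apply: cplx_eqP; rewrite !reimE /=.
  exact: rint_cat (contI_re fc).
exact: rint_cat (contI_im fc).
Qed.

Lemma eq_rint (u v : R -> R) a b : (forall t, a <= t <= b -> u t = v t) ->
  rint u a b = rint v a b.
Proof.
by move=> uv; apply: eq_Rintegral => t; rewrite inE /= in_itv /=; exact: uv.
Qed.

Lemma eq_cint f g a b : (forall t, a <= t <= b -> f t = g t) ->
  cint f a b = cint g a b.
Proof.
by move=> fg; rewrite /cint; congr mkc; apply: eq_rint => t /fg ->.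
Qed.

Lemma contRM (u v : R -> R) t : ctsat u t -> ctsat v t -> ctsat (fun s => u s * v s) t.
Proof. by move=> *; exact: contC_M. Qed.

Lemma cintD f g a b : contI f a b -> contI g a b ->
  cint (fun t => f t + g t) a b = cint f a b + cint g a b.
Proof.
move=> fc gc; apply: cplx_eqP; rewrite !reimE /=.
  rewrite -rintD; [|exact: contI_re|exact: contI_re].
  by apply: eq_rint => t _; rewrite reD.
rewrite -rintD; [|exact: contI_im|exact: contI_im].
by apply: eq_rint => t _; rewrite imD.
Qed.

Lemma cintZ f a b (k : C) : contI f a b ->
  cint (fun t => k * f t) a b = k * cint f a b.
Proof.
move=> fc; have rc := contI_re fc; have ic := contI_im fc.
have Zc : forall (l : R) u, contI u a b -> contI (fun t => l * u t) a b.
  by move=> l u uc t tab; apply: contRM; [exact: contI_cst tab|exact: uc].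
apply: cplx_eqP; rewrite !reimE /=.
  rewrite -(rintZ (re k))// -mulNr -(rintZ (- im k))//.
  rewrite -rintD; [|exact: Zc|exact: Zc].
  by apply: eq_rint => t _; rewrite reM mulNr.
rewrite -(rintZ (re k))// -(rintZ (im k))// -rintD; [|exact: Zc|exact: Zc].
by apply: eq_rint => t _; rewrite imM.
Qed.

(** The factor 2 comes from bounding the two coordinates separately. *)
Lemma cint_bound f a b M : a <= b -> contI f a b ->
  (forall t, a <= t <= b -> cm (f t) <= M) -> cm (cint f a b) <= 2 * M * (b - a).
Proof.
move=> ab fc fM; rewrite (le_trans (cm_le _))//= -mulrA mulr_natl mulr2n lerD//.
  apply: rint_bound => //; first exact: contI_re.
  by move=> t /fM; apply: le_trans; exact: re_le_cm.
apply: rint_bound => //; first exact: contI_im.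
by move=> t /fM; apply: le_trans; exact: im_le_cm.
Qed.

Lemma cint_ftc f F a b : a <= b -> contI f a b ->
  (forall t, a <= t <= b -> rder F t (f t)) -> cint f a b = F b - F a.
Proof.
move=> ab fc dF; apply: cplx_eqP; rewrite ?reB ?imB /=.
  apply: (rint_ftc (U := fun t => re (F t))) => //; first exact: contI_re.
  by move=> t /dF; exact: rder_re.
apply: (rint_ftc (U := fun t => im (F t))) => //; first exact: contI_im.
by move=> t /dF; exact: rder_im.
Qed.
End ComplexSegmentIntegral.

(** * Goursat's theorem for rectangles *)

Section RectangleIntegral.
Context {R : realType}.
Local Notation C := (cplx R).
Implicit Types (f g : C -> C).

(** Integrals of [f dz] along a horizontal and along a vertical segment. *)
Definition hseg f (y a b : R) : C := cint (fun t => f (mkc t y)) a b.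
Definition vseg f (x a b : R) : C := iC * cint (fun t => f (mkc x t)) a b.

(** The integral of [f] along the boundary of a rectangle, counterclockwise. *)
Definition bint f (x0 x1 y0 y1 : R) : C :=
  hseg f y0 x0 x1 + vseg f x1 y0 y1 - hseg f y1 x0 x1 - vseg f x0 y0 y1.

(** Continuity at every point of a closed rectangle. *)
Definition contR f (x0 x1 y0 y1 : R) :=
  forall x y, x0 <= x <= x1 -> y0 <= y <= y1 -> ctsat f (mkc x y).

Lemma ctsat_idR (t : R) : ctsat (fun s : R => s) t.
Proof. by apply: Ctsat; exact: cvg_id. Qed.
Lemma ctsat_cstR (a t : R) : ctsat (fun _ : R => a) t.
Proof. by apply: Ctsat; exact: cvg_cst. Qed.

Lemma contI_h f y a b : (forall x, a <= x <= b -> ctsat f (mkc x y)) ->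
  contI (fun t => f (mkc t y)) a b.
Proof.
move=> fc t tab; apply: ctsat_comp; last exact: fc.
by apply: contC_mkc; [exact: ctsat_idR|exact: ctsat_cstR].
Qed.

Lemma contI_v f x a b : (forall y, a <= y <= b -> ctsat f (mkc x y)) ->
  contI (fun t => f (mkc x t)) a b.
Proof.
move=> fc t tab; apply: ctsat_comp; last exact: fc.
by apply: contC_mkc; [exact: ctsat_cstR|exact: ctsat_idR].
Qed.

Lemma contR_sub f x0 x1 y0 y1 a0 a1 b0 b1 :
  x0 <= a0 -> a1 <= x1 -> y0 <= b0 -> b1 <= y1 ->
  contR f x0 x1 y0 y1 -> contR f a0 a1 b0 b1.
Proof.
move=> h1 h2 h3 h4 fc x y /andP[? ?] /andP[? ?]; apply: fc.
  by apply/andP; split; [exact: le_trans h1 _|exact: le_trans _ h2].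
by apply/andP; split; [exact: le_trans h3 _|exact: le_trans _ h4].
Qed.

Lemma contR_h f x0 x1 y0 y1 y : contR f x0 x1 y0 y1 -> y0 <= y <= y1 ->
  contI (fun t => f (mkc t y)) x0 x1.
Proof. by move=> fc yy; apply: contI_h => x xx; exact: fc. Qed.

Lemma contR_v f x0 x1 y0 y1 x : contR f x0 x1 y0 y1 -> x0 <= x <= x1 ->
  contI (fun t => f (mkc x t)) y0 y1.
Proof. by move=> fc xx; apply: contI_v => y yy; exact: fc. Qed.

(** The boundary of a rectangle, and continuity at its points. *)
Definition onB (x0 x1 y0 y1 x y : R) :=
  [/\ x0 <= x <= x1, y0 <= y <= y1 & x = x0 \/ x = x1 \/ y = y0 \/ y = y1].

Definition contB f x0 x1 y0 y1 :=
  forall x y, onB x0 x1 y0 y1 x y -> ctsat f (mkc x y).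

Lemma contR_B f x0 x1 y0 y1 : contR f x0 x1 y0 y1 -> contB f x0 x1 y0 y1.
Proof. by move=> fc x y [xx yy _]; exact: fc. Qed.

Lemma contB_h f x0 x1 y0 y1 y : contB f x0 x1 y0 y1 -> y0 <= y1 ->
  y = y0 \/ y = y1 -> contI (fun t => f (mkc t y)) x0 x1.
Proof.
move=> fc y01 yy; apply: contI_h => x xx; apply: fc.
by split=> //; [case: yy => ->; rewrite lexx y01|case: yy; tauto].
Qed.

Lemma contB_v f x0 x1 y0 y1 x : contB f x0 x1 y0 y1 -> x0 <= x1 ->
  x = x0 \/ x = x1 -> contI (fun t => f (mkc x t)) y0 y1.
Proof.
move=> fc x01 xx; apply: contI_v => y yy; apply: fc.
by split=> //; [case: xx => ->; rewrite lexx x01|case: xx; tauto].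
Qed.

Lemma bint_catx f x0 x1 x2 y0 y1 : x0 <= x1 -> x1 <= x2 -> y0 <= y1 ->
  contR f x0 x2 y0 y1 ->
  bint f x0 x2 y0 y1 = bint f x0 x1 y0 y1 + bint f x1 x2 y0 y1.
Proof.
move=> x01 x12 y01 fc; rewrite /bint /hseg !(cint_cat x01 x12).
- by ring.
- by apply: contR_h fc _; rewrite lexx y01.
- by apply: contR_h fc _; rewrite lexx y01.
Qed.

Lemma bint_caty f x0 x1 y0 y1 y2 : x0 <= x1 -> y0 <= y1 -> y1 <= y2 ->
  contR f x0 x1 y0 y2 ->
  bint f x0 x1 y0 y2 = bint f x0 x1 y0 y1 + bint f x0 x1 y1 y2.
Proof.
move=> x01 y01 y12 fc; rewrite /bint /vseg !(cint_cat y01 y12).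
- by ring.
- by apply: contR_v fc _; rewrite lexx x01.
- by apply: contR_v fc _; rewrite lexx x01.
Qed.

Lemma bint_bound f x0 x1 y0 y1 M : x0 <= x1 -> y0 <= y1 ->
  contB f x0 x1 y0 y1 ->
  (forall x y, onB x0 x1 y0 y1 x y -> cm (f (mkc x y)) <= M) ->
  cm (bint f x0 x1 y0 y1) <= 4 * M * ((x1 - x0) + (y1 - y0)).
Proof.
move=> x01 y01 fc fM.
have hb y : y = y0 \/ y = y1 -> cm (hseg f y x0 x1) <= 2 * M * (x1 - x0).
  move=> yy; apply: cint_bound => //; first exact: contB_h fc y01 yy.
  move=> t tt; apply: fM; split=> //; last by tauto.
  by case: yy => ->; rewrite lexx y01.
have vb x : x = x0 \/ x = x1 -> cm (vseg f x y0 y1) <= 2 * M * (y1 - y0).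
  move=> xx; rewrite cmM cm_iC mul1r.
  apply: cint_bound => //; first exact: contB_v fc x01 xx.
  move=> t tt; apply: fM; split=> //; last by tauto.
  by case: xx => ->; rewrite lexx x01.
have := hb y0 (or_introl erefl); have := hb y1 (or_intror erefl).
have := vb x0 (or_introl erefl); have := vb x1 (or_intror erefl).
have := cmB (hseg f y0 x0 x1 + vseg f x1 y0 y1 - hseg f y1 x0 x1) (vseg f x0 y0 y1).
have := cmB (hseg f y0 x0 x1 + vseg f x1 y0 y1) (hseg f y1 x0 x1).
have := cmD (hseg f y0 x0 x1) (vseg f x1 y0 y1).
rewrite /bint; move=> *; lra.
Qed.

Lemma rder_h (f : C -> C) y t d : cder f (mkc t y) d -> rder (fun s => f (mkc s y)) t d.
Proof.
move=> fd; rewrite -[d]mulr1; apply: (rder_comp (f := fun s => mkc s y) _ fd).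
rewrite (_ : 1 = mkc 1 0)//; exact: rder_mkc.
Qed.

Lemma rder_v (f : C -> C) x t d : cder f (mkc x t) d -> rder (fun s => f (mkc x s)) t (d * iC).
Proof.
move=> fd; apply: (rder_comp (f := fun s => mkc x s) _ fd).
exact: rder_mkc.
Qed.

Lemma bint_exact f F x0 x1 y0 y1 : x0 <= x1 -> y0 <= y1 ->
  contB f x0 x1 y0 y1 ->
  (forall x y, onB x0 x1 y0 y1 x y -> cder F (mkc x y) (f (mkc x y))) ->
  bint f x0 x1 y0 y1 = 0.
Proof.
move=> x01 y01 fc dF.
have hE y : y = y0 \/ y = y1 -> hseg f y x0 x1 = F (mkc x1 y) - F (mkc x0 y).
  move=> yy; apply: (cint_ftc (F := fun t => F (mkc t y))) => //.
    exact: contB_h fc y01 yy.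
  move=> t tt; apply: rder_h; apply: dF; split=> //; last by tauto.
  by case: yy => ->; rewrite lexx y01.
have vE x : x = x0 \/ x = x1 -> vseg f x y0 y1 = F (mkc x y1) - F (mkc x y0).
  move=> xx; have fx := contB_v fc x01 xx; rewrite /vseg -cintZ//.
  apply: (cint_ftc (F := fun t => F (mkc x t))) => //.
    by move=> t tt; apply: contC_M; [exact: contC_cst|exact: fx].
  move=> t tt; rewrite mulrC; apply: rder_v; apply: dF; split=> //; last by tauto.
  by case: xx => ->; rewrite lexx x01.
by rewrite /bint !hE ?vE; try tauto; ring.
Qed.

Lemma contBZ f x0 x1 y0 y1 (k : C) : contB f x0 x1 y0 y1 ->
  contB (fun z => k * f z) x0 x1 y0 y1.
Proof. by move=> fc x y xy; apply: contC_M; [exact: contC_cst|exact: fc]. Qed.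

Lemma bintD f g x0 x1 y0 y1 : x0 <= x1 -> y0 <= y1 ->
  contB f x0 x1 y0 y1 -> contB g x0 x1 y0 y1 ->
  bint (fun z => f z + g z) x0 x1 y0 y1 = bint f x0 x1 y0 y1 + bint g x0 x1 y0 y1.
Proof.
move=> x01 y01 fc gc; have L := @or_introl; have Rr := @or_intror.
rewrite /bint /hseg /vseg (cintD (contB_h fc y01 _) (contB_h gc y01 _)); try tauto.
rewrite (cintD (contB_h fc y01 _) (contB_h gc y01 _)); try tauto.
rewrite (cintD (contB_v fc x01 _) (contB_v gc x01 _)); try tauto.
rewrite (cintD (contB_v fc x01 _) (contB_v gc x01 _)); try tauto.
by ring.
Qed.

Lemma bintZ f x0 x1 y0 y1 (k : C) : x0 <= x1 -> y0 <= y1 ->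
  contB f x0 x1 y0 y1 ->
  bint (fun z => k * f z) x0 x1 y0 y1 = k * bint f x0 x1 y0 y1.
Proof.
move=> x01 y01 fc.
rewrite /bint /hseg /vseg (cintZ _ (contB_h fc y01 _)); try tauto.
rewrite (cintZ _ (contB_h fc y01 _)); try tauto.
rewrite (cintZ _ (contB_v fc x01 _)); try tauto.
rewrite (cintZ _ (contB_v fc x01 _)); try tauto.
by ring.
Qed.

Lemma bintB f g x0 x1 y0 y1 : x0 <= x1 -> y0 <= y1 ->
  contB f x0 x1 y0 y1 -> contB g x0 x1 y0 y1 ->
  bint (fun z => f z - g z) x0 x1 y0 y1 = bint f x0 x1 y0 y1 - bint g x0 x1 y0 y1.
Proof.
move=> x01 y01 fc gc.
have -> : (fun z => f z - g z) = (fun z => f z + (-1) * g z).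
  by apply/funext => z; rewrite mulN1r.
by rewrite bintD ?bintZ ?mulN1r//; exact: contBZ.
Qed.

Lemma eq_bint f g x0 x1 y0 y1 : x0 <= x1 -> y0 <= y1 ->
  (forall x y, onB x0 x1 y0 y1 x y -> f (mkc x y) = g (mkc x y)) ->
  bint f x0 x1 y0 y1 = bint g x0 x1 y0 y1.
Proof.
move=> x01 y01 fg; rewrite /bint /hseg /vseg.
by congr (_ + _ - _ - _); try congr (_ * _); apply: eq_cint => t tt; apply: fg;
  split; rewrite ?lexx ?x01 ?y01//; tauto.
Qed.
End RectangleIntegral.

Section Goursat.
Context {R : realType}.
Local Notation C := (cplx R).

Lemma nested_intervals (a w : nat -> R) : (forall n, 0 <= w n) ->
  (forall n, a n <= a n.+1) -> (forall n, a n.+1 + w n.+1 <= a n + w n) ->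
  exists l, forall n, a n <= l <= a n + w n.
Proof.
move=> w0 ainc bdec.
have amon m n : (m <= n)%N -> a m <= a n.
  move/subnKC <-; elim: (n - m)%N => [|k IH]; first by rewrite addn0.
  by rewrite addnS (le_trans IH).
have bmon m n : (m <= n)%N -> a n + w n <= a m + w m.
  move/subnKC <-; elim: (n - m)%N => [|k IH]; first by rewrite addn0.
  by rewrite addnS (le_trans _ IH).
have ab m n : a m <= a n + w n.
  have [mn|/ltnW nm] := leqP m n.
    by rewrite (le_trans (amon _ _ mn))// lerDl.
  by rewrite (le_trans _ (bmon _ _ nm))// lerDl.
have ubA n : ubound [set a k | k in setT] (a n + w n).
  by move=> _ [k _ <-]; exact: ab.
exists (sup [set a k | k in setT]) => n; apply/andP; split.
  apply: ub_le_sup; last by exists n.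
  by exists (a 0%N + w 0%N); exact: ubA.
by apply: ge_sup; [exists (a 0%N), 0%N|exact: ubA].
Qed.

(** Halving a length often enough makes it smaller than any positive number. *)
Lemma half_pow_lt (c d : R) : 0 <= c -> 0 < d -> exists n : nat, c * 2^-1 ^+ n < d.
Proof.
move=> c0 d0; exists (Num.bound (c / d)).
have := archi_boundP (divr_ge0 c0 (ltW d0)); set n := Num.bound _ => cdn.
rewrite exprVn ltr_pdivrMr ?exprn_gt0// mulrC -ltr_pdivrMr//.
rewrite (lt_trans cdn)// -natrX ltr_nat; exact: ltn_expl.
Qed.

Lemma bint_quarters (f : C -> C) (x y a b : R) : 0 <= a -> 0 <= b ->
  contR f x (x + (a + a)) y (y + (b + b)) ->
  bint f x (x + (a + a)) y (y + (b + b)) =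
  bint f x (x + a) y (y + b) + bint f x (x + a) (y + b) (y + b + b) +
  bint f (x + a) (x + a + a) y (y + b) +
  bint f (x + a) (x + a + a) (y + b) (y + b + b).
Proof.
rewrite !(addrA x a a) !(addrA y b b) => a0 b0 fc.
have xa : x <= x + a by rewrite lerDl.
have xaa : x + a <= x + a + a by rewrite lerDl.
have yb : y <= y + b by rewrite lerDl.
have ybb : y + b <= y + b + b by rewrite lerDl.
rewrite (bint_catx xa xaa (le_trans yb ybb) fc).
rewrite (bint_caty xa yb ybb (contR_sub (lexx _) xaa (lexx _) (lexx _) fc)).
rewrite (bint_caty xaa yb ybb (contR_sub xa (lexx _) (lexx _) (lexx _) fc)).
exact: addrA.
Qed.

(** Goursat's theorem, by repeated bisection of both sides. *)
Theorem goursat (f : C -> C) (x0 x1 y0 y1 : R) : x0 <= x1 -> y0 <= y1 ->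
  (forall x y, x0 <= x <= x1 -> y0 <= y <= y1 -> exists d, cder f (mkc x y) d) ->
  bint f x0 x1 y0 y1 = 0.
Proof.
move=> x01 y01 fd.
pose w := x1 - x0; pose h := y1 - y0.
have w0 : 0 <= w by rewrite subr_ge0.
have h0 : 0 <= h by rewrite subr_ge0.
pose s n : R := 2^-1 ^+ n.
have s0 n : 0 < s n by rewrite exprn_gt0// invr_gt0.
have sS n : s n = s n.+1 + s n.+1.
  by rewrite /s exprS; field.
have fc : contR f x0 x1 y0 y1.
  by move=> x y xx yy; have [d /cder_cont] := fd x y xx yy.
pose B n (p : R * R) := cm (bint f p.1 (p.1 + w * s n) p.2 (p.2 + h * s n)).
(* [next] keeps a quarter that carries at least a quarter of the integral. *)
pose kap := B 0%N (x0, y0).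
pose big n p := kap * s n ^+ 2 <= B n p.
pose next n (p : R * R) : R * R :=
  if big n.+1 p then p else
  if big n.+1 (p.1 + w * s n.+1, p.2) then (p.1 + w * s n.+1, p.2) else
  if big n.+1 (p.1, p.2 + h * s n.+1) then (p.1, p.2 + h * s n.+1) else
  (p.1 + w * s n.+1, p.2 + h * s n.+1).
pose P := fix P n := if n is m.+1 then next m (P m) else (x0, y0).
have nextx n p : p.1 <= (next n p).1 /\
    (next n p).1 + w * s n.+1 <= p.1 + w * s n.
  have ws : 0 <= w * s n.+1 by rewrite mulr_ge0// ltW.
  by rewrite (sS n) mulrDr /next; do 3?[case: ifP => _ /=]; split; lra.
have nexty n p : p.2 <= (next n p).2 /\
    (next n p).2 + h * s n.+1 <= p.2 + h * s n.
  have ws : 0 <= h * s n.+1 by rewrite mulr_ge0// ltW.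
  by rewrite (sS n) mulrDr /next; do 3?[case: ifP => _ /=]; split; lra.
(* The chosen rectangles shrink to a point [l]. *)
have [lx Hlx] := @nested_intervals (fun n => (P n).1) (fun n => w * s n)
  (fun n => mulr_ge0 w0 (ltW (s0 n))) (fun n => (nextx n (P n)).1) (fun n => (nextx n (P n)).2).
have [ly Hly] := @nested_intervals (fun n => (P n).2) (fun n => h * s n)
  (fun n => mulr_ge0 h0 (ltW (s0 n))) (fun n => (nexty n (P n)).1) (fun n => (nexty n (P n)).2).
have inx n : x0 <= (P n).1 /\ (P n).1 + w * s n <= x1.
  elim: n => [|n [IH1 IH2]] /=; first by rewrite /s expr0 mulr1 /w; split; lra.
  by have [? ?] := nextx n (P n); split; lra.
have iny n : y0 <= (P n).2 /\ (P n).2 + h * s n <= y1.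
  elim: n => [|n [IH1 IH2]] /=; first by rewrite /s expr0 mulr1 /h; split; lra.
  by have [? ?] := nexty n (P n); split; lra.
have bigP n : big n (P n).
  elim: n => [|n IH]; first by rewrite /big /s expr0 expr1n mulr1.
  rewrite /= /next; case: ifP => // b1; case: ifP => // b2; case: ifP => // b3.
  have [ix1 ix2] := inx n; have [iy1 iy2] := iny n.
  have sS2 : s n ^+ 2 = 4 * s n.+1 ^+ 2 by rewrite sS; ring.
  move: b1 b2 b3 IH; rewrite /big /B /= sS2 (sS n) !mulrDr.
  set p := P n; set a := w * s n.+1; set b := h * s n.+1.
  have a0 : 0 <= a by rewrite mulr_ge0// ltW.
  have b0 : 0 <= b by rewrite mulr_ge0// ltW.
  move=> /negbT; rewrite -ltNge => b1 /negbT; rewrite -ltNge => b2 /negbT.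
  rewrite -ltNge => b3.
  have fcn : contR f p.1 (p.1 + (a + a)) p.2 (p.2 + (b + b)).
    apply: contR_sub fc => //.
      by rewrite -mulrDr -sS.
    by rewrite -mulrDr -sS.
  rewrite (bint_quarters a0 b0 fcn).
  move=> IH; rewrite leNgt; apply/negP => b4.
  move: IH; apply/negP; rewrite -ltNge; apply: (le_lt_trans (cmD _ _)).
  apply: (@lt_le_trans _ _ (kap * s n.+1 ^+ 2 + kap * s n.+1 ^+ 2 + kap * s n.+1 ^+ 2 + kap * s n.+1 ^+ 2)).
    apply: ltrD => //; apply: (le_lt_trans (cmD _ _)); apply: ltrD => //.
    by apply: (le_lt_trans (cmD _ _)); apply: ltrD.
  by rewrite le_eqVlt; apply/orP; left; apply/eqP; ring.
suff : kap <= 0.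
  rewrite /kap /B /s expr0 !mulr1 /= /w /h !(addrC _ (_ - _)) !subrK.
  by move=> k0; apply/eqP; rewrite -cm_eq0 eq_le k0 cm_ge0.
have lxx : x0 <= lx <= x1 by have := Hlx 0%N; rewrite /s expr0 mulr1 /w /=; lra.
have lyy : y0 <= ly <= y1 by have := Hly 0%N; rewrite /s expr0 mulr1 /h /=; lra.
have [d [q [[qc] qd fq]]] := fd lx ly lxx lyy.
set l := mkc lx ly in qc qd fq *.
(* On a small rectangle around [l] the function differs from its affine part,
   whose integral vanishes, by at most [e] times the distance to [l]. *)
have key e : 0 < e -> kap <= 4 * e * (w + h) ^+ 2.
  move=> e0.
  have /nbhsC[dl dl0 dlP] : \forall z \near l,
      cm (q z - q l) < e /\ f z - f l = q z * (z - l).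
    by move/cvgC : qc => /(_ _ e0); apply: filterS2 fq => z.
  have [n Hn] := half_pow_lt (addr_ge0 w0 h0) dl0.
  have := bigP n; rewrite /big /B.
  set p := P n; set a := w * s n; set b := h * s n.
  have := Hlx n; have := Hly n; rewrite -/p -/a -/b => lyn lxn.
  have a0 : 0 <= a by rewrite mulr_ge0// ltW.
  have b0 : 0 <= b by rewrite mulr_ge0// ltW.
  have [ix1 ix2] := inx n; have [iy1 iy2] := iny n.
  have fcn : contR f p.1 (p.1 + a) p.2 (p.2 + b) by apply: contR_sub fc.
  pose A z := f l + d * (z - l).
  have dA z : cder A z d.
    rewrite -[d]add0r; apply: cderivD; first exact: cderiv_cst.
    rewrite -[X in cderiv _ _ _ X]mulr1 -[X in _ * X](subr0 1).
    by apply: cderivZ; apply: cderivB; [exact: cderiv_emb|exact: cderiv_cst].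
  have Ac : contR A p.1 (p.1 + a) p.2 (p.2 + b).
    by move=> x y _ _; exact: cder_cont (dA _).
  have A0 : bint A p.1 (p.1 + a) p.2 (p.2 + b) = 0.
    apply: (@bint_exact _ A (fun z => f l * z + d * (2^-1 * ((z - l) * (z - l))))).
    - by rewrite lerDl.
    - by rewrite lerDl.
    - exact: contR_B.
    - move=> x y _; rewrite /A.
      have dz : cder (fun z => z - l) (mkc x y) (1 - 0).
        by apply: cderivB; [exact: cderiv_emb|exact: cderiv_cst].
      apply: cderivD.
        by rewrite -[X in cderiv _ _ _ X]mulr1; apply: cderivZ; exact: cderiv_emb.
      apply: cderivZ; apply: cderiv_eq; first by apply: cderivZ; exact: (cderM dz dz).
      by rewrite subr0 mul1r mulr1 -[X in _ * (X + X)]mul1r -mulrDl mulrA mulVf ?mul1r// pnatr_eq0.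
  have -> : bint f p.1 (p.1 + a) p.2 (p.2 + b) =
      bint (fun z => f z - A z) p.1 (p.1 + a) p.2 (p.2 + b).
    have pa : p.1 <= p.1 + a by rewrite lerDl.
    have pb : p.2 <= p.2 + b by rewrite lerDl.
    by rewrite (bintB pa pb (contR_B fcn) (contR_B Ac)) A0 subr0.
  have bnd : cm (bint (fun z => f z - A z) p.1 (p.1 + a) p.2 (p.2 + b)) <=
      4 * (e * (a + b)) * ((p.1 + a - p.1) + (p.2 + b - p.2)).
    apply: bint_bound; [by rewrite lerDl|by rewrite lerDl| |].
      by move=> x y [xx yy _]; apply: contC_B; [exact: fcn|exact: Ac].
    move=> x y [xx yy _].
    have zl : cm (mkc x y - l) <= a + b.
      rewrite (le_trans (cm_le _))// reB imB lerD//= ler_norml; lra.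
    have abE : a + b = (w + h) * s n by rewrite mulrDl.
    have [ze zq] := dlP (mkc x y) (le_lt_trans zl (eq_ind_r (fun u => u < dl) Hn abE)).
    have -> : f (mkc x y) - A (mkc x y) = (q (mkc x y) - q l) * (mkc x y - l).
      by rewrite /A opprD addrA zq mulrBl qd.
    by rewrite cmM; apply: ler_pM; [exact: cm_ge0|exact: cm_ge0|exact: ltW|exact: zl].
  move=> H1; have := le_trans H1 bnd.
  have -> : p.2 + b - p.2 = b by ring.
  have -> : p.1 + a - p.1 = a by ring.
  have -> : 4 * (e * (a + b)) * (a + b) = 4 * e * (w + h) ^+ 2 * s n ^+ 2.
    by rewrite /a /b; ring.
  by rewrite ler_pM2r ?exprn_gt0.
rewrite leNgt; apply/negP => k0.
have wh0 : 0 < 4 * (w + h) ^+ 2 + 1.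
  by rewrite ltr_wpDl// mulr_ge0// sqr_ge0.
have := key (kap / 2 / (4 * (w + h) ^+ 2 + 1)).
rewrite !divr_gt0// => /(_ isT).
set X := (w + h) ^+ 2 in wh0 *.
have -> : 4 * (kap / 2 / (4 * X + 1)) * X = (kap / 2) * (4 * X / (4 * X + 1)) by field; rewrite gt_eqF.
have X1 : 4 * X / (4 * X + 1) <= 1 by rewrite ler_pdivrMr// mul1r lerDl.
apply/negP; rewrite -ltNge.
have : kap / 2 * (4 * X / (4 * X + 1)) <= kap / 2 by rewrite ler_piMr// divr_ge0// ltW.
by move=> *; lra.
Qed.
End Goursat.

(** * Cauchy's formula on squares *)

Section CauchyFormula.
Context {R : realType}.
Local Notation C := (cplx R).
Implicit Types (f g : C -> C).

Lemma ball_near (z0 a : C) (d : R) : cm (a - z0) < d ->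
  \forall b \near a, cm (b - z0) < d.
Proof.
move=> ad; apply/nbhsC; exists (d - cm (a - z0)); first by rewrite subr_gt0.
move=> w wa; have -> : w - z0 = (w - a) + (a - z0) by ring.
by rewrite (le_lt_trans (cmD _ _))// -ltrBrDr.
Qed.

Lemma near_ball (z0 : C) (d : R) : 0 < d -> \forall b \near z0, cm (b - z0) < d.
Proof. by move=> d0; apply: ball_near; rewrite subrr cm0. Qed.

Lemma near_neqC (z a : C) : z != a -> \forall w \near z, w != a.
Proof.
move=> za; apply/nbhsC; exists (cm (z - a)); first by rewrite cm_gt0 subr_eq0.
by move=> w; apply: contraTneq => ->; rewrite cmBC ltxx.
Qed.

(** Goursat's theorem with one exceptional point at which [g] is only continuous. *)
Theorem goursat_removable g (x0 x1 y0 y1 : R) (a : C) :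
  x0 < re a < x1 -> y0 < im a < y1 -> contR g x0 x1 y0 y1 ->
  (forall x y, x0 <= x <= x1 -> y0 <= y <= y1 -> mkc x y <> a ->
     exists d, cder g (mkc x y) d) ->
  bint g x0 x1 y0 y1 = 0.
Proof.
move=> /andP[xa ax] /andP[ya ay] gc gd.
pose M := cm (g a) + 1.
have M0 : 0 < M by apply: ltr_wpDl; [exact: cm_ge0|exact: ltr01].
have [dl dl0 dlP] : exists2 dl, 0 < dl & forall z, cm (z - a) < dl -> cm (g z) <= M.
  have gca : ctsat g a by rewrite -(mkcK a); apply: gc; apply/andP; split; exact: ltW.
  have : \forall z \near a, cm (g z - g a) < 1.
    by case: gca => /cvgC; apply.
  move=> /nbhsC[dl dl0 dlP]; exists dl => // z /dlP gz.
  rewrite -(subrK (g a) (g z)) (le_trans (cmD _ _))// addrC /M lerD2l.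
  exact: ltW.
(* Excise a small square around the exceptional point. *)
have key e : 0 < e -> e <= re a - x0 -> e <= x1 - re a -> e <= im a - y0 ->
    e <= y1 - im a -> e + e < dl -> cm (bint g x0 x1 y0 y1) <= 16 * M * e.
  move=> e0 e1 e2 e3 e4 ed.
  have h1 : x0 <= re a - e by lra.
  have h2 : re a - e <= re a + e by lra.
  have h3 : re a + e <= x1 by lra.
  have k1 : y0 <= im a - e by lra.
  have k2 : im a - e <= im a + e by lra.
  have k3 : im a + e <= y1 by lra.
  have h : y0 <= y1 by lra.
  have ll (x : R) := lexx x.
  have gc1 := contR_sub h1 (ll x1) (ll y0) (ll y1) gc.
  have gc2 := contR_sub (ll _) h3 (ll y0) (ll y1) gc1.
  have gc3 := contR_sub (ll _) (ll _) k1 (ll y1) gc2.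
  rewrite (bint_catx h1 (le_trans h2 h3) h gc) (bint_catx h2 h3 h gc1).
  rewrite (bint_caty h2 k1 (le_trans k2 k3) gc2) (bint_caty h2 k2 k3 gc3).
  have G1 : bint g x0 (re a - e) y0 y1 = 0.
    apply: goursat => // x y /andP[? ?] yy; apply: gd => //; first by apply/andP; split=> //; lra.
    by move=> /(congr1 (@re R)) /= E; lra.
  have G2 : bint g (re a + e) x1 y0 y1 = 0.
    apply: goursat => // x y /andP[? ?] yy; apply: gd => //; first by apply/andP; split=> //; lra.
    by move=> /(congr1 (@re R)) /= E; lra.
  have G3 : bint g (re a - e) (re a + e) y0 (im a - e) = 0.
    apply: goursat => // x y /andP[? ?] /andP[? ?]; apply: gd; try (apply/andP; split=> //; lra).
    by move=> /(congr1 (@im R)) /= E; lra.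
  have G4 : bint g (re a - e) (re a + e) (im a + e) y1 = 0.
    apply: goursat => // x y /andP[? ?] /andP[? ?]; apply: gd; try (apply/andP; split=> //; lra).
    by move=> /(congr1 (@im R)) /= E; lra.
  rewrite G1 G2 G3 G4 !add0r !addr0.
  have -> : 16 * M * e = 4 * M * ((re a + e - (re a - e)) + (im a + e - (im a - e))) by ring.
  apply: bint_bound => //.
    by apply: contR_B; exact: contR_sub gc3.
  move=> x y [/andP[? ?] /andP[? ?] _]; apply: dlP.
  apply: le_lt_trans ed; apply: le_trans (cm_le _) _.
  by rewrite reB imB /= lerD// ler_norml; apply/andP; split; lra.
apply/eqP; rewrite -cm_eq0 eq_le cm_ge0 andbT leNgt; apply/negP => b0.
set b := cm _ in b0 key.
pose e := Num.min (Num.min (Num.min (re a - x0) (x1 - re a)) (Num.min (im a - y0) (y1 - im a)))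
  (Num.min (dl / 4) (b / (32 * M))).
have e0 : 0 < e by rewrite !lt_min !subr_gt0 xa ax ya ay !divr_gt0// mulr_gt0.
have : e <= e by [].
rewrite {2}/e !le_min => /andP[/andP[/andP[e1 e2] /andP[e3 e4]] /andP[e5 e6]].
have edl : e + e < dl by lra.
have := key e e0 e1 e2 e3 e4 edl.
apply/negP; rewrite -ltNge; move: e6; rewrite ler_pdivlMr ?mulr_gt0// => e6.
by have -> : 16 * M * e = e * (32 * M) / 2 by [field]; lra.
Qed.

Lemma cder_sub (a z : C) : cder (fun w => w - a) z 1.
Proof.
rewrite -[1]subr0; apply: cderivB; [exact: cderiv_emb|exact: cderiv_cst].
Qed.

Lemma cder_subV (a z : C) : z != a -> exists d, cder (fun w => (w - a)^-1) z d.
Proof.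
move=> za; exists (- 1 / (z - a) ^+ 2); apply: cderV; first by rewrite subr_eq0.
exact: cder_sub.
Qed.

Lemma onB_neq (x0 x1 y0 y1 x y : R) (a : C) : x0 < re a < x1 -> y0 < im a < y1 ->
  onB x0 x1 y0 y1 x y -> mkc x y != a.
Proof.
move=> /andP[xa ax] /andP[ya ay] [_ _ xy]; apply/eqP => E.
by move: xa ax ya ay; rewrite -E /=; case: xy => [->|[->|[->|->]]]; rewrite ltxx.
Qed.

(** Goursat's theorem applied to the difference quotient of [f] at [a]. *)
Theorem cauchy_formula f (x0 x1 y0 y1 : R) (a : C) :
  x0 < re a < x1 -> y0 < im a < y1 ->
  (forall x y, x0 <= x <= x1 -> y0 <= y <= y1 -> exists d, cder f (mkc x y) d) ->
  bint (fun z => f z / (z - a)) x0 x1 y0 y1 =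
  f a * bint (fun z => (z - a)^-1) x0 x1 y0 y1.
Proof.
move=> xa ya fd.
have x01 : x0 <= x1 by case/andP: xa => *; lra.
have y01 : y0 <= y1 by case/andP: ya => *; lra.
have [da dfa] : exists d, cder f a d.
  rewrite -(mkcK a); case/andP: xa => ? ?; case/andP: ya => ? ?.
  by apply: fd; apply/andP; split; lra.
pose g z := if z == a then da else (f z - f a) / (z - a).
have gnear z : z != a -> \forall w \near z, (f w - f a) / (w - a) = g w.
  move=> za; have wa : \forall w \near z, w != a.
    exact: near_neqC.
  by apply: filterS wa => w wa; rewrite /g (negbTE wa).
have gder x y : x0 <= x <= x1 -> y0 <= y <= y1 -> mkc x y != a ->
    exists d, cder g (mkc x y) d.
  move=> xx yy xya; have [d fxy] := fd x y xx yy.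
  have [e xyV] := cder_subV xya.
  exists ((d - 0) * (mkc x y - a)^-1 + (f (mkc x y) - f a) * e).
  apply: cderiv_near (gnear _ xya) _; apply: cderM xyV.
  by apply: cderivB fxy _; exact: cderiv_cst.
have gc : contR g x0 x1 y0 y1.
  move=> x y xx yy; have [->|xya] := eqVneq (mkc x y) a; last first.
    by have [d /cder_cont] := gder x y xx yy xya.
  case: dfa => q [qc qa fq]; apply: ctsat_near qc.
  apply: filterS fq => w fq; rewrite /g; case: eqVneq => [->//|wa].
  by rewrite fq mulfK// subr_eq0.
have g0 : bint g x0 x1 y0 y1 = 0.
  apply: goursat_removable xa ya gc _ => x y xx yy /eqP; exact: gder.
have V : contB (fun z => (z - a)^-1) x0 x1 y0 y1.
  by move=> x y /(onB_neq xa ya)/cder_subV[d /cder_cont].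
have fV : contB (fun z => f z / (z - a)) x0 x1 y0 y1.
  move=> x y xy; apply: contC_M; last exact: V.
  by case: xy => xx yy _; have [d /cder_cont] := fd x y xx yy.
apply/eqP; rewrite -subr_eq0 -bintZ// -bintB//; last exact: contBZ.
apply/eqP; rewrite -g0; apply: eq_bint => // x y /(onB_neq xa ya) xya.
by rewrite /g (negbTE xya) mulrBl.
Qed.

Lemma contI_bounded (u : R -> C) (a b : R) : a <= b -> contI u a b ->
  exists M, forall t, a <= t <= b -> cm (u t) <= M.
Proof.
move=> ab uc.
have [] := @EVT_max _ (fun t => cm (u t)) a b ab.
  by apply: contI_within => t /uc; exact: contC_cm.
move=> c _ cM; exists (cm (u c)) => t tab; apply: cM.
by rewrite in_itv.
Qed.

Lemma contB_bounded g (x0 x1 y0 y1 : R) : x0 <= x1 -> y0 <= y1 ->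
  contB g x0 x1 y0 y1 -> exists2 M, 0 <= M &
  forall x y, onB x0 x1 y0 y1 x y -> cm (g (mkc x y)) <= M.
Proof.
move=> x01 y01 gc.
have [M1 H1] := contI_bounded x01 (contB_h gc y01 (or_introl erefl)).
have [M2 H2] := contI_bounded x01 (contB_h gc y01 (or_intror erefl)).
have [M3 H3] := contI_bounded y01 (contB_v gc x01 (or_introl erefl)).
have [M4 H4] := contI_bounded y01 (contB_v gc x01 (or_intror erefl)).
exists (Num.max 0 (Num.max (Num.max M1 M2) (Num.max M3 M4))).
  by rewrite le_max lexx.
move=> x y [xx yy xy]; rewrite !le_max; case: xy => [E|[E|[E|E]]]; subst.
- by rewrite (H3 _ yy) !orbT.
- by rewrite (H4 _ yy) !orbT.
- by rewrite (H1 _ xx) !orbT.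
- by rewrite (H2 _ xx) !orbT.
Qed.

(** A first-order expansion with quadratic error gives the derivative. *)
Lemma cder_quadratic (F : C -> C) (a d : C) (M r : R) : 0 < r ->
  (forall w, cm (w - a) < r -> cm (F w - F a - d * (w - a)) <= M * cm (w - a) ^+ 2) ->
  cder F a d.
Proof.
move=> r0 H; have M0 : 0 <= `|M| + 1 by rewrite addr_ge0.
pose q w := if w == a then d else (F w - F a) / (w - a).
exists q; split.
- apply: Ctsat; apply/(cvgC (F := nbhs a)) => e e0.
  apply/nbhsC; exists (Num.min r (e / (`|M| + 1))).
    by rewrite lt_min r0 divr_gt0// ltr_wpDl.
  move=> w; rewrite lt_min => /andP[wr we]; rewrite /q eqxx.
  case: eqVneq => [_|wa]; first by rewrite subrr cm0.
  have wa0 : 0 < cm (w - a) by rewrite cm_gt0 subr_eq0.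
  have -> : (F w - F a) / (w - a) - d = (F w - F a - d * (w - a)) / (w - a).
    by field; rewrite subr_eq0.
  rewrite cmM cmV ltr_pdivrMr//; apply: le_lt_trans (H w wr) _.
  rewrite expr2 mulrA ltr_pM2r//.
  move: we; rewrite ltr_pdivlMr ?ltr_wpDl//; apply: le_lt_trans.
  rewrite mulrC; apply: ler_wpM2l; first exact: cm_ge0.
  by rewrite (le_trans (ler_norm _))// lerDl.
- by rewrite /q eqxx.
- apply: (@filterE _ (nbhs a)) => w; rewrite /q; case: eqVneq => [->|wa].
    by rewrite !subrr mulr0.
  by rewrite divfK// subr_eq0.
Qed.

(** Second-order remainders of [1 / (u - h)] and [1 / (u - h) ^ 2]. *)
Lemma kernel1_bound (u h : C) (d : R) : 0 < d -> d <= cm u -> cm h < d / 2 ->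
  cm ((u - h)^-1 - u^-1 - h * (u ^+ 2)^-1) <= (2 / d ^+ 3) * cm h ^+ 2.
Proof.
move=> d0 du hd.
have u0 : u != 0 by rewrite -cm_gt0 (lt_le_trans d0).
have duh : d / 2 <= cm (u - h) by have := cmBB u h; lra.
have uh0 : u - h != 0 by rewrite -cm_gt0 (lt_le_trans _ duh)// divr_gt0.
have -> : (u - h)^-1 - u^-1 - h * (u ^+ 2)^-1 = h ^+ 2 * ((u ^+ 2)^-1 * (u - h)^-1).
  by field; rewrite uh0 u0.
rewrite cmM cmX mulrC ler_wpM2r ?exprn_ge0// cmM !cmV cmX.
have -> : 2 / d ^+ 3 = (d ^+ 2)^-1 * (d / 2)^-1 by field; rewrite gt_eqF.
apply: ler_pM; rewrite ?invr_ge0 ?exprn_ge0//.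
  by rewrite lef_pV2 ?posrE ?exprn_gt0 ?cm_gt0// lerXn2r ?nnegrE// ltW.
by rewrite lef_pV2 ?posrE ?cm_gt0// divr_gt0.
Qed.

Lemma kernel2_bound (u h : C) (d : R) : 0 < d -> d <= cm u -> cm h < d / 2 ->
  cm (((u - h) ^+ 2)^-1 - (u ^+ 2)^-1 - 2 * h * (u ^+ 3)^-1) <= (16 / d ^+ 4) * cm h ^+ 2.
Proof.
move=> d0 du hd.
have u0 : u != 0 by rewrite -cm_gt0 (lt_le_trans d0).
have cu0 : 0 < cm u by rewrite cm_gt0.
have duh : d / 2 <= cm (u - h) by have := cmBB u h; lra.
have uh0 : u - h != 0 by rewrite -cm_gt0 (lt_le_trans _ duh)// divr_gt0.
have -> : ((u - h) ^+ 2)^-1 - (u ^+ 2)^-1 - 2 * h * (u ^+ 3)^-1 =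
    h ^+ 2 * ((3 * u - 2 * h) / u * (u ^+ 2)^-1 * ((u - h) ^+ 2)^-1).
  by field; rewrite uh0 u0.
rewrite cmM cmX mulrC ler_wpM2r ?exprn_ge0// !cmM !cmV !cmX.
have -> : 16 / d ^+ 4 = 4 * (d ^+ 2)^-1 * ((d / 2) ^+ 2)^-1 by field; rewrite gt_eqF.
have cmn n : cm (n%:R : C) = n%:R.
  have -> : (n%:R : C) = inC n%:R.
    by elim: n => [|n IH]; rewrite ?inC0// -!natr1 inCD -IH.
  by rewrite cm_inC ger0_norm.
apply: ler_pM; rewrite ?mulr_ge0 ?invr_ge0 ?exprn_ge0//.
  apply: ler_pM; rewrite ?mulr_ge0 ?invr_ge0 ?exprn_ge0//.
    rewrite ler_pdivrMr// (le_trans (cmB _ _))// !cmM !cmn; lra.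
  by rewrite lef_pV2 ?posrE ?exprn_gt0 ?cm_gt0// lerXn2r ?nnegrE// ltW.
rewrite lef_pV2 ?posrE ?exprn_gt0 ?cm_gt0 ?divr_gt0//.
by rewrite lerXn2r ?nnegrE// divr_ge0// ltW.
Qed.

Lemma onB_far (x0 x1 y0 y1 : R) (a : C) : x0 < re a < x1 -> y0 < im a < y1 ->
  exists2 d, 0 < d & forall x y, onB x0 x1 y0 y1 x y -> d <= cm (mkc x y - a).
Proof.
move=> /andP[xa ax] /andP[ya ay].
exists (Num.min (Num.min (re a - x0) (x1 - re a)) (Num.min (im a - y0) (y1 - im a))).
  by rewrite !lt_min !subr_gt0 xa ax ya ay.
move=> x y [_ _ xy]; rewrite !ge_min.
have rel := re_le_cm (mkc x y - a); have iml := im_le_cm (mkc x y - a).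
rewrite reB /= in rel; rewrite imB /= in iml.
have := ler_norm (x - re a); have := ler_norm (re a - x); rewrite (distrC (re a)).
have := ler_norm (y - im a); have := ler_norm (im a - y); rewrite (distrC (im a)).
case: xy => [E|[E|[E|E]]]; subst => *; apply/orP.
- by left; apply/orP; left; lra.
- by left; apply/orP; right; lra.
- by right; apply/orP; left; lra.
- by right; apply/orP; right; lra.
Qed.

(** The Cauchy transform of the boundary values of [g], with a pole of order [j]. *)
Definition cauchy_transform g (x0 x1 y0 y1 : R) (j : nat) (a : C) : C :=
  bint (fun z => g z / (z - a) ^+ j) x0 x1 y0 y1.

Lemma contB_kernel g (x0 x1 y0 y1 : R) (j : nat) (a : C) :
  x0 < re a < x1 -> y0 < im a < y1 -> contB g x0 x1 y0 y1 ->
  contB (fun z => g z / (z - a) ^+ j) x0 x1 y0 y1.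
Proof.
move=> xa ya gc x y xy; have xya := onB_neq xa ya xy.
apply: contC_M; first exact: gc.
apply: contC_V; first by rewrite expf_neq0// subr_eq0.
elim: j => [|j IH]; first exact: contC_cst.
have -> : (fun z => (z - a) ^+ j.+1) = (fun z => (z - a) * (z - a) ^+ j).
  by apply/funext => z; rewrite exprS.
by apply: contC_M IH; exact: cder_cont (cder_sub _ _).
Qed.

Section Transform.
Variables (g : C -> C) (x0 x1 y0 y1 : R).
Hypothesis gc : contB g x0 x1 y0 y1.
Let T := cauchy_transform g x0 x1 y0 y1.

(** Differentiation under the integral sign, from an expansion of the kernel. *)
Lemma cauchy_transform_step (i j : nat) (k : C) (K : R -> R) (a : C) :
  x0 < re a < x1 -> y0 < im a < y1 ->
  (forall u h d, 0 < d -> d <= cm u -> cm h < d / 2 ->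
     cm (((u - h) ^+ i)^-1 - (u ^+ i)^-1 - k * h * (u ^+ j)^-1) <= K d * cm h ^+ 2) ->
  cder (T i) a (k * T j a).
Proof.
move=> xa ya Hk.
have x01 : x0 <= x1 by case/andP: xa => *; lra.
have y01 : y0 <= y1 by case/andP: ya => *; lra.
have [d d0 dP] := onB_far xa ya.
have [M M0 gM] := contB_bounded x01 y01 gc.
have [r r0 rP] : exists2 r, 0 < r & forall w, cm (w - a) < r ->
    x0 < re w < x1 /\ y0 < im w < y1.
  case/andP: (xa) => xa1 xa2; case/andP: (ya) => ya1 ya2.
  exists (Num.min (Num.min (re a - x0) (x1 - re a)) (Num.min (im a - y0) (y1 - im a))).
    by rewrite !lt_min !subr_gt0 xa1 xa2 ya1 ya2.
  move=> w; rewrite !lt_min => /andP[/andP[h1 h2] /andP[h3 h4]].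
  have := le_trans (ler_norm _) (re_le_cm (w - a)).
  have := le_trans (ler_norm _) (im_le_cm (w - a)).
  have := le_trans (ler_norm _) (re_le_cm (a - w)).
  have := le_trans (ler_norm _) (im_le_cm (a - w)).
  rewrite (cmBC a) !reB !imB => *.
  by split; apply/andP; split; lra.
apply: (@cder_quadratic _ _ _ (4 * (M * K d) * ((x1 - x0) + (y1 - y0))) (Num.min r (d / 2))).
  by rewrite lt_min r0 divr_gt0.
move=> w; rewrite lt_min => /andP[/rP[xw yw] wd].
have ca := contB_kernel _ xa ya gc; have cw := contB_kernel i xw yw gc.
have -> : T i w - T i a - k * T j a * (w - a) =
    bint (fun z => (g z / (z - w) ^+ i - g z / (z - a) ^+ i) -
       (k * (w - a)) * (g z / (z - a) ^+ j)) x0 x1 y0 y1.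
  rewrite (bintB x01 y01); last 2 first.
  - by move=> x y xy; apply: contC_B; [exact: cw|exact: ca].
  - exact: contBZ (ca j).
  rewrite (bintB x01 y01 cw (ca i)) (bintZ _ x01 y01 (ca j)).
  by rewrite /T /cauchy_transform mulrAC.
have -> : 4 * (M * K d) * ((x1 - x0) + (y1 - y0)) * cm (w - a) ^+ 2 =
    4 * (M * (K d * cm (w - a) ^+ 2)) * ((x1 - x0) + (y1 - y0)) by ring.
apply: (bint_bound x01 y01).
  move=> x y xy; apply: contC_B; last exact: contBZ (ca j) x y xy.
  by apply: contC_B; [exact: cw|exact: ca].
move=> x y xy.
set z := mkc x y.
have -> : g z / (z - w) ^+ i - g z / (z - a) ^+ i - k * (w - a) * (g z / (z - a) ^+ j) =
   g z * (((z - a - (w - a)) ^+ i)^-1 - ((z - a) ^+ i)^-1 - k * (w - a) * ((z - a) ^+ j)^-1).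
  by rewrite (_ : z - a - (w - a) = z - w); ring.
rewrite cmM; apply: ler_pM => //; first exact: gM.
by apply: Hk => //; exact: dP.
Qed.

Lemma cauchy_transform1_der a : x0 < re a < x1 -> y0 < im a < y1 ->
  cder (T 1) a (T 2 a).
Proof.
move=> xa ya; rewrite -[T 2 a]mul1r.
apply: (@cauchy_transform_step _ _ _ (fun d => 2 / d ^+ 3)) => // u h d d0 du hd.
by rewrite mul1r !expr1; exact: kernel1_bound.
Qed.

Lemma cauchy_transform2_der a : x0 < re a < x1 -> y0 < im a < y1 ->
  cder (T 2) a (2 * T 3 a).
Proof.
move=> xa ya.
apply: (@cauchy_transform_step _ _ _ (fun d => 16 / d ^+ 4)) => // u h d d0 du hd.
exact: kernel2_bound.
Qed.
End Transform.
End CauchyFormula.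

(** * Derivatives of holomorphic functions *)

Section DerivativeHolomorphic.
Context {R : realType}.
Local Notation C := (cplx R).
Implicit Types (f g : C -> C).

Lemma reV (z : C) : re z^-1 = re z / (re z ^+ 2 + im z ^+ 2).
Proof. by case: z. Qed.
Lemma imV (z : C) : im z^-1 = - im z / (re z ^+ 2 + im z ^+ 2).
Proof. by case: z => a b /=; rewrite mulNr. Qed.

(** Each of the four sides contributes at least 1 to the imaginary part. *)
Lemma square_winding_neq0 (z0 : C) (r : R) : 0 < r ->
  bint (fun z => (z - z0)^-1) (re z0 - r) (re z0 + r) (im z0 - r) (im z0 + r) != 0.
Proof.
move=> r0.
set x0 := re z0 - r; set x1 := re z0 + r; set y0 := im z0 - r; set y1 := im z0 + r.
have x01 : x0 <= x1 by rewrite /x0 /x1; lra.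
have y01 : y0 <= y1 by rewrite /y0 /y1; lra.
have xa : x0 < re z0 < x1 by rewrite /x0 /x1; apply/andP; split; lra.
have ya : y0 < im z0 < y1 by rewrite /y0 /y1; apply/andP; split; lra.
have V : contB (fun z : C => (z - z0)^-1) x0 x1 y0 y1.
  by move=> x y /(onB_neq xa ya)/cder_subV[d /cder_cont].
have bnd (s : R) : - r <= s <= r -> (2 * r)^-1 <= r / (s ^+ 2 + r ^+ 2).
  move=> /andP[s1 s2]; have s2r : s ^+ 2 <= r ^+ 2.
    rewrite -subr_ge0 subr_sqr mulr_ge0//; lra.
  have p0 : 0 < s ^+ 2 + r ^+ 2 by rewrite ltr_wpDl ?sqr_ge0// exprn_gt0.
  by rewrite ler_pdivlMr// ler_pdivrMl ?mulr_gt0// -mulrA -expr2; lra.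
suff : 0 < im (bint (fun z : C => (z - z0)^-1) x0 x1 y0 y1).
  by apply: contraTneq => ->; rewrite im0 ltxx.
have L (u : R -> R) (a b : R) : a <= b -> b - a = 2 * r -> contI u a b ->
    (forall t, a <= t <= b -> (2 * r)^-1 <= u t) -> 1 <= rint u a b.
  move=> ab bar uc ub; have <- : rint (fun=> (2 * r)^-1) a b = 1.
    by rewrite rint_cst// bar mulVf// gt_eqF// mulr_gt0.
  by apply: le_rint => //; exact: contI_cst.
have c1 := contB_h V y01 (or_introl erefl).
have c2 := contB_v V x01 (or_intror erefl).
have c3 := contB_h V y01 (or_intror erefl).
have c4 := contB_v V x01 (or_introl erefl).
have wx : x1 - x0 = 2 * r by rewrite /x0 /x1; ring.
have wy : y1 - y0 = 2 * r by rewrite /y0 /y1; ring.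
have i1 : 1 <= im (hseg (fun z : C => (z - z0)^-1) y0 x0 x1).
  apply: L => //; first exact: contI_im c1.
  move=> t tt; rewrite imV reB imB /= (_ : y0 - im z0 = - r); last by rewrite /y0; ring.
  rewrite sqrrN opprK; apply: bnd.
  by move: tt; rewrite /x0 /x1 => /andP[? ?]; apply/andP; split; lra.
have i2 : 1 <= im (vseg (fun z : C => (z - z0)^-1) x1 y0 y1).
  rewrite /vseg imM /= mul0r add0r mul1r.
  apply: L => //; first exact: contI_re c2.
  move=> t tt; rewrite reV reB imB /= (_ : x1 - re z0 = r); last by rewrite /x1; ring.
  rewrite addrC; apply: bnd.
  by move: tt; rewrite /y0 /y1 => /andP[? ?]; apply/andP; split; lra.
have i3 : im (hseg (fun z : C => (z - z0)^-1) y1 x0 x1) <= -1.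
  rewrite /hseg /= lerNr -mulN1r -rintZ; last exact: contI_im c3.
  apply: L => //.
    move=> t tt; apply: contRM; first by apply: Ctsat; exact: cvg_cst.
    exact: contI_im c3 t tt.
  move=> t tt; rewrite imV reB imB /= (_ : y1 - im z0 = r); last by rewrite /y1; ring.
  rewrite mulN1r -mulNr opprK; apply: bnd.
  by move: tt; rewrite /x0 /x1 => /andP[? ?]; apply/andP; split; lra.
have i4 : im (vseg (fun z : C => (z - z0)^-1) x0 y0 y1) <= -1.
  rewrite /vseg imM /= mul0r add0r mul1r lerNr -mulN1r -rintZ; last exact: contI_re c4.
  apply: L => //.
    move=> t tt; apply: contRM; first by apply: Ctsat; exact: cvg_cst.
    exact: contI_re c4 t tt.
  move=> t tt; rewrite reV reB imB /= (_ : x0 - re z0 = - r); last by rewrite /x0; ring.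
  rewrite mulN1r mulNr opprK sqrrN addrC; apply: bnd.
  by move: tt; rewrite /y0 /y1 => /andP[? ?]; apply/andP; split; lra.
rewrite /bint !imB imD; lra.
Qed.

(** Holomorphic functions on a set, and their derivative. *)
Definition holo (A : set C) f := forall z, A z -> exists d, cder f z d.

Definition der f : C -> C := fun z => 'D_(1 : C) f z.

Lemma cder_der f z d : cder f z d -> der f z = d.
Proof. by move=> /is_derive_cderP[_]. Qed.

Lemma holo_der (A : set C) f z : holo A f -> A z -> cder f z (der f z).
Proof. by move=> fA /fA[d fd]; rewrite (cder_der fd). Qed.

(** The derivative of a holomorphic function is holomorphic. *)
Theorem holo_deriv (A : set C) f : open A -> holo A f -> holo A (der f).
Proof.
move=> oA fA z0 Az0.
have /nbhsC[e e0 eA] : nbhs z0 A by exact: open_nbhs_nbhs.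
pose r := e / 4; have r0 : 0 < r by rewrite divr_gt0.
pose x0 := re z0 - r; pose x1 := re z0 + r; pose y0 := im z0 - r; pose y1 := im z0 + r.
have fd x y : x0 <= x <= x1 -> y0 <= y <= y1 -> exists d, cder f (mkc x y) d.
  rewrite /x0 /x1 /y0 /y1 => /andP[? ?] /andP[? ?]; apply: fA; apply: eA.
  apply: (@le_lt_trans _ _ (r + r)); last by rewrite /r; lra.
  by rewrite (le_trans (cm_le _))// reB imB lerD//= ler_norml; apply/andP; split; lra.
have x01 : x0 <= x1 by rewrite /x0 /x1; lra.
have y01 : y0 <= y1 by rewrite /y0 /y1; lra.
have fB : contB f x0 x1 y0 y1.
  by move=> x y [xx yy _]; have [d /cder_cont] := fd x y xx yy.
have oneB : contB (fun=> 1 : C) x0 x1 y0 y1 by move=> x y _; exact: contC_cst.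
pose T := cauchy_transform f x0 x1 y0 y1.
pose N := cauchy_transform (fun=> 1) x0 x1 y0 y1.
have inside a : cm (a - z0) < r -> x0 < re a < x1 /\ y0 < im a < y1.
  move=> ar; have := le_lt_trans (re_le_cm _) ar; have := le_lt_trans (im_le_cm _) ar.
  rewrite reB imB !ltr_norml /x0 /x1 /y0 /y1 => /andP[? ?] /andP[? ?].
  by split; apply/andP; split; lra.
have NE a : N 1%N a = bint (fun z => (z - a)^-1) x0 x1 y0 y1.
  rewrite /N /cauchy_transform.
  have -> : (fun z : C => 1 / (z - a) ^+ 1) = (fun z => (z - a)^-1).
    by apply/funext => z; rewrite mul1r expr1.
  reflexivity.
have N0 : N 1%N z0 != 0 by rewrite NE; exact: square_winding_neq0.
have [s s0 sP] : exists2 s, 0 < s & forall a, cm (a - z0) < s -> cm (a - z0) < r /\ N 1%N a != 0.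
  have [xz yz] : x0 < re z0 < x1 /\ y0 < im z0 < y1 by apply: inside; rewrite subrr cm0.
  have Nc : ctsat (N 1%N) z0 := cder_cont (cauchy_transform1_der oneB xz yz).
  have /nbhsC[s s0 sP] : \forall a \near z0, cm (a - z0) < r /\ N 1%N a != 0.
    apply: filterS2 (near_ball z0 r0) _; first by move=> a; exact: conj.
    by case: Nc => Nc; exact: (cvgr_neq0 (N 1%N z0) Nc N0).
  by exists s.
(* By Cauchy's formula, applied to [f] and to the constant 1, [f] is near [z0]
   the quotient of two Cauchy transforms. *)
have fE a : cm (a - z0) < s -> T 1%N a * (N 1%N a)^-1 = f a.
  move=> /sP[/inside[xa ya] Na0]; apply/eqP; rewrite -(inj_eq (mulIf Na0)) mulfVK//.
  rewrite NE -(cauchy_formula xa ya fd) /T /cauchy_transform.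
  have -> : (fun z : C => f z / (z - a) ^+ 1) = (fun z => f z / (z - a)).
    by apply/funext => z; rewrite expr1.
  exact: eqxx.
pose G a := T 2%N a * (N 1%N a)^-1 + T 1%N a * (- N 2%N a / N 1%N a ^+ 2).
have dE a : cm (a - z0) < s -> G a = der f a.
  move=> as_; have [/inside[xa ya] Na0] := sP a as_.
  apply/esym; apply: cder_der; apply: cderiv_near.
    by apply: filterS (ball_near as_) => b; exact: fE.
  apply: cderM; first exact: cauchy_transform1_der.
  by apply: cderV => //; exact: cauchy_transform1_der.
have [/inside[xz yz] _] : cm (z0 - z0) < r /\ N 1%N z0 != 0 by apply: sP; rewrite subrr cm0.
have T1 := cauchy_transform1_der fB xz yz; have N1 := cauchy_transform1_der oneB xz yz.
have T2 := cauchy_transform2_der fB xz yz; have N2 := cauchy_transform2_der oneB xz yz.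
have NV := cderV N0 N1.
have [e2 N1sV] : exists d, cder (fun a => (N 1%N a ^+ 2)^-1) z0 d.
  eexists; apply: (cderV (f := fun a => N 1%N a ^+ 2)); first by rewrite expf_neq0.
  exact: (cderM N1 N1).
eexists; apply: cderiv_near; first by apply: filterS (near_ball z0 s0) => b; exact: dE.
apply: cderivD; first exact: (cderM T2 NV).
apply: (cderM T1); exact: (cderM (cderivN N2) N1sV).
Qed.
End DerivativeHolomorphic.

(** * Real derivatives and the second derivative test *)

Section RealDerivativeRules.
Context {R : realType}.
Implicit Types (f g : R -> R) (t a b : R).

Lemma rdD f g t a b : is_derive t 1 f a -> is_derive t 1 g b ->
  is_derive t 1 (fun s => f s + g s) (a + b).
Proof. by move=> ? ?; exact: is_deriveD. Qed.
Lemma rdB f g t a b : is_derive t 1 f a -> is_derive t 1 g b ->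
  is_derive t 1 (fun s => f s - g s) (a - b).
Proof. by move=> ? ?; exact: is_deriveB. Qed.
Lemma rdM f g t a b : is_derive t 1 f a -> is_derive t 1 g b ->
  is_derive t 1 (fun s => f s * g s) (a * g t + f t * b).
Proof.
move=> fa gb; apply: (is_derive_eq (is_deriveM fa gb)).
by rewrite /GRing.scale /= addrC mulrC; congr (_ + _); rewrite mulrC.
Qed.
Lemma rdV f t a : f t != 0 -> is_derive t 1 f a ->
  is_derive t 1 (fun s => (f s)^-1) (- a / f t ^+ 2).
Proof.
move=> f0 [fd fa]; split; first exact: derivableV.
by rewrite deriveV// fa /GRing.scale /=; field.
Qed.
Lemma rd_comp f g t a b : is_derive t 1 g b -> is_derive (g t) 1 f a ->
  is_derive t 1 (fun s => f (g s)) (a * b).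
Proof. by move=> gb fa; have := is_derive1_comp fa gb. Qed.
Lemma rd_ln f t a : 0 < f t -> is_derive t 1 f a ->
  is_derive t 1 (fun s => ln (f s)) (a / f t).
Proof.
move=> f0 fa; apply: (is_derive_eq (rd_comp fa (is_derive1_ln f0))).
by rewrite mulrC.
Qed.
Lemma rd_exp f t a : is_derive t 1 f a ->
  is_derive t 1 (fun s => expR (f s)) (expR (f t) * a).
Proof. by move=> fa; exact: (rd_comp fa (is_derive_expR _)). Qed.

Lemma rd_near f g t a : (\forall s \near t, f s = g s) ->
  is_derive t 1 f a -> is_derive t 1 g a.
Proof.
by move=> fg fa; exact: (@near_eq_is_derive _ _ _ f).
Qed.

(** A derivative bound integrates along a segment. *)
Lemma mvt_le f (f' : R -> R) (M a b : R) : a <= b ->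
  (forall t, a <= t <= b -> is_derive t 1 f (f' t)) ->
  (forall t, a <= t <= b -> f' t <= M) -> f b - f a <= M * (b - a).
Proof.
move=> ab fd fM.
have [| |c cab ->] := @MVT_segment _ f f' a b ab.
- by move=> t; rewrite in_itv /= => /andP[/ltW ? /ltW ?]; apply: fd; apply/andP.
- by apply: contI_within => t /fd; exact: is_derive_ctsat.
- by apply: ler_wpM2r; [rewrite subr_ge0|apply: fM; rewrite in_itv in cab].
Qed.

(** If the logarithmic derivative of [f] is bounded by [M], then [f] loses at most
    the factor [exp (- M)] over the unit interval. *)
Lemma exp_decay (f f' : R -> R) (M : R) : (forall t, 0 < f t) ->
  (forall t : R, is_derive t 1 f (f' t)) -> (forall t, `|f' t| <= M * f t) ->
  expR (- M) * f 0 <= f 1.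
Proof.
move=> f0 fd fM.
have ld (t : R) := rdB (is_derive_cst (0 : R) t (1 : R)) (rd_ln (f0 t) (fd t)).
have bnd t : 0 <= t <= 1 -> 0 - f' t / f t <= M.
  move=> _; rewrite sub0r -mulNr ler_pdivrMr//; apply: le_trans (fM t).
  by rewrite -normrN ler_norm.
have := mvt_le ler01 (fun t _ => ld t) bnd.
rewrite -{2}(lnK (f0 0 : f 0 \in Num.pos)) -{2}(lnK (f0 1 : f 1 \in Num.pos)).
by rewrite -expRD ler_expR; lra.
Qed.

Lemma second_derivative_test (v v1 : R -> R) (a d : R) : 0 < d ->
  (forall t, `|t| < d -> is_derive t 1 v (v1 t)) -> is_derive (0 : R) 1 v1 a ->
  (forall t, `|t| < d -> v t <= v 0) -> a <= 0.
Proof.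
move=> d0 vd v1d vmax; rewrite leNgt; apply/negP => a0.
have v10 : v1 0 = 0.
  have itvd t : t \in `]-d, d[ -> `|t| < d by rewrite in_itv /= ltr_norml.
  have h : is_derive (0 : R) 1 v 0.
    apply: (@derive1_at_max _ v (-d) d 0).
    - lra.
    - by move=> t /itvd/vd[].
    - by rewrite in_itv /= oppr_lt0 d0.
    - by move=> t /itvd; exact: vmax.
  have [_ <-] := vd 0 (eq_ind_r (fun x => x < d) d0 (normr0 R)).
  by case: h.
have [q [[qc] q0 vq]] := caratheodory_is_derive v1d.
have /cvgrPdist_lt/(_ _ a0) : q @ 0 --> a by rewrite -q0.
move=> /nbhs_ballP[r /= r0 rP].
pose s := Num.min r d / 2.
have rd0 : 0 < Num.min r d by rewrite lt_min r0 d0.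
have s0 : 0 < s by rewrite divr_gt0.
have sr : s < r.
  have : Num.min r d <= r by rewrite ge_min lexx.
  rewrite /s; lra.
have sd : s < d.
  have : Num.min r d <= d by rewrite ge_min lexx orbT.
  rewrite /s; lra.
have ins t : 0 <= t <= s -> `|t| < d.
  by move=> /andP[t0 ts]; rewrite ger0_norm// (le_lt_trans ts).
have [| |c] := @MVT _ v v1 0 s s0.
- move=> t; rewrite in_itv /= => /andP[t0 ts]; apply: vd; apply: ins.
  by rewrite !ltW.
- by apply: contI_within => t /ins/vd; exact: is_derive_ctsat.
rewrite in_itv /= => /andP[c0 cs] E.
have := vmax s (ins _ (introT andP (conj (ltW s0) (lexx _)))).
rewrite -subr_le0 E subr0; apply/negP; rewrite -ltNge mulr_gt0//.
have -> : v1 c = q c * c by have := vq c; rewrite v10 !subr0.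
rewrite mulr_gt0//.
have /rP /= : ball (0 : R) r c.
  by rewrite -ball_normE /= sub0r normrN gtr0_norm// (lt_trans cs sr).
by rewrite ltr_norml => /andP[_ ?]; lra.
Qed.
End RealDerivativeRules.

(** * The gradient estimate for positive harmonic functions *)

Section GradientBound.
Context {R : realType}.
Local Notation C := (cplx R).

(** The real part of the logarithmic derivative. *)
Lemma rd_ln_cm (g : R -> C) (t : R) (d : C) : rder g t d -> g t != 0 ->
  is_derive t 1 (fun s => ln (cm (g s))) (re (d / g t)).
Proof.
move=> gd g0; have rg := rder_re gd; have ig := rder_im gd.
have c0 : 0 < cm (g t) by rewrite cm_gt0.
have c2 : 0 < re (g t) ^+ 2 + im (g t) ^+ 2 by rewrite -cm2 exprn_gt0.
pose N s := re (g s) * re (g s) + im (g s) * im (g s).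
have Nd := rdD (rdM rg rg) (rdM ig ig).
have N0 : 0 < N t by rewrite /N -!expr2.
apply: (@rd_near _ (fun s => 2^-1 * ln (N s))).
  have : \forall s \near t, g s != 0.
    by case: (rder_cont gd) => gc; exact: (cvgr_neq0 (g t) gc g0).
  apply: filterS => s gs0; rewrite /N -!expr2 -cm2 lnXn ?cm_gt0//.
  by field.
apply: (is_derive_eq (rdM (is_derive_cst (2^-1 : R) t 1) (rd_ln N0 Nd))).
rewrite mul0r add0r reM reV imV /N -!expr2 /=; field.
by rewrite gt_eqF.
Qed.

(** [A] has the differential [h |-> Re (k z * h)] at [z]; stated along curves.
    When [k] is holomorphic, such a function [A] is harmonic. *)
Definition rediff (A : C -> R) (k : C -> C) (z : C) := forall (g : R -> C) t d,
  g t = z -> rder g t d -> is_derive t 1 (fun s => A (g s)) (re (k z * d)).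

Variables (A : C -> R) (k : C -> C).
Let D := @unit_disk R.
Hypothesis A0 : forall z, D z -> 0 < A z.
Hypothesis Ac : forall z, D z -> ctsat A z.
Hypothesis dA : forall z, D z -> rediff A k z.
Hypothesis kD : holo D k.
Hypothesis k0 : forall z, D z -> k z != 0.

Lemma disk_open : open D.
Proof.
rewrite openE => z /unit_diskE z1.
apply: filterS (ball_near (a := z) (z0 := 0) (d := 1) _); last by rewrite subr0.
by move=> w; rewrite subr0 => /unit_diskE.
Qed.

(* [v r] is the logarithm of the quantity that is maximized over the disk of
   radius [r]; [v1 r e] is its derivative in the direction [e]. *)
Let v (r : R) z := ln (cm (k z)) + ln (r ^+ 2 - cm z ^+ 2) - ln (A z).
Let q z := der k z / k z.
Let v1 (r : R) (e z : C) :=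
  re (q z * e) - 2 * (re z * re e + im z * im e) / (r ^+ 2 - cm z ^+ 2)
  - re (k z * e) / A z.

Lemma v_der r (p e : C) t : r < 1 -> cm (p + inC t * e) < r ->
  is_derive t 1 (fun s => v r (p + inC s * e)) (v1 r e (p + inC t * e)).
Proof.
move=> r1; set z := p + inC t * e => zr.
have Dz : D z by apply/unit_diskE; exact: lt_trans r1.
have ld := rder_line p e t.
have kd := holo_der kD Dz.
rewrite /v /v1; apply: rdB; last first.
  by apply: rd_ln; [exact: A0|exact: dA ld].
apply: rdD.
  have := rd_ln_cm (rder_comp ld kd) (k0 Dz).
  by rewrite -/z /q mulrAC.
have r0 : 0 <= r by rewrite ltW// (le_lt_trans _ zr).
have B0 : 0 < r ^+ 2 - cm z ^+ 2 by rewrite subr_gt0 ltrXn2r.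
pose N s := r ^+ 2 - (re (p + inC s * e) * re (p + inC s * e) +
                      im (p + inC s * e) * im (p + inC s * e)).
have NE s : r ^+ 2 - cm (p + inC s * e) ^+ 2 = N s by rewrite cm2 /N -!expr2.
have rg := rder_re ld; have ig := rder_im ld.
have Nd := rdB (is_derive_cst (r ^+ 2) t 1) (rdD (rdM rg rg) (rdM ig ig)).
have -> : (fun s => ln (r ^+ 2 - cm (p + inC s * e) ^+ 2)) = (fun s => ln (N s)).
  by apply/funext => s; rewrite NE.
have Nt : 0 < N t by rewrite -NE.
apply: (is_derive_eq (rd_ln Nt Nd)).
by rewrite -NE -/z sub0r mulNr; congr (- (_ / _)); ring.
Qed.

(** The sum of the second derivatives in the directions 1 and [i]: the terms in
    [a] and [b], which come from harmonic functions, cancel. *)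
Lemma harmonic_terms_cancel (a a' b b' x y c B px py r : R) :
  0 < c -> 0 < B -> r ^+ 2 = B + (px ^+ 2 + py ^+ 2) ->
  (a * (1 ^+ 2 - 0 ^+ 2) - 2 * a' * 1 * 0)
     - (2 * (1 ^+ 2 + 0 ^+ 2) / B + 4 * (px * 1 + py * 0) ^+ 2 / B ^+ 2)
     - ((b * (1 ^+ 2 - 0 ^+ 2) - 2 * b' * 1 * 0) / c - (x * 1 - y * 0) ^+ 2 / c ^+ 2)
  + ((a * (0 ^+ 2 - 1 ^+ 2) - 2 * a' * 0 * 1)
     - (2 * (0 ^+ 2 + 1 ^+ 2) / B + 4 * (px * 0 + py * 1) ^+ 2 / B ^+ 2)
     - ((b * (0 ^+ 2 - 1 ^+ 2) - 2 * b' * 0 * 1) / c - (x * 0 - y * 1) ^+ 2 / c ^+ 2)) <= 0 ->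
  (x ^+ 2 + y ^+ 2) / c ^+ 2 <= 4 * r ^+ 2 / B ^+ 2.
Proof.
move=> c0 B0 rB H.
rewrite -subr_le0; apply: le_trans H; rewrite le_eqVlt; apply/orP; left; apply/eqP.
by rewrite rB; field; rewrite !gt_eqF.
Qed.

Lemma v1_der r (p e : C) a b : re e = a -> im e = b -> r < 1 -> cm p < r ->
  is_derive (0 : R) 1 (fun s => v1 r e (p + inC s * e))
    ((re (der q p) * (a ^+ 2 - b ^+ 2) - 2 * im (der q p) * a * b)
     - (2 * (a ^+ 2 + b ^+ 2) / (r ^+ 2 - cm p ^+ 2)
        + 4 * (re p * a + im p * b) ^+ 2 / (r ^+ 2 - cm p ^+ 2) ^+ 2)
     - ((re (der k p) * (a ^+ 2 - b ^+ 2) - 2 * im (der k p) * a * b) / A p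
        - (re (k p) * a - im (k p) * b) ^+ 2 / A p ^+ 2)).
Proof.
move=> <- <- r1 pr.
have Dp : D p by apply/unit_diskE; exact: lt_trans r1.
have ld := rder_line p e 0.
have pE : p + inC 0 * e = p by rewrite inC0 mul0r addr0.
have kd := holo_der kD Dp.
have kd2 := holo_der (holo_deriv disk_open kD) Dp.
have qd : cder q p (der q p).
  have h : cder q p _ := cderM kd2 (cderV (k0 Dp) kd).
  by rewrite (cder_der h).
rewrite /v1; apply: rdB; last first.
  have kl : cder k (p + inC 0 * e) (der k p) by rewrite pE.
  have h1 := rder_re (rderM (rder_comp ld kl) (cderiv_cst _ e 0)).
  have Al : is_derive (0 : R) 1 (fun s : R => A (p + inC s * e)) (re (k p * e)).
    by apply: dA Dp _ _ _ _ ld.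
  have An0 : A (p + inC 0 * e) != 0 by rewrite pE gt_eqF// A0.
  apply: (is_derive_eq (rdM h1 (rdV An0 Al))).
  by rewrite pE mulr0 addr0 !reM !imM; field; rewrite gt_eqF// A0.
apply: rdB.
  have ql : cder q (p + inC 0 * e) (der q p).
    by rewrite pE.
  have h1 := rder_re (rderM (rder_comp ld ql) (cderiv_cst _ e 0)).
  by apply: (is_derive_eq h1); rewrite mulr0 addr0 !reM imM; ring.
have rg := rder_re ld; have ig := rder_im ld.
pose N s := r ^+ 2 - (re (p + inC s * e) * re (p + inC s * e) +
                      im (p + inC s * e) * im (p + inC s * e)).
have NE s : r ^+ 2 - cm (p + inC s * e) ^+ 2 = N s by rewrite cm2 /N -!expr2.
have Nd := rdB (is_derive_cst (r ^+ 2) (0 : R) (1 : R)) (rdD (rdM rg rg) (rdM ig ig)).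
have r0 : 0 <= r by rewrite ltW// (le_lt_trans _ pr).
have B0 : 0 < r ^+ 2 - cm p ^+ 2 by rewrite subr_gt0 ltrXn2r.
have N0 : N 0 != 0 by rewrite -NE pE gt_eqF.
have -> : (fun s => 2 * (re (p + inC s * e) * re e + im (p + inC s * e) * im e) /
    (r ^+ 2 - cm (p + inC s * e) ^+ 2)) = (fun s => 2 * (re (p + inC s * e) * re e + im (p + inC s * e) * im e) * (N s)^-1).
  by apply/funext => s; rewrite NE.
have c1 (x : R) := is_derive_cst x (0 : R) (1 : R).
have h := rdM (rdM (c1 2) (rdD (rdM rg (c1 (re e))) (rdM ig (c1 (im e))))) (rdV N0 Nd).
apply: (is_derive_eq h).
rewrite -NE pE; set B := r ^+ 2 - cm p ^+ 2 in B0 *.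
by field; rewrite gt_eqF.
Qed.

(** At an interior maximum of [v r] the second derivatives along the two
    coordinate axes add up to a nonpositive number; the harmonic terms cancel. *)
Lemma v_max_bound r (p : C) : r < 1 -> cm p < r ->
  (forall z, cm z < r -> v r z <= v r p) ->
  cm (k p) * (r ^+ 2 - cm p ^+ 2) <= 2 * r * A p.
Proof.
move=> r1 pr vmax.
have Dp : D p by apply/unit_diskE; exact: lt_trans r1.
have r0 : 0 < r by rewrite (le_lt_trans _ pr).
have B0 : 0 < r ^+ 2 - cm p ^+ 2 by rewrite subr_gt0 ltrXn2r// ltW.
have d0 : 0 < r - cm p by rewrite subr_gt0.
have inr (e : C) t : cm e = 1 -> `|t| < r - cm p -> cm (p + inC t * e) < r.
  move=> e1 tr; apply: le_lt_trans (cmD _ _) _.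
  by rewrite cmM cm_inC e1 mulr1 addrC -ltrBrDr.
pose V t := v r (p + inC t * 1) + v r (p + inC t * iC).
pose V1 t := v1 r 1 (p + inC t * 1) + v1 r iC (p + inC t * iC).
have Vd (t : R) : `|t| < r - cm p -> is_derive t 1 V (V1 t).
  by move=> tr; apply: rdD; apply: v_der => //; apply: inr; rewrite ?cm1 ?cm_iC.
have V1d := rdD (@v1_der r p 1 1 0 re1 im1 r1 pr) (@v1_der r p iC 0 1 erefl erefl r1 pr).
have Vm (t : R) : `|t| < r - cm p -> V t <= V 0.
  move=> tr; rewrite /V !inC0 !mul0r !addr0.
  by apply: lerD; apply: vmax; apply: inr; rewrite ?cm1 ?cm_iC.
have Ap := A0 Dp; set B := r ^+ 2 - cm p ^+ 2 in B0 *.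
have rB : r ^+ 2 = B + (re p ^+ 2 + im p ^+ 2) by rewrite -cm2 subrK.
have H2 := harmonic_terms_cancel Ap B0 rB (second_derivative_test d0 Vd V1d Vm).
have Bk : 0 <= cm (k p) * B by rewrite mulr_ge0// ltW.
have rA : 0 <= 2 * r * A p by rewrite mulr_ge0 ?mulr_ge0// ltW.
rewrite -(@ler_pXn2r _ 2) ?nnegrE// !exprMn (cm2 (k p)).
set AA := A p in H2 Ap *.
have AA2 : 0 < AA ^+ 2 by rewrite exprn_gt0.
have BB2 : 0 < B ^+ 2 by rewrite exprn_gt0.
move: H2; rewrite ler_pdivrMr// [leRHS]mulrAC ler_pdivlMr// => H2.
by apply: le_trans H2 _; rewrite le_eqVlt; apply/orP; left; apply/eqP; ring.
Qed.
(** Gradient estimate for positive harmonic functions on the unit disk. *)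
Theorem gradient_bound z0 : D z0 -> cm (k z0) * (1 - cm z0 ^+ 2) <= 2 * A z0.
Proof.
move=> Dz0; have /unit_diskE z01 := Dz0.
have Az0 := A0 Dz0.
(* The estimate on a smaller disk. *)
have key r : cm z0 < r -> r < 1 -> cm (k z0) * (r ^+ 2 - cm z0 ^+ 2) <= 2 * A z0.
  move=> z0r r1; have r0 : 0 < r by rewrite (le_lt_trans _ z0r).
  have Dr z : cm z <= r -> D z by move=> zr; apply/unit_diskE; exact: le_lt_trans r1.
  pose Q z := cm (k z) * (r ^+ 2 - cm z ^+ 2) / A z.
  have Bge z : cm z <= r -> 0 <= r ^+ 2 - cm z ^+ 2.
    by move=> zr; rewrite subr_ge0 lerXn2r// nnegrE// ltW.
  have Bgt z : cm z < r -> 0 < r ^+ 2 - cm z ^+ 2.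
    by move=> zr; rewrite subr_gt0 ltrXn2r// ?nnegrE// ltW.
  have Qc z : cm z <= r -> ctsat Q z.
    move=> zr; have Dz := Dr z zr.
    have kc : ctsat k z by have [d /cder_cont] := kD Dz.
    apply: (@contC_M R).
      apply: (@contC_M R); first exact: contC_cm.
      apply: (@contC_B R); first exact: contC_cst.
      apply: (@contC_M R); apply: contC_cm; apply: Ctsat; exact: cvg_id.
    by apply: (@contC_V R); [rewrite gt_eqF// A0|exact: Ac].
  pose K : set (R * R) := [set p | cm (toC p) <= r].
  have K0 : K !=set0 by exists (0, 0); rewrite /K /= (_ : toC (0, 0) = 0)// cm0 ltW.
  have Kc : compact K.
    apply: (@subclosed_compact _ _ (`[-r, r] `*` `[-r, r])).
    - have -> : K = (fun p => cm (toC p)) @^-1` [set x | x <= r] by [].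
      apply: preimage_closed; last exact: closed_le.
      move=> p _; have : ctsat (fun p => cm (toC p)) p.
        apply: (@ctsat_comp _ _ _ (@toC R) (@cm R)); apply: Ctsat.
          exact: toC_cont.
        exact: cm_cont.
      by case.
    - by apply: compact_setX; exact: segment_compact.
    - move=> p pK; split; rewrite /= in_itv /= -ler_norml.
        exact: le_trans (re_le_cm (toC p)) pK.
      exact: le_trans (im_le_cm (toC p)) pK.
  have [] := @compact_EVT_max _ _ (fun p => Q (toC p)) K K0 Kc.
    apply: continuous_in_subspaceT => p; rewrite inE => pK.
    have : ctsat (fun p => Q (toC p)) p.
      by apply: ctsat_comp; [apply: Ctsat; exact: toC_cont|exact: Qc].
    by case.
  move=> c; rewrite inE => cK cmax.
  have Qmax z : cm z <= r -> Q z <= Q (toC c).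
    move=> zr; have := cmax (re z, im z); rewrite inE /K /= (_ : toC (re z, im z) = z).
      exact.
    by rewrite -[RHS]mkcK.
  set p := toC c in Qmax; have pr : cm p <= r := cK.
  have Ap := A0 (Dr p pr).
  have QA z : D z -> Q z * A z = cm (k z) * (r ^+ 2 - cm z ^+ 2).
    by move=> Dz; rewrite /Q divfK// gt_eqF// A0.
  rewrite -(QA _ Dz0); apply: ler_wpM2r; first exact: ltW.
  apply: le_trans (Qmax z0 (ltW z0r)) _.
  have Qgt z : cm z < r -> 0 < Q z.
    move=> zr; have Dz := Dr _ (ltW zr).
    by rewrite divr_gt0 ?A0// mulr_gt0 ?Bgt// cm_gt0 k0.
  have [pr'|pr'] := ltP (cm p) r; last first.
    have := Qgt z0 z0r; rewrite ltNge (le_trans (Qmax z0 (ltW z0r)))//.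
    by rewrite /Q (_ : cm p = r) ?subrr ?mulr0 ?mul0r//; apply/eqP; rewrite eq_le pr.
  have vQ z : cm z < r -> v r z = ln (Q z).
    move=> zr; have Dz := Dr _ (ltW zr).
    have k1 : 0 < cm (k z) by rewrite cm_gt0 k0.
    by rewrite /v /Q ln_div ?posrE ?mulr_gt0 ?A0 ?Bgt// lnM ?posrE ?Bgt.
  have vmax z : cm z < r -> v r z <= v r p.
    move=> zr; rewrite !vQ// ler_ln ?posrE ?Qgt//.
    by apply: Qmax; exact: ltW.
  have := v_max_bound r1 pr' vmax.
  rewrite -(QA _ (Dr p pr)) ler_pM2r// => Qp; apply: le_trans Qp _.
  by rewrite -[leRHS]mulr1 ler_pM2l// ltW.
rewrite leNgt; apply/negP => lt0.
have kz0 : 0 < cm (k z0) by rewrite cm_gt0 k0.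
(* If the estimate failed, so would that on the disk of radius [sqrt r], for
   [r] strictly between [X] and 1. *)
pose X := 2 * A z0 / cm (k z0) + cm z0 ^+ 2.
have X1 : X < 1.
  by rewrite /X -ltrBrDr ltr_pdivrMr// [ltRHS]mulrC.
have X0 : 0 <= X by rewrite addr_ge0 ?divr_ge0 ?mulr_ge0 ?exprn_ge0// ltW.
have m1 : Num.max X (cm z0) < 1 by rewrite gt_max X1 z01.
pose r := (Num.max X (cm z0) + 1) / 2.
have zm : cm z0 <= Num.max X (cm z0) by rewrite le_max lexx orbT.
have Xm : X <= Num.max X (cm z0) by rewrite le_max lexx.
have r1 : r < 1 by rewrite /r; lra.
have zr : cm z0 < r by rewrite /r; lra.
have := key (Num.sqrt r).
have r0 : 0 < r by rewrite (le_lt_trans _ zr).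
have srr : Num.sqrt r ^+ 2 = r by rewrite sqr_sqrtr// ltW.
have sr1 : Num.sqrt r < 1 by rewrite -(sqrtr1 R) ltr_sqrt.
have rs : r <= Num.sqrt r.
  rewrite -{1}srr expr2 -[leRHS]mulr1; apply: ler_wpM2l; first exact: sqrtr_ge0.
  exact: ltW.
move=> /(_ (lt_le_trans zr rs) sr1); rewrite srr; apply/negP; rewrite -ltNge.
have : X < r by rewrite /r; lra.
by rewrite /X -ltrBrDr ltr_pdivrMr// (mulrC (r - _)).
Qed.
End GradientBound.

(** * Conformal maps, the half plane and the Cayley transform *)

Section ConformalPairs.
Context {R : realType}.
Local Notation C := (cplx R).
Implicit Types (A B : set C) (f g : C -> C).

(** [f] and [g] are mutually inverse holomorphic maps between [A] and [B]. *)
Definition conf A B f g :=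
  [/\ forall z, A z -> B (f z) /\ g (f z) = z,
      forall w, B w -> A (g w) /\ f (g w) = w, holo A f & holo B g].

Lemma conf_sym A B f g : conf A B f g -> conf B A g f.
Proof. by case. Qed.

Lemma holo_comp A B f g : (forall z, A z -> B (f z)) -> holo A f -> holo B g ->
  holo A (fun z => g (f z)).
Proof.
move=> AB fA gB z Az; have [d fd] := fA z Az; have [e ge] := gB _ (AB z Az).
by exists (e * d); exact: cder_comp fd ge.
Qed.

Lemma conf_comp A B E f g h k : conf A B f g -> conf B E h k ->
  conf A E (fun z => h (f z)) (fun w => g (k w)).
Proof.
move=> [fB gA fh gh] [hE kB hh kh]; split.
- move=> z Az; have [Bf gf] := fB z Az; have [Eh kf] := hE _ Bf.
  by rewrite kf gf.
- move=> w Ew; have [Bk hk] := kB w Ew; have [Ag fg] := gA _ Bk.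
  by rewrite fg hk.
- by apply: holo_comp fh hh => z /fB[].
- by apply: holo_comp kh gh => w /kB[].
Qed.

Lemma conf_der A B f g z : open A -> conf A B f g -> A z ->
  der g (f z) * der f z = 1.
Proof.
move=> oA [fB _ fh gh] Az; have [Bf _] := fB z Az.
have h := cder_comp (holo_der fh Az) (holo_der gh Bf).
rewrite -(cder_der h); apply: cder_der.
apply: cderiv_near (cderiv_emb _ _).
have : \forall s \near z, A s by exact: open_nbhs_nbhs.
by apply: filterS => s /fB[_ ->].
Qed.

Lemma conf_der_neq0 A B f g z : open A -> conf A B f g -> A z -> der f z != 0.
Proof.
move=> oA fg Az; apply: contra_eq_neq (conf_der oA fg Az) => ->.
by rewrite mulr0 eq_sym oner_neq0.
Qed.

Lemma holo_cont A f z : holo A f -> A z -> ctsat f z.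
Proof. by move=> fA /fA[d /cder_cont]. Qed.

(** The inverse of a conformal homeomorphism is holomorphic. *)
Lemma conformal_homeoP A B f : open A -> open B -> conformal_homeo A B f ->
  exists g, conf A B f g.
Proof.
move=> oA oB [[g [fB gA fc gc]] fd]; exists g; split=> //.
  by move=> z /fd[/derivable_cder ? _]; exists ('D_1 f z).
move=> w Bw; have [Aw fw] := gA w Bw.
have [/derivable_cder[q [qc qd fq]] d0] := fd _ Aw.
have gcw : ctsat g w.
  apply: Ctsat; move: gc; rewrite continuous_open_subspace// => /(_ w).
  by rewrite inE => /(_ Bw).
have qgc : ctsat (fun v => q (g v)) w by exact: ctsat_comp.
have qg0 : q (g w) != 0 by rewrite qd.
exists (q (g w))^-1; exists (fun v => (q (g v))^-1); split=> //.
- exact: contC_V.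
- have nB : \forall v \near w, B v by exact: open_nbhs_nbhs.
  have nq : \forall v \near w, q (g v) != 0.
    by case: qgc => qgc; exact: (cvgr_neq0 (q (g w)) qgc qg0).
  have nf : \forall v \near w, f (g v) - f (g w) = q (g v) * (g v - g w).
    by case: gcw => gcw; exact: (gcw [set z | f z - f (g w) = q z * (z - g w)]).
  apply: filterS3 nB nq nf => v Bv qv; have [_ fv] := gA v Bv.
  by rewrite fv fw /= => ->; rewrite mulKf.
Qed.

Lemma conf_conformal_homeo A B f g : open A -> open B -> conf A B f g ->
  conformal_homeo A B f.
Proof.
move=> oA oB fg; have [fB gA fh gh] := fg; split.
  exists g; split=> //.
    rewrite continuous_open_subspace// => z; rewrite inE => Az.
    by case: (holo_cont fh Az).
  rewrite continuous_open_subspace// => z; rewrite inE => Az.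
  by case: (holo_cont gh Az).
move=> z Az; split; last exact: conf_der_neq0 fg Az.
by have /is_derive_cderP[] := holo_der fh Az.
Qed.
End ConformalPairs.

Section HalfPlane.
Context {R : realType}.
Local Notation C := (cplx R).
Implicit Types (w z : C).

(** The right half plane, the Cayley transform to the disk and its inverse. *)
Definition rhp : set C := [set w | 0 < re w].
Definition cay w : C := (w - 1) / (w + 1).
Definition cayi z : C := (1 + z) / (1 - z).

Lemma rhp_open : open rhp.
Proof.
rewrite openE => w /= w0; apply: filterS (near_ball w w0) => v vw.
have := le_lt_trans (ler_norm _) (le_lt_trans (re_le_cm (w - v)) _).
by rewrite cmBC => /(_ _ vw); rewrite /rhp /= reB; lra.
Qed.

Lemma rhpD1 w : rhp w -> w + 1 != 0.
Proof.
rewrite /rhp /= => w0; apply: contraTneq isT => /(congr1 (@re R)).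
by rewrite reD re1 re0; lra.
Qed.

Lemma disk1B z : unit_disk z -> 1 - z != 0.
Proof.
move=> /unit_diskE z1; rewrite subr_eq0; apply: contraTneq z1 => <-.
by rewrite cm1 ltxx.
Qed.

Lemma cay_conformal_factor w : rhp w -> 1 - cm (cay w) ^+ 2 = 4 * re w / cm (w + 1) ^+ 2.
Proof.
move=> /rhpD1 w1; have c0 : 0 < cm (w + 1) ^+ 2 by rewrite exprn_gt0// cm_gt0.
have E : 4 * re w = cm (w + 1) ^+ 2 - cm (w - 1) ^+ 2.
  by rewrite !cm2 !reD !imD reN imN re1 im1; ring.
by rewrite /cay cmM cmV E; field; rewrite cm_eq0.
Qed.

Lemma cayi_conformal_factor z : unit_disk z ->
  re (cayi z) = (1 - cm z ^+ 2) / cm (1 - z) ^+ 2.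
Proof.
move=> /disk1B z1.
have c0 : cm (1 - z) ^+ 2 != 0 by rewrite expf_neq0// cm_eq0.
rewrite /cayi reM reV imV -cm2; move: (cm (1 - z) ^+ 2) c0 => N N0.
by rewrite cm2 !reD !imD reN imN re1 im1; field.
Qed.

Lemma cay_disk w : rhp w -> unit_disk (cay w).
Proof.
move=> wP; have w1 := rhpD1 wP; have w0 : 0 < re w := wP; apply/unit_diskE.
have : 0 < 1 - cm (cay w) ^+ 2.
  by rewrite cay_conformal_factor// divr_gt0 ?exprn_gt0 ?cm_gt0// mulr_gt0.
by rewrite subr_gt0 => h; rewrite -(@ltr_pXn2r _ 2) ?nnegrE// expr1n.
Qed.

Lemma cayi_rhp z : unit_disk z -> rhp (cayi z).
Proof.
move=> zD; have z1 := disk1B zD; move/unit_diskE: (zD) => zl.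
rewrite /rhp /= cayi_conformal_factor// divr_gt0 ?exprn_gt0 ?cm_gt0//.
by rewrite subr_gt0 exprn_ilt1.
Qed.

Lemma two_neq0 : (2 : C) != 0. Proof. by rewrite pnatr_eq0. Qed.

Lemma cayK w : rhp w -> cayi (cay w) = w.
Proof.
move=> /rhpD1 w1; rewrite /cayi /cay.
have h : 1 - (w - 1) / (w + 1) = 2 / (w + 1) by field.
rewrite h; have -> : 1 + (w - 1) / (w + 1) = 2 * w / (w + 1) by field.
by field; rewrite w1 ?two_neq0 ?pnatr_eq0.
Qed.

Lemma cayiK z : unit_disk z -> cay (cayi z) = z.
Proof.
move=> /disk1B z1; rewrite /cayi /cay.
have h : (1 + z) / (1 - z) + 1 = 2 / (1 - z) by field.
rewrite h; have -> : (1 + z) / (1 - z) - 1 = 2 * z / (1 - z) by field.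
by field; rewrite z1 ?two_neq0 ?pnatr_eq0.
Qed.

Lemma cay_der w : rhp w -> cder cay w (2 / (w + 1) ^+ 2).
Proof.
move=> /rhpD1 w1.
have h1 : cder (fun v => v - 1) w 1 by exact: cder_sub.
have h2 : cder (fun v => v + 1) w (1 + 0).
  by apply: cderivD; [exact: cderiv_emb|exact: cderiv_cst].
have h : cder cay w _ := cderM h1 (cderV (f := fun v => v + 1) w1 h2).
apply: (cderiv_eq h).
by field.
Qed.

Lemma cayi_der z : unit_disk z -> cder cayi z (2 / (1 - z) ^+ 2).
Proof.
move=> /disk1B z1.
have h1 : cder (fun v => 1 + v) z (0 + 1).
  by apply: cderivD; [exact: cderiv_cst|exact: cderiv_emb].
have h2 : cder (fun v => 1 - v) z (0 - 1).
  by apply: cderivB; [exact: cderiv_cst|exact: cderiv_emb].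
have h : cder cayi z _ := cderM h1 (cderV (f := fun v => 1 - v) z1 h2).
apply: (cderiv_eq h).
by field.
Qed.

Lemma cay_conf : conf rhp (@unit_disk R) cay cayi.
Proof.
split.
- by move=> w wP; split; [exact: cay_disk|exact: cayK].
- by move=> z zD; split; [exact: cayi_rhp|exact: cayiK].
- by move=> w /cay_der; eexists; eassumption.
- by move=> z /cayi_der; eexists; eassumption.
Qed.

(** The gradient estimate on the half plane. *)
Lemma gradient_bound_rhp (A : C -> R) (k : C -> C) :
  (forall w, rhp w -> 0 < A w) -> (forall w, rhp w -> ctsat A w) ->
  (forall w, rhp w -> rediff A k w) -> holo rhp k ->
  (forall w, rhp w -> k w != 0) ->
  forall w, rhp w -> cm (k w) * re w <= A w.
Proof.
move=> A0 Ac dA kh k0 w wP.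
have n0 z : unit_disk z -> 2 / (1 - z) ^+ 2 != 0.
  by move=> /disk1B z1; rewrite mulf_neq0 ?two_neq0// invr_neq0// expf_neq0.
pose k' z := k (cayi z) * (2 / (1 - z) ^+ 2).
have : cm (k' (cay w)) * (1 - cm (cay w) ^+ 2) <= 2 * A (cayi (cay w)).
  apply: (@gradient_bound _ (fun z => A (cayi z)) k' _ _ _ _ _ _ (cay_disk wP)).
  - by move=> z /cayi_rhp; exact: A0.
  - move=> z zD; apply: (ctsat_comp (f := cayi)); last by apply: Ac; exact: cayi_rhp.
    exact: cder_cont (cayi_der zD).
  - move=> z zD g t d gt gd; have zP := cayi_rhp zD.
    have kd : cder cayi (g t) (2 / (1 - z) ^+ 2) by rewrite gt; exact: cayi_der.
    have h := dA _ zP (fun s => cayi (g s)) t _ (congr1 cayi gt) (rder_comp gd kd).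
    by rewrite -mulrA.
  - move=> z zD; have [d kd] : exists d, cder (fun z => k (cayi z)) z d.
      by apply: holo_comp kh _ zD => [v /cayi_rhp|v /cayi_der] //; eexists; eassumption.
    have z1 := disk1B zD.
    have h2 : cder (fun v => 1 - v) z (0 - 1).
      by apply: cderivB; [exact: cderiv_cst|exact: cderiv_emb].
    have h3 : (1 - z) ^+ 2 != 0 by rewrite expf_neq0.
    have h4 := cderivZ 2 (cderV (f := fun v => (1 - v) ^+ 2) h3 (cderM h2 h2)).
    by eexists; exact: (cderM kd h4).
  - by move=> z zD; rewrite mulf_neq0 ?n0// k0//; exact: cayi_rhp.
rewrite /k' cayK// cay_conformal_factor//; have w1 := rhpD1 wP.
have -> : 2 / (1 - cay w) ^+ 2 = (w + 1) ^+ 2 / 2.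
  have -> : 1 - cay w = 2 / (w + 1) by rewrite /cay; field.
  by field; rewrite w1 ?two_neq0 ?pnatr_eq0.
have c0 : cm (w + 1) != 0 by rewrite cm_eq0.
have cm_two : cm (2 : C) = 2.
  by rewrite (_ : 2 = inC 2) ?cm_inC ?ger0_norm// (natrD _ 1 1) inCD.
rewrite (cmM (k w)) (cmM (_ ^+ 2)) cmX cmV cm_two.
have -> : cm (k w) * (cm (w + 1) ^+ 2 / 2) * (4 * re w / cm (w + 1) ^+ 2) =
  2 * (cm (k w) * re w) by field.
by rewrite ler_pM2l.
Qed.
End HalfPlane.

(** * Schwarz-Pick inequalities *)

Section SchwarzPick.
Context {R : realType}.
Local Notation C := (cplx R).

Lemma rediff_re (f : C -> C) (A : set C) z : holo A f -> A z ->
  rediff (fun w => re (f w)) (der f) z.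
Proof.
move=> fA Az g t d gt gd; apply: rder_re; apply: (rder_comp gd).
by rewrite gt; exact: holo_der fA Az.
Qed.

Lemma schwarz_pick_disk_rhp (f g : C -> C) z : conf (@unit_disk R) (@rhp R) f g ->
  unit_disk z -> cm (der f z) * (1 - cm z ^+ 2) <= 2 * re (f z).
Proof.
move=> fg zD; have [fP _ fh _] := fg; have oD := @disk_open R.
apply: (@gradient_bound _ (fun z => re (f z)) (der f)) => //.
- by move=> w /fP[].
- by move=> w wD; apply: contC_re; exact: holo_cont fh wD.
- by move=> w wD; exact: rediff_re fh wD.
- exact: holo_deriv.
- by move=> w wD; exact: conf_der_neq0 fg wD.
Qed.

Lemma schwarz_pick_rhp_disk (f g : C -> C) w : conf (@rhp R) (@unit_disk R) f g ->
  rhp w -> 2 * cm (der f w) * re w <= 1 - cm (f w) ^+ 2.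
Proof.
move=> fg wP; have oP := @rhp_open R; have [fD _ fh _] := fg.
have hg := conf_comp fg (conf_sym (@cay_conf R)).
have [hP _ hh _] := hg.
have := @gradient_bound_rhp _ (fun z => re (cayi (f z))) (der (fun z => cayi (f z)))
  _ _ _ _ _ w wP.
have -> : der (fun z => cayi (f z)) w = 2 / (1 - f w) ^+ 2 * der f w.
  by apply: cder_der; exact: (cder_comp (holo_der fh wP) (cayi_der (fD w wP).1)).
have f1 := disk1B (fD w wP).1.
have c0 : 0 < cm (1 - f w) ^+ 2 by rewrite exprn_gt0// cm_gt0.
have cm_two : cm (2 : C) = 2.
  by rewrite (_ : 2 = inC 2) ?cm_inC ?ger0_norm// (natrD _ 1 1) inCD.
have -> : cm (2 / (1 - f w) ^+ 2 * der f w) = 2 * cm (der f w) / cm (1 - f w) ^+ 2.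
  by rewrite (cmM (_ / _)) (cmM 2) cmV cmX cm_two mulrAC.
rewrite cayi_conformal_factor; last exact: (fD w wP).1.
rewrite mulrAC ler_pM2r ?invr_gt0//; apply => //.
- by move=> z /hP[].
- by move=> z zP; apply: contC_re; exact: holo_cont hh zP.
- by move=> z zP; exact: rediff_re hh zP.
- exact: holo_deriv.
- by move=> z zP; exact: conf_der_neq0 hg zP.
Qed.

(** A conformal map of the half plane that omits [zeta] and stays within
    distance [M] of it: [log (M / |f - zeta|)] is positive and harmonic, and
    the gradient estimate applies to it. *)
Lemma omitted_point_bound (Om : set C) (f g : C -> C) (zeta w : C) (M : R) :
  open Om -> conf (@rhp R) Om f g -> ~ Om zeta ->
  (forall z, Om z -> cm (z - zeta) < M) -> rhp w ->
  cm (der f w / (f w - zeta)) * re w <= ln M - ln (cm (f w - zeta)).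
Proof.
move=> oO fg nz bM wP; have oP := @rhp_open R; have [fO _ fh _] := fg.
have n0 z : rhp z -> f z - zeta != 0.
  move=> /fO[fz _]; rewrite subr_eq0; apply/eqP => E; apply: nz; by rewrite -E.
have c0 z : rhp z -> 0 < cm (f z - zeta) by move=> /n0; rewrite cm_gt0.
have hd z : rhp z -> cder (fun v => f v - zeta) z (der f z).
  move=> zP; rewrite -[der f z]subr0; apply: cderivB; last exact: cderiv_cst.
  exact: holo_der fh zP.
have := @gradient_bound_rhp _ (fun z => ln M - ln (cm (f z - zeta)))
  (fun z => - (der f z / (f z - zeta))) _ _ _ _ _ w wP.
rewrite cmN; apply.
- move=> z zP; have zM := bM _ (fO z zP).1.
  by rewrite subr_gt0 ltr_ln ?posrE ?c0// (lt_trans _ zM)// c0.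
- move=> z zP; apply: (@contC_B R); first exact: contC_cst.
  have fc : ctsat (fun z => cm (f z - zeta)) z.
    by apply: contC_cm; exact: cder_cont (hd z zP).
  apply: (ctsat_comp (g := @ln R) fc); apply: Ctsat; apply: continuous_ln.
  exact: c0.
- move=> z zP h t d ht hdd.
  have hz : cder (fun v => f v - zeta) (h t) (der f z) by rewrite ht; exact: hd.
  have hn : f (h t) - zeta != 0 by rewrite ht; exact: n0.
  have H := rdB (is_derive_cst (ln M) t (1 : R)) (rd_ln_cm (rder_comp hdd hz) hn).
  by apply: (is_derive_eq H); rewrite sub0r ht mulNr reN mulrAC.
- move=> z zP; have [e de] := holo_deriv oP fh zP.
  by eexists; apply: cderivN; exact: (cderM de (cderV (f := fun v => f v - zeta) (n0 z zP) (hd z zP))).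
- move=> z zP; rewrite oppr_eq0 mulf_neq0 ?invr_neq0 ?n0//.
  exact: conf_der_neq0 fg zP.
Qed.
End SchwarzPick.

(** * Fermi coordinates along the positive real axis *)

Section FermiCoordinates.
Context {R : realType}.
Local Notation C := (cplx R).
Implicit Types (w : C) (s r c : R).

(** Hyperbolic secant and tangent. *)
Definition sech s : R := 2 / (expR s + expR (- s)).
Definition tanhr s : R := (expR s - expR (- s)) / (expR s + expR (- s)).

(** Polar coordinates on the right half plane: the point of modulus [r] at signed
    hyperbolic distance [s] from the positive real axis; [sdist] recovers [s]. *)
Definition pol r s : C := mkc (r * sech s) (r * tanhr s).
Definition sdist w : R := ln ((im w + cm w) / re w).

Lemma cosh_gt0 s : 0 < expR s + expR (- s).
Proof. by rewrite addr_gt0 ?expR_gt0. Qed.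

Lemma sech_gt0 s : 0 < sech s.
Proof. by rewrite divr_gt0// cosh_gt0. Qed.

Lemma expRNV s : expR (- s) = (expR s)^-1. Proof. exact: expRN. Qed.

Lemma sech2_tanh2 s : sech s ^+ 2 + tanhr s ^+ 2 = 1.
Proof.
have e0 : expR s != 0 by rewrite gt_eqF// expR_gt0.
have h := cosh_gt0 s; rewrite /sech /tanhr; move: h; rewrite expRNV => h.
have h' : expR s ^+ 2 + 1 != 0 by rewrite gt_eqF// ltr_wpDl// sqr_ge0.
by field; rewrite h' e0.
Qed.

Lemma expR_is_derive s : is_derive s 1 (@expR R) (expR s).
Proof. exact: is_derive_expR. Qed.

Lemma expRN_is_derive s : is_derive s 1 (fun t => expR (- t)) (- expR (- s)).
Proof.
have h := @rd_exp R (fun t => - t) s (-1) (is_deriveN (is_derive_id s 1)).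
by apply: (is_derive_eq h); rewrite mulrN1.
Qed.

Lemma sech_der s : is_derive s 1 sech (- (sech s * tanhr s)).
Proof.
have c0 : expR s + expR (- s) != 0 by rewrite gt_eqF// cosh_gt0.
have h := rdV (f := fun t => expR t + expR (- t)) c0 (rdD (expR_is_derive s) (expRN_is_derive s)).
apply: (is_derive_eq (rdM (is_derive_cst (2 : R) s (1 : R)) h)).
by rewrite /sech /tanhr /=; field.
Qed.

Lemma tanhr_der s : is_derive s 1 tanhr (sech s ^+ 2).
Proof.
have c0 : expR s + expR (- s) != 0 by rewrite gt_eqF// cosh_gt0.
have h := rdV (f := fun t => expR t + expR (- t)) c0 (rdD (expR_is_derive s) (expRN_is_derive s)).
have h2 := rdB (expR_is_derive s) (expRN_is_derive s).
apply: (is_derive_eq (rdM h2 h)).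
have e0 : expR s != 0 by rewrite gt_eqF// expR_gt0.
have h' : expR s ^+ 2 + 1 != 0 by rewrite gt_eqF// ltr_wpDl// sqr_ge0.
by rewrite /sech /=; move: c0; rewrite expRNV => c0; field; rewrite h' e0.
Qed.

Lemma cm_pol r s : 0 <= r -> cm (pol r s) = r.
Proof.
move=> r0; have : cm (pol r s) ^+ 2 = r ^+ 2.
  by rewrite cm2 /= -[RHS]mulr1 -(sech2_tanh2 s); ring.
by move/eqP; rewrite eqrXn2// => /eqP.
Qed.

Lemma pol_rhp r s : 0 < r -> rhp (pol r s).
Proof. by move=> r0; rewrite /rhp /= mulr_gt0// sech_gt0. Qed.

Lemma sdist_pol r s : 0 < r -> sdist (pol r s) = s.
Proof.
move=> r0; rewrite /sdist cm_pol ?ltW//= -[RHS]expRK; congr ln.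
have e0 : expR s != 0 by rewrite gt_eqF// expR_gt0.
have := cosh_gt0 s; rewrite /sech /tanhr expRNV => h.
have h' : expR s ^+ 2 + 1 != 0 by rewrite gt_eqF// ltr_wpDl// sqr_ge0.
by field; rewrite h' e0 (gt_eqF r0).
Qed.

Lemma rhp_im_cm w : rhp w -> 0 < im w + cm w.
Proof.
move=> wP; have : `|im w| < cm w.
  rewrite -(@ltr_pXn2r _ 2) ?nnegrE// real_normK ?num_real// cm2 ltrDr.
  by rewrite exprn_gt0.
by rewrite ltr_norml => /andP[h _]; lra.
Qed.

Lemma rhp_cm_gt0 w : rhp w -> 0 < cm w.
Proof.
move=> wP; rewrite cm_gt0; apply: contraTneq (wP : is_true (0 < re w)) => ->.
by rewrite ltxx.
Qed.

Lemma expR_sdist w : rhp w -> expR (sdist w) = (im w + cm w) / re w.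
Proof. by move=> wP; rewrite lnK// posrE divr_gt0// rhp_im_cm. Qed.

Lemma sech_sdist w : rhp w -> sech (sdist w) = re w / cm w.
Proof.
move=> wP; have r0 := rhp_cm_gt0 wP; have x0 : 0 < re w := wP; have s0 := rhp_im_cm wP.
rewrite /sech expRNV expR_sdist//.
have -> : (im w + cm w) / re w + ((im w + cm w) / re w)^-1 =
   ((im w + cm w) ^+ 2 + re w ^+ 2) / (re w * (im w + cm w)).
  by field; rewrite !gt_eqF.
have -> : (im w + cm w) ^+ 2 + re w ^+ 2 = 2 * cm w * (im w + cm w).
  have -> : re w ^+ 2 = cm w ^+ 2 - im w ^+ 2 by rewrite cm2; ring.
  ring.
by field; rewrite !gt_eqF.
Qed.

Lemma tanhr_sdist w : rhp w -> tanhr (sdist w) = im w / cm w.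
Proof.
move=> wP; have r0 := rhp_cm_gt0 wP; have x0 : 0 < re w := wP; have s0 := rhp_im_cm wP.
have -> : tanhr (sdist w) = sech (sdist w) * (expR (sdist w) - expR (- sdist w)) / 2.
  by rewrite /tanhr /sech; field; rewrite gt_eqF// cosh_gt0.
rewrite sech_sdist// expRNV expR_sdist//.
have -> : (im w + cm w) / re w - ((im w + cm w) / re w)^-1 =
   ((im w + cm w) ^+ 2 - re w ^+ 2) / (re w * (im w + cm w)).
  by field; rewrite !gt_eqF.
have -> : (im w + cm w) ^+ 2 - re w ^+ 2 = 2 * im w * (im w + cm w).
  have -> : re w ^+ 2 = cm w ^+ 2 - im w ^+ 2 by rewrite cm2; ring.
  ring.
by field; rewrite !gt_eqF.
Qed.

Lemma pol_sdist w : rhp w -> pol (cm w) (sdist w) = w.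
Proof.
move=> wP; have r0 := rhp_cm_gt0 wP.
rewrite /pol sech_sdist// tanhr_sdist//.
by apply: cplx_eqP => /=; rewrite mulrC divfK// gt_eqF.
Qed.

Lemma rd_cm (g : R -> C) (t : R) (d : C) : rder g t d -> g t != 0 ->
  is_derive t 1 (fun s => cm (g s)) (cm (g t) * re (d / g t)).
Proof.
move=> gd g0; have h := rd_exp (rd_ln_cm gd g0).
have c0 : 0 < cm (g t) by rewrite cm_gt0.
rewrite lnK ?posrE// in h; apply: rd_near h.
have : \forall s \near t, g s != 0.
  by case: (rder_cont gd) => gc; exact: (cvgr_neq0 (g t) gc g0).
by apply: filterS => s gs0; rewrite lnK// posrE cm_gt0.
Qed.

Lemma rd_sdist (g : R -> C) (t : R) (d : C) : rder g t d -> rhp (g t) ->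
  is_derive t 1 (fun s => sdist (g s)) (cm (g t) / re (g t) * im (d / g t)).
Proof.
move=> gd gP; have r0 := rhp_cm_gt0 gP; have x0 : 0 < re (g t) := gP.
have s0 := rhp_im_cm gP; have g0 : g t != 0 by rewrite -cm_gt0.
have q0 : 0 < (im (g t) + cm (g t)) / re (g t) by rewrite divr_gt0.
have x0' : re (g t) != 0 by rewrite gt_eqF.
have h := rd_ln (f := fun s => (im (g s) + cm (g s)) / re (g s)) q0
  (rdM (rdD (rder_im gd) (rd_cm gd g0)) (rdV (f := fun s => re (g s)) x0' (rder_re gd))).
apply: (is_derive_eq h); rewrite reM imM reV imV -cm2.
have E : re (g t) ^+ 2 = cm (g t) ^+ 2 - im (g t) ^+ 2 by rewrite cm2; ring.
set x := re (g t) in E x0 s0 *; set y := im (g t) in E s0 *.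
set r := cm (g t) in E r0 s0 *; set a := re d; set b := im d.
have -> : r / x * (a * (- y / r ^+ 2) + b * (x / r ^+ 2)) = (b * x - a * y) / (x * r).
  by field; rewrite !gt_eqF.
have -> : ((b + r * (a * (x / r ^+ 2) - b * (- y / r ^+ 2))) / x + (y + r) * (- a / x ^+ 2)) / ((y + r) / x)
   = (b * x * (y + r) + a * (x ^+ 2 - r ^+ 2 - r * y)) / ((x * r) * (y + r)).
  by field; rewrite !gt_eqF.
by rewrite E; field; rewrite !gt_eqF.
Qed.

(** The flow along the geodesics orthogonal to the positive real axis. *)
Definition shift c w : C := pol (cm w) (sdist w + c).

Lemma shift_rhp c w : rhp w -> rhp (shift c w).
Proof. by move=> wP; apply: pol_rhp; exact: rhp_cm_gt0. Qed.

Lemma cm_shift c w : cm (shift c w) = cm w.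
Proof. exact: cm_pol. Qed.

Lemma sdist_shift c w : rhp w -> sdist (shift c w) = sdist w + c.
Proof. by move=> wP; apply: sdist_pol; exact: rhp_cm_gt0. Qed.

Lemma shiftK c w : rhp w -> shift (- c) (shift c w) = w.
Proof. by move=> wP; rewrite {1}/shift cm_shift sdist_shift// addrK pol_sdist. Qed.

Lemma pol_der_s r s : rder (fun t => pol r t) s (iC * inC (sech s) * pol r s).
Proof.
have h1 := rdM (is_derive_cst r s (1 : R)) (sech_der s).
have h2 := rdM (is_derive_cst r s (1 : R)) (tanhr_der s).
apply: (cderiv_eq (rder_mkc h1 h2)); apply: cplx_eqP; rewrite !reimE /=; ring.
Qed.

Lemma rder_pol (p s : R -> R) (t a b : R) : is_derive t 1 p a -> is_derive t 1 s b ->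
  0 < p t ->
  rder (fun u => pol (p u) (s u)) t
    (pol (p t) (s t) * (inC (a / p t) + iC * inC (sech (s t) * b))).
Proof.
move=> pa sb p0.
have h1 := rdM pa (rd_comp sb (sech_der (s t))).
have h2 := rdM pa (rd_comp sb (tanhr_der (s t))).
apply: (cderiv_eq (rder_mkc h1 h2)); apply: cplx_eqP; rewrite !reimE /=.
  by field; rewrite gt_eqF.
by field; rewrite gt_eqF.
Qed.

(** The factor by which the shift stretches the angular direction. *)
Definition shift_stretch c w : R := sech (sdist w + c) / sech (sdist w).

(** At [w], the shift sends the vector [d = w (a + i b)] to
    [shift c w * (a + i l b)], where [l] is its angular stretch. *)
Lemma rder_shift c (g : R -> C) (t : R) (d : C) : rder g t d -> rhp (g t) ->
  rder (fun u => shift c (g u)) t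
    (shift c (g t) * (inC (re (d / g t)) + iC * inC (shift_stretch c (g t) * im (d / g t)))).
Proof.
move=> gd gP; have r0 := rhp_cm_gt0 gP; have g0 : g t != 0 by rewrite -cm_gt0.
have x0 : 0 < re (g t) := gP.
have h1 := rd_cm gd g0.
have h2 := rdD (rd_sdist gd gP) (is_derive_cst c t (1 : R)).
apply: (cderiv_eq (rder_pol h1 h2 r0)); rewrite /shift /shift_stretch sech_sdist// addr0 /=.
have -> : cm (g t) * re (d / g t) / cm (g t) = re (d / g t) by field; rewrite gt_eqF.
congr (_ * (_ + iC * inC _)).
by field; rewrite !gt_eqF.
Qed.

Lemma shift_stretch_gt0 c w : 0 < shift_stretch c w.
Proof. by rewrite divr_gt0 ?sech_gt0. Qed.

Lemma shift_stretch_le c w : shift_stretch c w <= expR `|c|.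
Proof.
rewrite ler_pdivrMr ?sech_gt0//; set s := sdist w.
rewrite /sech mulrA ler_pdivrMr ?cosh_gt0// mulrAC ler_pdivlMr ?cosh_gt0//.
have h1 : expR s <= expR `|c| * expR (s + c).
  by rewrite -expRD ler_expR; have := ler_norm (- c); rewrite normrN; lra.
have h2 : expR (- s) <= expR `|c| * expR (- (s + c)).
  by rewrite -expRD ler_expR; have := ler_norm c; lra.
by rewrite mulrDr; lra.
Qed.

Lemma shift_stretch_ge c w : expR (- `|c|) <= shift_stretch c w.
Proof.
rewrite ler_pdivlMr ?sech_gt0//; set s := sdist w.
rewrite /sech mulrA ler_pdivrMr ?cosh_gt0// mulrAC ler_pdivlMr ?cosh_gt0//.
have e0 := expR_gt0 (- `|c|).
have h1 : expR (- `|c|) * expR (s + c) <= expR s.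
  by rewrite -expRD ler_expR; have := ler_norm c; lra.
have h2 : expR (- `|c|) * expR (- (s + c)) <= expR (- s).
  by rewrite -expRD ler_expR; have := ler_norm (- c); rewrite normrN; lra.
by lra.
Qed.
End FermiCoordinates.

(** * Hyperbolic distance to a geodesic *)

Section PlaneCurves.
Context {R : realType}.
Local Notation C := (cplx R).

Lemma cvg_fst_at (p : R * R) : x.1 @[x --> p] --> p.1.
Proof. by case: p => a b; exact: cvg_fst. Qed.
Lemma cvg_snd_at (p : R * R) : x.2 @[x --> p] --> p.2.
Proof. by case: p => a b; exact: cvg_snd. Qed.

Lemma derivable_rder (s : R -> R * R) (t : R) : derivable s t 1 ->
  rder (fun u => toC (s u)) t (toC (derive1 s t)).
Proof.
rewrite derive1E => sd.
have H : h^-1 *: (s (h *: (1 : R) + t) - s t) @[h --> (0 : R)^'] --> 'D_1 s t := sd.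
have H1 : h^-1 *: ((s (h *: (1 : R) + t)).1 - (s t).1) @[h --> (0 : R)^'] --> ('D_1 s t).1.
  have E : (fun h : R => h^-1 *: ((s (h *: (1 : R) + t)).1 - (s t).1)) =
      (fun p : R * R => p.1) \o (fun h : R => h^-1 *: (s (h *: (1 : R) + t) - s t)).
    by apply/funext.
  rewrite E; apply: cvg_comp; [exact: H|exact: cvg_fst_at].
have H2 : h^-1 *: ((s (h *: (1 : R) + t)).2 - (s t).2) @[h --> (0 : R)^'] --> ('D_1 s t).2.
  have E : (fun h : R => h^-1 *: ((s (h *: (1 : R) + t)).2 - (s t).2)) =
      (fun p : R * R => p.2) \o (fun h : R => h^-1 *: (s (h *: (1 : R) + t) - s t)).
    by apply/funext.
  rewrite E; apply: cvg_comp; [exact: H|exact: cvg_snd_at].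
have D1 : is_derive t 1 (fun u => (s u).1) ('D_1 s t).1.
  split; last exact: cvg_lim H1.
  by apply/cvg_ex; exists ('D_1 s t).1.
have D2 : is_derive t 1 (fun u => (s u).2) ('D_1 s t).2.
  split; last exact: cvg_lim H2.
  by apply/cvg_ex; exists ('D_1 s t).2.
exact: rder_mkc D1 D2.
Qed.

Lemma rder_derivable (g : R -> C) (t : R) (d : C) : rder g t d ->
  derivable (fun u => (re (g u), im (g u))) t 1 /\
  derive1 (fun u => (re (g u), im (g u))) t = (re d, im d).
Proof.
move=> gd; have [rd rE] := rder_re gd; have [id_ iE] := rder_im gd.
have H : h^-1 *: ((re (g (h *: (1 : R) + t)), im (g (h *: (1 : R) + t))) - (re (g t), im (g t)))
   @[h --> (0 : R)^'] --> (re d, im d).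
  have rd' : h^-1 *: (re (g (h *: (1 : R) + t)) - re (g t)) @[h --> (0 : R)^'] --> re d.
    by rewrite -rE; exact: rd.
  have id' : h^-1 *: (im (g (h *: (1 : R) + t)) - im (g t)) @[h --> (0 : R)^'] --> im d.
    by rewrite -iE; exact: id_.
  exact: (cvg_pair rd' id').
rewrite derive1E; split; last exact: cvg_lim H.
by apply/cvg_ex; exists (re d, im d).
Qed.
End PlaneCurves.

Section DistanceToAxis.
Context {R : realType}.
Local Notation C := (cplx R).
Variables (Om : set C) (psi psi' Phi Psi : C -> C).
Hypothesis oO : open Om.
Hypothesis cpsi : conf Om (@unit_disk R) psi psi'.
Hypothesis cPhi : conf (@rhp R) Om Phi Psi.

Let m w := psi (Phi w).
Let kap z := Psi (psi' z).

Lemma cm_toC (p : R * R) : cm (toC p) = enorm p. Proof. by []. Qed.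

Lemma conf_m : conf (@rhp R) (@unit_disk R) m kap.
Proof. exact: conf_comp cPhi cpsi. Qed.

(** The hyperbolic speed of a curve in the disk. *)
Definition speed (s : R -> R * R) (t : R) : R :=
  2 * enorm (derive1 s t) / (1 - enorm (s t) ^+ 2).

Lemma contI_speed s z w : disk_curve z w s -> contI (speed s) 0 1.
Proof.
move=> [sd sc sD _ _] t t01; have /unit_diskE := sD t t01; rewrite cm_toC => s1.
have c1 : ctsat (fun u => enorm (derive1 s u)) t.
  apply: (ctsat_comp (f := derive1 s) (g := fun p => cm (toC p))).
    by apply: Ctsat; exact: sc.
  by apply: contC_cm; apply: Ctsat; exact: toC_cont.
have c2 : ctsat (fun u => enorm (s u)) t.
  have := contC_cm (rder_cont (derivable_rder (sd t))).
  by [].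
have n0 : 1 - enorm (s t) ^+ 2 != 0.
  by rewrite gt_eqF// subr_gt0 exprn_ilt1// sqrtr_ge0.
apply: (@contC_M R); first by apply: (@contC_M R) => //; exact: contC_cst.
apply: (@contC_V R) => //; apply: (@contC_B R); first exact: contC_cst.
exact: (@contC_M R).
Qed.

Lemma hyp_lengthE s : hyp_length s = rint (speed s) 0 1.
Proof. by []. Qed.

(** The signed distance to the axis changes at most at hyperbolic unit speed. *)
Lemma hyp_length_ge s z w : Om z -> rhp w -> im w = 0 ->
  disk_curve (psi z) (psi (Phi w)) s -> `|sdist (Psi z)| <= hyp_length s.
Proof.
move=> Oz wP w0 sC; have [sd sc sD s0 s1] := sC.
have oD := @disk_open R.
have ck := conf_sym conf_m; have [kP _ kh _] := ck.
pose g t := kap (toC (s t)).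
pose d t := der kap (toC (s t)) * toC (derive1 s t).
have gd t : 0 <= t <= 1 -> rder g t (d t).
  move=> t01; apply: (rder_comp (derivable_rder (sd t))).
  exact: holo_der kh (sD t t01).
have gP t : 0 <= t <= 1 -> rhp (g t) by move=> t01; case: (kP _ (sD t t01)).
pose u' t := cm (g t) / re (g t) * im (d t / g t).
have ud (t : R) : 0 <= t <= 1 -> is_derive t 1 (fun v => sdist (g v)) (u' t).
  by move=> t01; apply: rd_sdist; [exact: gd|exact: gP].
have u'c : contI u' 0 1.
  move=> t t01; have gc := rder_cont (gd t t01).
  have x0 : re (g t) != 0 by rewrite gt_eqF//; exact: gP.
  have g0 : g t != 0 by rewrite -cm_gt0; exact: rhp_cm_gt0 (gP t t01).
  have dc : ctsat d t.
    apply: contC_M.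
      apply: (ctsat_comp (g := der kap) (rder_cont (derivable_rder (sd t)))).
      exact: holo_cont (holo_deriv oD kh) (sD t t01).
    apply: (ctsat_comp (f := derive1 s)); apply: Ctsat; first exact: sc.
    exact: toC_cont.
  apply: (@contC_M R).
    by apply: (@contC_M R); [exact: contC_cm|apply: (@contC_V R) => //; exact: contC_re].
  by apply: contC_im; apply: contC_M => //; exact: contC_V.
have vc := contI_speed sC.
have bnd t : 0 <= t <= 1 -> `|u' t| <= speed s t.
  move=> t01; have gPt := gP t t01; have x0 : 0 < re (g t) := gPt.
  have r0 := rhp_cm_gt0 gPt.
  have /unit_diskE := sD t t01; rewrite cm_toC => st1.
  have B0 : 0 < 1 - enorm (s t) ^+ 2.
    by rewrite subr_gt0 exprn_ilt1// sqrtr_ge0.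
  have q0 : 0 <= cm (g t) / re (g t) by rewrite divr_ge0// ltW.
  rewrite /u' normrM (ger0_norm q0).
  apply: (@le_trans _ _ (cm (g t) / re (g t) * cm (d t / g t))).
    by apply: ler_wpM2l => //; exact: im_le_cm.
  rewrite /d cmM cmV cmM.
  have -> : cm (g t) / re (g t) * (cm (der kap (toC (s t))) * cm (toC (derive1 s t)) / cm (g t))
    = cm (der kap (toC (s t))) * cm (toC (derive1 s t)) / re (g t).
    by field; rewrite !gt_eqF.
  have := schwarz_pick_disk_rhp ck (sD t t01); rewrite !cm_toC => sp.
  rewrite /speed ler_pdivrMr// mulrAC ler_pdivlMr// mulrAC.
  rewrite [leRHS](_ : _ = 2 * re (g t) * enorm (derive1 s t)); last by ring.
  by apply: ler_wpM2r; [exact: sqrtr_ge0|exact: sp].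
have E : rint u' 0 1 = sdist (g 1) - sdist (g 0).
  by apply: (rint_ftc (U := fun v => sdist (g v))).
have g0E : g 0 = Psi z by rewrite /g s0 /kap; have [_ ->] := let: And4 h _ _ _ := cpsi in h z Oz.
have g1E : g 1 = w.
  rewrite /g s1 /kap; have [Ow Pw] := let: And4 h _ _ _ := cPhi in h w wP.
  by have [_ ->] := let: And4 h _ _ _ := cpsi in h _ Ow.
have sw : sdist w = 0.
  have cw : cm w = re w.
    by rewrite /cm w0 expr0n /= addr0 sqrtr_sqr ger0_norm// ltW.
  by rewrite /sdist cw w0 add0r divff ?ln1// gt_eqF.
have E2 : sdist (Psi z) = - rint u' 0 1 by rewrite E g0E g1E sw sub0r opprK.
rewrite hyp_lengthE E2 normrN ler_norml.
apply/andP; split.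
  rewrite lerNl (_ : - rint u' 0 1 = rint (fun t => -1 * u' t) 0 1); last first.
    by rewrite rintZ// mulN1r.
  apply: le_rint => //.
    by move=> t t01; apply: (@contC_M R); [exact: contC_cst|exact: u'c].
  by move=> t /bnd; rewrite ler_norml mulN1r lerNl => /andP[].
by apply: le_rint => // t /bnd; rewrite ler_norml => /andP[].
Qed.

Lemma tanhr0 : tanhr 0 = 0 :> R.
Proof. by rewrite /tanhr oppr0 subrr mul0r. Qed.
Lemma sech0 : sech 0 = 1 :> R.
Proof. by rewrite /sech oppr0 expR0 divff// pnatr_eq0. Qed.

(** The orthogonal geodesic from a point to the axis has length [|sdist|]. *)
Lemma hyp_length_le z : Om z -> exists s, [/\
  disk_curve (psi z) (psi (Phi (inC (cm (Psi z))))) s &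
  hyp_length s <= `|sdist (Psi z)|].
Proof.
move=> Oz; set w := Psi z; have oP := @rhp_open R.
have wP : rhp w by case: cPhi => _ /(_ z Oz)[].
have r0 := rhp_cm_gt0 wP.
pose S := sdist w.
pose h t : R := S * (1 - t).
have hd (t : R) : is_derive t 1 h (- S).
  have H := rdM (is_derive_cst S t (1 : R)) (rdB (is_derive_cst (1 : R) t (1 : R)) (is_derive_id t (1 : R))).
  by apply: (is_derive_eq H); rewrite mul0r add0r sub0r mulrN1.
pose g t := pol (cm w) (h t).
have gP t : rhp (g t) by exact: pol_rhp.
pose d t := inC (- S) * (iC * inC (sech (h t)) * g t).
have gd t : rder g t (d t) by exact: (rder_compR (hd t) (pol_der_s (cm w) (h t))).
have [mD _ mh _] := conf_m.
pose s t : R * R := (re (m (g t)), im (m (g t))).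
have sE t : toC (s t) = m (g t) by rewrite -[RHS]mkcK.
have md t : rder (fun u => m (g u)) t (der m (g t) * d t).
  by apply: (rder_comp (gd t)); exact: holo_der mh (gP t).
have sd t := rder_derivable (md t).
have s'E : derive1 s = fun t => (re (der m (g t) * d t), im (der m (g t) * d t)).
  by apply/funext => t; case: (sd t).
have dc t : ctsat (fun t => der m (g t) * d t) t.
  apply: contC_M.
    by apply: ctsat_comp (rder_cont (gd t)) _; exact: holo_cont (holo_deriv oP mh) (gP t).
  apply: contC_M; first exact: contC_cst.
  apply: contC_M; last exact: rder_cont (gd t).
  apply: contC_M; first exact: contC_cst.
  apply: contC_inC; apply: ctsat_comp; first exact: is_derive_ctsat (hd t).
  exact: is_derive_ctsat (sech_der _).
have sC : disk_curve (psi z) (psi (Phi (inC (cm w)))) s.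
  split.
  - by move=> t; case: (sd t).
  - rewrite s'E => t; have [c1] := contC_re (dc t); have [c2] := contC_im (dc t).
    exact: (cvg_pair c1 c2).
  - by move=> t _; rewrite sE; case: (mD _ (gP t)).
  - rewrite sE /m /g /h subr0 mulr1 pol_sdist//.
    by have [_ ->] := let: And4 _ h _ _ := cPhi in h z Oz.
  - rewrite sE /m /g /h subrr mulr0 /pol sech0 tanhr0 mulr1 mulr0.
    by [].
exists s; split=> //.
have vc := contI_speed sC.
rewrite hyp_lengthE -[leRHS]mulr1 -[X in _ * X](subr0 1) -rint_cst//.
apply: le_rint => //; first exact: contI_cst.
move=> t _; have x0 : 0 < re (g t) := gP t.
have sp := schwarz_pick_rhp_disk conf_m (gP t).
rewrite /speed -!cm_toC sE s'E (_ : toC _ = der m (g t) * d t); last first.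
  by rewrite -[RHS]mkcK.
have mD1 : 0 < 1 - cm (m (g t)) ^+ 2.
  by have [/unit_diskE m1 _] := mD _ (gP t); rewrite subr_gt0 exprn_ilt1.
rewrite ler_pdivrMr// cmM.
have -> : cm (d t) = `|S| * re (g t).
  rewrite /d (cmM (inC _)) (cmM (iC * _)) (cmM iC) cm_iC !cm_inC normrN mul1r.
  rewrite (ger0_norm (ltW (sech_gt0 _))) /g cm_pol ?ltW//.
  by congr (_ * _); rewrite mulrC.
rewrite [leLHS](_ : _ = `|S| * (2 * cm (der m (g t)) * re (g t))); last by ring.
exact: ler_wpM2l.
Qed.

Lemma disk_curve_segment (z w : C) : unit_disk z -> unit_disk w ->
  exists s, disk_curve z w s.
Proof.
move=> /unit_diskE z1 /unit_diskE w1.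
pose g t := z + inC t * (w - z).
have gd t : rder g t (w - z) by exact: rder_line.
have sd t := rder_derivable (gd t).
exists (fun t => (re (g t), im (g t))).
have sE t : toC (re (g t), im (g t)) = g t by rewrite -[RHS]mkcK.
split.
- by move=> t; case: (sd t).
- have -> : derive1 (fun t => (re (g t), im (g t))) = fun=> (re (w - z), im (w - z)).
    by apply/funext => t; case: (sd t).
  by move=> t; exact: cvg_cst.
- move=> t /andP[t0 t1]; rewrite sE; apply/unit_diskE.
  have -> : g t = inC (1 - t) * z + inC t * w by rewrite /g inCB inC1; ring.
  apply: le_lt_trans (cmD _ _) _; rewrite !cmM !cm_inC !ger0_norm ?subr_ge0//.
  have [->|tn] := eqVneq t 0; first by rewrite subr0 mul1r mul0r addr0.
  have tp : 0 < t by rewrite lt_def tn.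
  have := ltr_pM2l tp (cm w) 1; rewrite w1 mulr1 => wt.
  have : (1 - t) * cm z <= (1 - t) * 1 by apply: ler_wpM2l; rewrite ?subr_ge0// ltW.
  by rewrite mulr1; lra.
- by rewrite sE /g inC0 mul0r addr0.
- by rewrite sE /g inC1 mul1r addrC subrK.
Qed.

Let axis : set C := [set w | rhp w /\ im w = 0].

(** The hyperbolic distance to the image of the axis, computed in the disk by
    way of an arbitrary conformal map [psi]. *)
Lemma dist_to_axis z : Om z ->
  inf [set hyp_dist_disk (psi z) (psi v) | v in Phi @` axis] = `|sdist (Psi z)|.
Proof.
move=> Oz; have [pD _ _ _] := cpsi; have [PO _ _ _] := cPhi.
have wP : rhp (Psi z) by case: cPhi => _ /(_ z Oz)[].
have axP : axis (inC (cm (Psi z))) by split=> //; exact: rhp_cm_gt0.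
have ge v : axis v -> `|sdist (Psi z)| <= hyp_dist_disk (psi z) (psi (Phi v)).
  move=> [vP v0]; apply: lb_le_inf.
    have [s sC] := disk_curve_segment (pD z Oz).1 (pD _ (PO v vP).1).1.
    by exists (hyp_length s), s.
  by move=> _ [s sC <-]; exact: hyp_length_ge sC.
have lbd : lbound [set hyp_dist_disk (psi z) (psi v) | v in Phi @` axis] `|sdist (Psi z)|.
  by move=> _ [_ [v vA <-] <-]; exact: ge.
apply/eqP; rewrite eq_le; apply/andP; split; last first.
  apply: lb_le_inf => //; exists (hyp_dist_disk (psi z) (psi (Phi (inC (cm (Psi z)))))).
  by exists (Phi (inC (cm (Psi z)))) => //; exists (inC (cm (Psi z))).
have [s [sC sl]] := hyp_length_le Oz.
apply: (@le_trans _ _ (hyp_dist_disk (psi z) (psi (Phi (inC (cm (Psi z))))))).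
  apply: ge_inf; first by exists `|sdist (Psi z)|.
  by exists (Phi (inC (cm (Psi z)))) => //; exists (inC (cm (Psi z))).
apply: le_trans sl; apply: ge_inf; last by exists s.
exists `|sdist (Psi z)| => _ [s' sC' <-]; apply: hyp_length_ge sC' => //.
by case: axP.
Qed.
End DistanceToAxis.

(** * Measurability and local integrability in the plane *)

Section PlaneMeasure.
Context {R : realType}.
Local Notation T2 := (measurableTypeR R * measurableTypeR R)%type.
Local Notation mu := (@lebesgue_measure R).

(** Open boxes. *)
Definition box (a b c d : R) : set (R * R) := `]a, b[ `*` `]c, d[.

Lemma nbhs_R2 (p : R * R) (U : set (R * R)) : nbhs p U ->
  exists2 e : R, 0 < e & forall q, `|q.1 - p.1| < e -> `|q.2 - p.2| < e -> U q.
Proof.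
move=> [[A B] /= [/nbhs_ballP[e1 /= e10 A1] /nbhs_ballP[e2 /= e20 B2]] AB].
exists (Num.min e1 e2); first by rewrite lt_min e10 e20.
move=> [x y] /=; rewrite !lt_min => /andP[h1 _] /andP[_ h2]; apply: AB; split => /=.
  by apply: A1; rewrite -ball_normE /= distrC.
by apply: B2; rewrite -ball_normE /= distrC.
Qed.

Lemma open_measurable2 (U : set (R * R)) : open U -> measurable (U : set T2).
Proof.
move=> oU.
pose F (q : (rat * rat) * (rat * rat)) : set T2 :=
  if `[< box (ratr q.1.1) (ratr q.1.2) (ratr q.2.1) (ratr q.2.2) `<=` U >]
  then box (ratr q.1.1) (ratr q.1.2) (ratr q.2.1) (ratr q.2.2) else set0.
have -> : U = \bigcup_q F q.
  apply/seteqP; split=> [p Up|p [q _]]; last first.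
    by rewrite /F; case: asboolP => // qU; exact: qU.
  have [e e0 eU] := nbhs_R2 (open_nbhs_nbhs (conj oU Up)).
  have lt1 (x : R) : x - e < x by rewrite ltrBlDr ltrDl.
  have lt2 (x : R) : x < x + e by rewrite ltrDl.
  have [a ha] := rat_in_itvoo (lt1 p.1); have [b hb] := rat_in_itvoo (lt2 p.1).
  have [c hc] := rat_in_itvoo (lt1 p.2); have [d hd] := rat_in_itvoo (lt2 p.2).
  rewrite !in_itv /= in ha hb hc hd.
  case/andP: ha => a1 a2; case/andP: hb => b1 b2.
  case/andP: hc => c1 c2; case/andP: hd => d1 d2.
  exists ((a, b), (c, d)) => //; rewrite /F /=; case: asboolP => [_|[]].
    by split; rewrite /= in_itv /=; apply/andP.
  move=> q [/=]; rewrite !in_itv /= => /andP[? ?] /andP[? ?].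
  by apply: eU; rewrite ltr_norml; apply/andP; split; lra.
apply: countable_bigcupT_measurable; first exact: countableP.
move=> q; rewrite /F; case: ifP => _; last exact: measurable0.
by apply: measurableX; exact: measurable_itv.
Qed.

Lemma cont_measurable_fun (U : set (R * R)) (g : R * R -> R) : open U ->
  (forall p, U p -> ctsat g p) -> measurable_fun (U : set T2) (g : T2 -> R).
Proof.
move=> oU gc; apply: (measurability _ (@measurable_realfun.RGenOpens.measurableE R)).
move=> _ [_ [a [b ->] <-]]; apply: open_measurable2.
rewrite openE => p [Up gp].
have nU : nbhs p U by exact: open_nbhs_nbhs.
have ng : nbhs p (g @^-1` `]a, b[).
  by have [gcp] := gc p Up; apply: gcp; apply: open_nbhs_nbhs; split=> //.
by apply: filterS2 nU ng => q ? ?; split.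
Qed.

Lemma compact_measurable2 (A : set (R * R)) : compact A -> measurable (A : set T2).
Proof.
move=> cA; rewrite -[A]setCK; apply: measurableC; apply: open_measurable2.
apply: closed_openC; apply: compact_closed => //.
Qed.

Lemma compact_ubound (A : set (R * R)) (h : R * R -> R) : compact A ->
  (forall p, A p -> ctsat h p) -> exists2 M, 0 < M & forall p, A p -> h p < M.
Proof.
move=> cA hc; have [->|/set0P A0] := eqVneq A set0; first by exists 1.
have [|c _ cM] := @compact_EVT_max _ _ h A A0 cA.
  by apply: continuous_in_subspaceT => p; rewrite inE => /hc[].
exists (`|h c| + 1); first by rewrite ltr_wpDl.
move=> p Ap; have := cM p; rewrite inE => /(_ Ap) hp.
by rewrite (le_lt_trans hp)// (le_lt_trans (ler_norm _))// ltrDl.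
Qed.

Lemma compact_in_box (A : set (R * R)) : compact A ->
  exists2 M, 0 < M & A `<=` `[-M, M] `*` `[-M, M].
Proof.
move=> cA; have [|M M0 HM] := @compact_ubound A (fun p => cm (toC p)) cA.
- by move=> p _; apply: contC_cm; apply: Ctsat; exact: toC_cont.
- exists M => // p /HM pM; split; rewrite /= in_itv /= -ler_norml.
    exact: le_trans (re_le_cm (toC p)) (ltW pM).
  exact: le_trans (im_le_cm (toC p)) (ltW pM).
Qed.

(** The closed box of half-side [M] about the origin. *)
Definition cbox (M : R) : set (R * R) := `[-M, M] `*` `[-M, M].

Lemma area_box (M : R) : 0 < M -> (@area R (cbox M) < +oo)%E.
Proof.
move=> M0; have -> : @area R (cbox M) =
    (@lebesgue_measure R `[(- M)%R, M]%classic * @lebesgue_measure R `[(- M)%R, M]%classic)%E.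
  by apply: product_measure1E; exact: measurable_itv.
rewrite lebesgue_measure_itv /= lte_fin.
by rewrite ifT ?ltry//; lra.
Qed.

Lemma area_compact (A : set (R * R)) : compact A -> (@area R A < +oo)%E.
Proof.
move=> cA; have [M M0 AM] := compact_in_box cA.
apply: le_lt_trans (area_box M0); apply: le_measure => //; rewrite inE.
  exact: compact_measurable2.
by apply: measurableX; exact: measurable_itv.
Qed.

Lemma ctsat_R2_M (f g : R * R -> R) p : ctsat f p -> ctsat g p ->
  ctsat (fun q => f q * g q) p.
Proof. exact: (@contC_M R). Qed.

Lemma L2_loc_cont (U : set (R * R)) (g : R * R -> R) : open U ->
  (forall p, U p -> ctsat g p) -> L2_loc U g.
Proof.
move=> oU gc; split; first exact: cont_measurable_fun.
move=> A cA AU; have mA := compact_measurable2 cA.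
have g2c p : A p -> ctsat (fun q => g q ^+ 2) p.
  by move=> /AU/gc gp; exact: ctsat_R2_M.
have [M M0 HM] := compact_ubound cA g2c.
apply: (@le_lt_trans _ _ (\int[@area R]_(p in A) M%:E)%E).
  apply: ge0_le_integral => //.
  - by move=> p _; rewrite lee_fin sqr_ge0.
  - apply/measurable_EFinP; apply: (@measurable_funS _ _ _ _ U) => //.
      exact: open_measurable2.
    apply: cont_measurable_fun => // p /gc gp; exact: ctsat_R2_M.
  - by move=> p /HM; rewrite lee_fin => /ltW.
rewrite integral_cst//; apply: lte_mul_pinfty => //.
- by rewrite lee_fin ltW.
- exact: area_compact.
Qed.
End PlaneMeasure.

(** * Weak derivatives of continuously differentiable functions *)

Section IntegrationByParts.
Context {R : realType}.
Local Notation T2 := (measurableTypeR R * measurableTypeR R)%type.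
Local Notation mu := (@lebesgue_measure R).

Lemma cbox_compact (M : R) : compact (cbox M).
Proof. by apply: compact_setX; exact: segment_compact. Qed.

Lemma integrable_compact_support (f : R * R -> R) (M : R) : 0 < M ->
  (forall p, ctsat f p) -> (forall p, ~ cbox M p -> f p = 0) ->
  (@area R).-integrable setT (EFin \o f : T2 -> \bar R).
Proof.
move=> M0 fc f0.
have mB : measurable (cbox M : set T2) by apply: (compact_measurable2 (A := cbox M)); exact: cbox_compact.
have -> : EFin \o f = (EFin \o f) \_ (cbox M).
  apply/funext => p; rewrite patchE; case: ifPn => // /negP; rewrite inE => /f0 /=.
  by move=> ->.
apply/(integrable_mkcond _ mB).
apply: measurable_bounded_integrable => //.
- exact: area_box.
- apply: (@measurable_funS _ _ _ _ setT) => //.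
  by apply: cont_measurable_fun => //; exact: openT.
- have afc p : cbox M p -> ctsat (fun q => `|f q|) p.
    move=> _; apply: (ctsat_comp (g := fun x : R => `|x|) (fc p)); apply: Ctsat.
    exact: norm_continuous.
  have [N N0 HN] := compact_ubound (@cbox_compact M) afc.
  exists N; split; first exact: num_real.
  by move=> x Nx p /HN /ltW h; exact: le_trans h (ltW Nx).
Qed.

Lemma integral_line_derivative0 (w w' : R -> R) (M : R) : 0 < M ->
  (forall x, ctsat w' x) -> (forall x : R, is_derive x 1 w (w' x)) ->
  (forall x, M < `|x| -> w x = 0 /\ w' x = 0) ->
  (\int[mu]_x (w' x)%:E = 0)%E.
Proof.
move=> M0 wc wd w0.
pose N := M + 1.
have -> : (fun x => (w' x)%:E) = (EFin \o w') \_ `[- N, N].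
  apply/funext => x; rewrite patchE; case: ifPn => // /negP.
  rewrite inE /= in_itv /= -ler_norml => /negP; rewrite -ltNge => Nx.
  by have [|_ ->] := w0 x _; first by apply: lt_trans Nx; rewrite ltrDl.
rewrite -integral_mkcond.
have NN : - N <= N by rewrite /N; lra.
have wI : contI w' (- N) N by move=> x _; exact: wc.
have := rint_ftc NN wI (fun x _ => wd x).
have NM : M < `|N| by rewrite gtr0_norm /N; lra.
have [-> _] := w0 N NM; have [|-> _] := w0 (- N); first by rewrite normrN.
rewrite subrr /rint /Rintegral => h.
rewrite -[LHS]fineK; first by rewrite h.
by apply: integrable_fin_num; [exact: measurable_itv|exact: rint_integrable].
Qed.

Lemma is_derive_shift0 (f : R -> R) (x a : R) :
  is_derive (0 : R) 1 (fun h => f (x + h)) a -> is_derive x 1 f a.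
Proof.
move=> H.
have h2 := rdB (is_derive_id x (1 : R)) (is_derive_cst x x (1 : R)).
have h0 : is_derive ((fun s : R => s - x) x) 1 (fun h => f (x + h)) a.
  by rewrite subrr.
have := rd_comp (g := fun s : R => s - x) h2 h0.
rewrite subr0 mulr1; apply: rd_near.
by apply: (@filterE _ (nbhs x)) => s; rewrite addrC subrK.
Qed.

Lemma line_pair (x y h a b : R) : (x, y) + h *: (a, b) = (x + h * a, y + h * b).
Proof. by []. Qed.

Lemma ctsat_pair (f g : R -> R) (x : R) : ctsat f x -> ctsat g x ->
  ctsat (fun s => (f s, g s)) x.
Proof. by move=> [fc] [gc]; apply: Ctsat; exact: (cvg_pair fc gc). Qed.

(** A compactly supported coordinate derivative has integral zero. *)
Lemma integral_dir_derivative0 (j : 'I_2) (w w' : R * R -> R) (M : R) : 0 < M ->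
  (forall p, ctsat w' p) ->
  (forall p, is_derive (0 : R) 1 (fun h => w (p + h *: dir R j)) (w' p)) ->
  (forall p, ~ cbox M p -> w p = 0 /\ w' p = 0) ->
  (\int[@area R]_p (w' p)%:E = 0)%E.
Proof.
move=> M0 wc wd w0.
have iw : (@area R).-integrable setT (EFin \o w' : T2 -> \bar R).
  by apply: (integrable_compact_support M0) => // p /w0[].
have wcx y x : ctsat (fun s => w' (s, y)) x.
  apply: (ctsat_comp (f := fun s : R => (s, y))); last exact: wc.
  exact: ctsat_pair (ctsat_idR _) (ctsat_cstR _ _).
have wcy y x : ctsat (fun s => w' (x, s)) y.
  apply: (ctsat_comp (f := fun s : R => (x, s))); last exact: wc.
  exact: ctsat_pair (ctsat_cstR _ _) (ctsat_idR _).
have out1 x y : M < `|x| -> ~ cbox M (x, y).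
  by move=> Mx [/=]; rewrite in_itv /= -ler_norml leNgt Mx.
have out2 x y : M < `|y| -> ~ cbox M (x, y).
  by move=> Mx [/= _]; rewrite in_itv /= -ler_norml leNgt Mx.
have [j0|j1] := eqVneq j 0.
- rewrite -(integral21_prod_meas1 iw); apply: integral0_eq => y _.
  apply: (@integral_line_derivative0 (fun x => w (x, y)) (fun x => w' (x, y)) M) => //.
  + move=> x; apply: is_derive_shift0; have := wd (x, y); rewrite j0 /dir eqxx.
    congr (is_derive _ _ _ _); apply/funext => h; congr w.
    by rewrite line_pair mulr1 mulr0 addr0.
  + by move=> x /(out1 _ y)/w0.
- rewrite -(integral12_prod_meas1 iw); apply: integral0_eq => x _.
  apply: (@integral_line_derivative0 (fun y => w (x, y)) (fun y => w' (x, y)) M) => //.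
  + move=> y; apply: is_derive_shift0; have := wd (x, y); rewrite /dir (negbTE j1).
    congr (is_derive _ _ _ _); apply/funext => h; congr w.
    by rewrite line_pair mulr1 mulr0 addr0.
  + by move=> y /(out2 x)/w0.
Qed.

Lemma differentiable_ctsat (f : R * R -> R) p : differentiable f p -> ctsat f p.
Proof. by move=> fd; apply: Ctsat; exact: differentiable_continuous. Qed.

Lemma is_derive_dir (f : R * R -> R) (p v : R * R) : differentiable f p ->
  is_derive (0 : R) 1 (fun h => f (p + h *: v)) ('D_v f p).
Proof.
move=> fd; have dv := diff_derivable (v := v) fd.
have H : h^-1 *: (f (h *: v + p) - f p) @[h --> (0 : R)^'] --> 'D_v f p by exact: dv.
have E : (fun h : R => h^-1 *: (f (p + (h *: (1 : R) + 0) *: v) - f (p + 0 *: v))) =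
   (fun h : R => h^-1 *: (f (h *: v + p) - f p)).
  apply/funext => h; rewrite addr0 scale0r addr0 [h *: (1 : R)]mulr1.
  by rewrite [p + _]addrC.
split; last by rewrite /derive E.
by apply/cvg_ex; exists ('D_v f p); rewrite E.
Qed.

(** A continuous partial derivative is a weak derivative: the product of [u] with
    a test function, extended by zero, has compact support. *)
Lemma weak_derive_C1 (j : 'I_2) (U : set (R * R)) (u g : R * R -> R) : open U ->
  (forall p, U p -> ctsat u p) -> (forall p, U p -> ctsat g p) ->
  (forall p, U p -> is_derive (0 : R) 1 (fun h => u (p + h *: dir R j)) (g p)) ->
  weak_derive U (dir R j) u g.
Proof.
move=> oU uc gc ud phi [sm cK KU]; set K := closure _ in cK KU.
set v := dir R j.
have pd p : differentiable phi p := sm [::] p.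
have Dd p : differentiable ('D_v phi) p := sm [:: v] p.
have notK p : ~ K p -> \forall q \near p, phi q = 0.
  move=> nK; have : \forall q \near p, ~ K q.
    by apply: open_nbhs_nbhs; split=> //; exact/closed_openC/closed_closure.
  apply: filterS => q nKq; apply/eqP/negPn/negP => q0; apply: nKq.
  exact: subset_closure.
have pc p : ctsat phi p by exact: differentiable_ctsat.
have Dc p : ctsat ('D_v phi) p by exact: differentiable_ctsat.
have D0 p : ~ K p -> 'D_v phi p = 0.
  move=> /notK n0; have [_ <-] := is_derive_dir v (pd p).
  have n1 : \forall h \near (0 : R), phi (p + h *: v) = 0.
    have hc : ctsat (fun h : R => p + h *: v) 0.
      apply: Ctsat; apply: cvgD; first exact: cvg_cst.
      by apply: cvgZl; exact: cvg_id.
    case: hc; rewrite scale0r addr0 => hc; exact: (hc [set q | phi q = 0]).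
  have h0 : is_derive (0 : R) 1 (fun h => phi (p + h *: v)) 0.
    apply: (@rd_near _ (fun=> 0)).
    by apply: filterS n1 => h ->.
  by case: h0.
(* [K] is inside [U], so every point is in [U] or has a neighbourhood on which
   the test function vanishes. *)
have case_p p : U p \/ ~ K p by have [/KU|] := pselect (K p); [left|right].
pose w1 p := u p * 'D_v phi p; pose w2 p := g p * phi p.
have near0 (f : R * R -> R) p : ~ K p -> (forall q, ~ K q -> f q = 0) -> ctsat f p.
  move=> nK f0; apply: (@ctsat_near _ _ (fun=> 0)); last exact: contC_cst.
  have : \forall q \near p, ~ K q.
    by apply: open_nbhs_nbhs; split=> //; exact/closed_openC/closed_closure.
  by apply: filterS => q /f0.
have w10 p : ~ K p -> w1 p = 0 by move=> /D0 h; rewrite /w1 h mulr0.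
have w20 p : ~ K p -> w2 p = 0.
  by move=> /notK/nbhs_singleton h; rewrite /w2 h mulr0.
have w1c p : ctsat w1 p.
  have [Up|nK] := case_p p; last exact: near0.
  by apply: ctsat_R2_M => //; exact: uc.
have w2c p : ctsat w2 p.
  have [Up|nK] := case_p p; last exact: near0.
  by apply: ctsat_R2_M => //; exact: gc.
have [M M0 KM] := compact_in_box cK.
have nKM p : ~ cbox M p -> ~ K p by move=> nM /KM.
have i1 : (@area R).-integrable setT (EFin \o w1 : T2 -> \bar R).
  by apply: (integrable_compact_support M0) => // p /nKM/w10.
have i2 : (@area R).-integrable setT (EFin \o w2 : T2 -> \bar R).
  by apply: (integrable_compact_support M0) => // p /nKM/w20.
have sum0 : (\int[@area R]_p (w1 p + w2 p)%:E = 0)%E.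
  apply: (@integral_dir_derivative0 j (fun p => u p * phi p) _ M) => //.
  - by move=> p; apply: (@contC_D R).
  - move=> p; rewrite -/v; have [Up|nK] := case_p p.
      have h := rdM (ud p Up) (is_derive_dir v (pd p)).
      by apply: (is_derive_eq h); rewrite scale0r addr0 addrC.
    rewrite w10// w20// addr0; apply: (@rd_near _ (fun=> 0)).
    have hc : ctsat (fun h : R => p + h *: v) 0.
      apply: Ctsat; apply: cvgD; first exact: cvg_cst.
      by apply: cvgZl; exact: cvg_id.
    have n1 : \forall h \near (0 : R), phi (p + h *: v) = 0.
      case: hc; rewrite scale0r addr0 => hc; apply: (hc [set q | phi q = 0]).
      exact: notK.
    by apply: filterS n1 => h ->; rewrite mulr0.
  - move=> p /nKM nK; rewrite w10// w20// addr0.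
    by rewrite (nbhs_singleton (notK p nK)) mulr0.
have restr (f : R * R -> R) : (forall q, ~ K q -> f q = 0) ->
    (\int[@area R]_(p in U) (f p)%:E = \int[@area R]_p (f p)%:E)%E.
  move=> f0; rewrite integral_mkcond; apply: eq_integral => p _; rewrite patchE.
  by case: ifPn => // /negP; rewrite inE => nU; rewrite f0// => /KU.
rewrite (restr w1 w10) (restr w2 w20).
have f1 := integrable_fin_num measurableT i1.
have f2 := integrable_fin_num measurableT i2.
have sumE : (\int[@area R]_p (w1 p)%:E + \int[@area R]_p (w2 p)%:E = 0)%E.
  by rewrite -sum0 -(integralD measurableT i1 i2); apply: eq_integral.
move: sumE; rewrite -(fineK f1) -(fineK f2) -EFinD -EFinN => -[] /eqP.
by rewrite addr_eq0 => /eqP ->.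
Qed.
End IntegrationByParts.

(** * The shift transported to the domain *)

Section ShiftedMap.
Context {R : realType}.
Local Notation C := (cplx R).
Variables (Om : set C) (Phi Psi : C -> C).
Hypothesis oO : open Om.
Hypothesis cPhi : conf (@rhp R) Om Phi Psi.

Let oP := @rhp_open R.

(** The shift by [e] conjugated by [Phi]. *)
Definition push (e : R) (z : C) : C := Phi (shift e (Psi z)).

Lemma Psi_rhp z : Om z -> rhp (Psi z).
Proof. by case: cPhi => _ H _ _ /H[]. Qed.
Lemma PsiK z : Om z -> Phi (Psi z) = z.
Proof. by case: cPhi => _ H _ _ /H[]. Qed.
Lemma Phi_Om w : rhp w -> Om (Phi w).
Proof. by case: cPhi => H _ _ _ /H[]. Qed.
Lemma PhiK w : rhp w -> Psi (Phi w) = w.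
Proof. by case: cPhi => H _ _ _ /H[]. Qed.
Lemma Phi_holo : holo (@rhp R) Phi. Proof. by case: cPhi. Qed.
Lemma Psi_holo : holo Om Psi. Proof. by case: cPhi. Qed.

Lemma push_Om e z : Om z -> Om (push e z).
Proof. by move=> Oz; apply: Phi_Om; apply: shift_rhp; exact: Psi_rhp. Qed.

Lemma pushK e z : Om z -> push (- e) (push e z) = z.
Proof.
move=> Oz; have wP := Psi_rhp Oz.
by rewrite /push PhiK ?shiftK ?PsiK//; exact: shift_rhp.
Qed.

Lemma ctsat_idC (w : C) : ctsat (fun v : C => v) w.
Proof. by apply: Ctsat; exact: cvg_id. Qed.

Lemma ctsat_sdist (w : C) : rhp w -> ctsat (@sdist R) w.
Proof.
move=> wP; have x0 : 0 < re w := wP; have s0 := rhp_im_cm wP.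
have c1 : ctsat (fun v : C => (im v + cm v) / re v) w.
  apply: (@contC_M R).
    by apply: (@contC_D R); [apply: contC_im|apply: contC_cm]; exact: ctsat_idC.
  by apply: (@contC_V R); [rewrite gt_eqF|apply: contC_re; exact: ctsat_idC].
apply: (ctsat_comp (g := @ln R) c1); apply: Ctsat; apply: continuous_ln.
by rewrite divr_gt0.
Qed.

Lemma ctsat_shift e (w : C) : rhp w -> ctsat (shift e) w.
Proof.
move=> wP; have sc : ctsat (fun v => sdist v + e) w.
  by apply: (@contC_D R); [exact: ctsat_sdist|exact: contC_cst].
have cc : ctsat (@cm R) w by apply: contC_cm; exact: ctsat_idC.
apply: contC_mkc; apply: (@contC_M R) => //.
  by apply: (ctsat_comp (g := @sech R) sc); exact: is_derive_ctsat (sech_der _).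
by apply: (ctsat_comp (g := @tanhr R) sc); exact: is_derive_ctsat (tanhr_der _).
Qed.

Lemma ctsat_push e z : Om z -> ctsat (push e) z.
Proof.
move=> Oz; have wP := Psi_rhp Oz.
have c1 : ctsat (fun v => shift e (Psi v)) z.
  by apply: ctsat_comp (holo_cont Psi_holo Oz) _; exact: ctsat_shift.
by apply: (ctsat_comp (g := Phi) c1); exact: holo_cont Phi_holo (shift_rhp e wP).
Qed.

(** The axis is carried to a level set of the signed distance. *)
Lemma push_axis e : push e @` (Phi @` [set w | rhp w /\ im w = 0]) =
  Phi @` [set w | rhp w /\ sdist w = e].
Proof.
apply/seteqP; split=> [_ [_ [v [vP v0] <-] <-]|_ [w [wP we] <-]].
  rewrite /push PhiK//; exists (shift e v) => //; split; first exact: shift_rhp.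
  rewrite sdist_shift// /sdist v0 add0r.
  have -> : cm v = re v by rewrite /cm v0 expr0n /= addr0 sqrtr_sqr ger0_norm// ltW.
  by rewrite divff ?ln1 ?add0r// gt_eqF.
have vP : rhp (shift (- e) w) by exact: shift_rhp.
exists (Phi (shift (- e) w)).
  exists (shift (- e) w) => //; split=> //.
  have : tanhr (sdist (shift (- e) w)) = 0 by rewrite sdist_shift// we subrr tanhr0.
  rewrite tanhr_sdist// => /eqP; rewrite mulf_eq0 invr_eq0 => /orP[/eqP//|].
  by rewrite gt_eqF// rhp_cm_gt0.
rewrite /push PhiK//; congr Phi.
by have := shiftK (- e) wP; rewrite opprK.
Qed.

(** On a connected set of points at distance [c] the signed distance is constant. *)
Lemma level_component c z0 : Om z0 -> `|sdist (Psi z0)| = c ->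
  connected_component [set z | Om z /\ `|sdist (Psi z)| = c] z0 =
  Phi @` [set w | rhp w /\ sdist w = sdist (Psi z0)].
Proof.
move=> Oz0 sc; set e := sdist (Psi z0).
have w0P := Psi_rhp Oz0.
apply/seteqP; split=> [z [B [Bz0 BL cB] Bz]|z Tz]; last first.
  exists (Phi @` [set w | rhp w /\ sdist w = e]) => //; split.
  - by exists (Psi z0); [split|exact: PsiK].
  - move=> _ [w [wP we] <-]; split; first exact: Phi_Om.
    by rewrite PhiK// we.
  - have -> : Phi @` [set w | rhp w /\ sdist w = e] =
        (fun r : R => Phi (pol (expR r) e)) @` setT.
      apply/seteqP; split=> [_ [w [wP we] <-]|_ [r _ <-]].
        exists (ln (cm w)) => //; rewrite lnK ?posrE ?rhp_cm_gt0//.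
        by rewrite -we pol_sdist.
      exists (pol (expR r) e) => //; split; first by apply: pol_rhp; exact: expR_gt0.
      by rewrite sdist_pol ?expR_gt0.
    apply: connected_continuous_connected; first exact/connected_intervalP.
    apply: continuous_subspaceT => r.
    have c1 : ctsat (fun r : R => pol (expR r) e) r.
      by apply: contC_mkc; apply: (@contC_M R); [exact: is_derive_ctsat (expR_is_derive r)|exact: contC_cst|exact: is_derive_ctsat (expR_is_derive r)|exact: contC_cst].
    have : ctsat (fun r : R => Phi (pol (expR r) e)) r.
      apply: (ctsat_comp (g := Phi) c1); apply: holo_cont Phi_holo _.
      by apply: pol_rhp; exact: expR_gt0.
    by case.
have [Oz zc] := BL z Bz.
exists (Psi z); last exact: PsiK.
split; first exact: Psi_rhp.
pose h v := sdist (Psi v).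
have hc : {within B, continuous h}.
  apply: continuous_in_subspaceT => v; rewrite inE => /BL[Ov _].
  have : ctsat h v.
    by apply: (ctsat_comp (g := @sdist R) (holo_cont Psi_holo Ov)); apply: ctsat_sdist; exact: Psi_rhp.
  by case.
have cI : is_interval (h @` B).
  by apply/connected_intervalP; exact: connected_continuous_connected.
apply/eqP/negPn/negP => ne.
(* Otherwise the two values are opposite and the value 0 is taken on [B]. *)
have hz : h z = - e.
  have : `|h z| == `|e| by rewrite /h zc /e sc.
  by rewrite eqr_norm2 (negbTE ne) => /eqP.
have [b Bb hb] : (h @` B) 0.
  have [e0|e0] := leP 0 e.
    apply: (cI (h z) e); [by exists z|by exists z0|].
    by rewrite hz oppr_le0 e0.
  apply: (cI e (h z)); [by exists z0|by exists z|].
  by rewrite hz oppr_ge0 !ltW.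
have [_ bc] := BL b Bb.
have c0 : c = 0 by rewrite -bc -/(h b) hb normr0.
move: ne; rewrite -/(h z) hz -/e.
have -> : e = 0 by apply/eqP; rewrite -normr_eq0 /e sc c0.
by rewrite oppr0 eqxx.
Qed.
End ShiftedMap.

(** * Quasiconformality and boundary values *)

Section MatrixBound.
Context {R : realType}.

Lemma opnorm_sqr_le (A : 'M[R]_2) (k : R) :
  (forall x y, (A 0 0 * x + A 0 1 * y) ^+ 2 + (A 1 0 * x + A 1 1 * y) ^+ 2 <=
     k * (x ^+ 2 + y ^+ 2)) ->
  opnorm A ^+ 2 <= k.
Proof.
move=> H; have k0 : 0 <= k.
  have := H 1 0; rewrite (_ : k * _ = k); last by ring.
  by apply: le_trans; rewrite addr_ge0 ?sqr_ge0.
have sq (v : 'cV[R]_2) : \sum_i v i 0 ^+ 2 = v 0 0 ^+ 2 + v 1 0 ^+ 2.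
  by rewrite big_ord_recl big_ord1 (_ : lift _ _ = 1)//; apply/val_inj.
have bound v : l2norm v <= 1 -> l2norm (A *m v) <= Num.sqrt k.
  move=> v1; rewrite /l2norm ler_sqrt// sq.
  have mE i : (A *m v) i 0 = A i 0 * v 0 0 + A i 1 * v 1 0.
    by rewrite mxE big_ord_recl big_ord1 (_ : lift _ _ = 1)//; apply/val_inj.
  rewrite !mE; apply: le_trans (H _ _) _.
  rewrite -[leRHS]mulr1; apply: ler_wpM2l => //.
  by rewrite -(@ler_sqrt _ _ 1)// sqrtr1 -sq.
have ub : ubound [set l2norm (A *m v) | v in [set v : 'cV[R]_2 | l2norm v <= 1]] (Num.sqrt k).
  by move=> _ [v v1 <-]; exact: bound.
have z1 : l2norm (0 : 'cV[R]_2) = 0.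
  by rewrite /l2norm big1 ?sqrtr0// => i _; rewrite mxE expr0n.
have mem0 : [set l2norm (A *m v) | v in [set v : 'cV[R]_2 | l2norm v <= 1]] 0.
  by exists 0; [rewrite /= z1 ler01|rewrite mulmx0 z1].
have op0 : 0 <= opnorm A by apply: ub_le_sup mem0; exists (Num.sqrt k).
have op1 : opnorm A <= Num.sqrt k by apply: ge_sup => //; exists 0.
by rewrite -(sqr_sqrtr k0) lerXn2r// nnegrE// sqrtr_ge0.
Qed.

Lemma det2 (A : 'M[R]_2) : \det A = A 0 0 * A 1 1 - A 0 1 * A 1 0.
Proof.
have l0 : lift (0 : 'I_2) (0 : 'I_1) = 1 by exact/val_inj.
have l1 : lift (1 : 'I_2) (0 : 'I_1) = 0 by exact/val_inj.
rewrite (expand_det_row _ 0) big_ord_recl big_ord1 l0 /cofactor !det_mx11 !mxE l0 l1.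
by rewrite /= expr0 expr1 mul1r mulN1r mulrN.
Qed.
End MatrixBound.

Section PushQuasiconformal.
Context {R : realType}.
Local Notation C := (cplx R).
Variables (Om : set C) (Phi Psi : C -> C).
Hypothesis oO : open Om.
Hypothesis cPhi : conf (@rhp R) Om Phi Psi.

Let oP := @rhp_open R.
Let f e := push Phi Psi e.

(** The differential of [push] at [z] is [h |-> B (Re (b h) + i l Im (b h))]
    with [B] the outer factor, [b] the inner factor and [l] the stretch. *)
Definition outer_factor (e : R) (z : C) : C :=
  der Phi (shift e (Psi z)) * shift e (Psi z).
Definition inner_factor (z : C) : C := der Psi z / Psi z.
Definition push_diff (e : R) (z h : C) : C :=
  outer_factor e z * (inC (re (inner_factor z * h)) +
    iC * inC (shift_stretch e (Psi z) * im (inner_factor z * h))).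

(** The coordinate directions as complex numbers. *)
Definition dirC (j : 'I_2) : C := toC (dir R j).

Lemma rder_push e (g : R -> C) (t : R) (d : C) : rder g t d -> Om (g t) ->
  rder (fun s => f e (g s)) t (push_diff e (g t) d).
Proof.
move=> gd Og; have wP := Psi_rhp cPhi Og.
have h1 := rder_comp gd (holo_der (Psi_holo cPhi) Og).
have h2 := rder_shift e h1 wP.
have h3 := rder_comp h2 (holo_der (Phi_holo cPhi) (shift_rhp e wP)).
apply: (cderiv_eq h3); rewrite /push_diff /outer_factor /inner_factor.
have -> : der Psi (g t) * d / Psi (g t) = der Psi (g t) / Psi (g t) * d by rewrite mulrAC.
exact: mulrA.
Qed.

Lemma ctsat_push_diff e z h : Om z -> ctsat (fun v => push_diff e v h) z.
Proof.
move=> Oz; have wP := Psi_rhp cPhi Oz.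
have Pc := holo_cont (Psi_holo cPhi) Oz.
have Sc : ctsat (fun v => shift e (Psi v)) z.
  by apply: (ctsat_comp (g := shift e) Pc); exact: ctsat_shift.
have w0 : Psi z != 0 by rewrite -cm_gt0 rhp_cm_gt0.
have bc : ctsat (fun v => inner_factor v * h) z.
  apply: contC_M; last exact: contC_cst.
  apply: contC_M; first exact: holo_cont (holo_deriv oO (Psi_holo cPhi)) Oz.
  exact: contC_V.
have lc : ctsat (fun v => shift_stretch e (Psi v)) z.
  have sc : ctsat (fun v => sdist (Psi v)) z.
    by apply: (ctsat_comp (g := @sdist R) Pc); exact: ctsat_sdist.
  apply: (@contC_M R).
    apply: (ctsat_comp (g := @sech R)); last exact: is_derive_ctsat (sech_der _).
    by apply: (@contC_D R) => //; exact: contC_cst.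
  apply: (@contC_V R); first by rewrite gt_eqF// sech_gt0.
  by apply: (ctsat_comp (g := @sech R) sc); exact: is_derive_ctsat (sech_der _).
apply: contC_M.
  apply: contC_M => //.
  apply: (ctsat_comp (g := der Phi) Sc).
  exact: holo_cont (holo_deriv oP (Phi_holo cPhi)) (shift_rhp e wP).
apply: contC_D; first by apply: contC_inC; exact: contC_re.
apply: contC_M; first exact: contC_cst.
by apply: contC_inC; apply: (@contC_M R) => //; exact: contC_im.
Qed.

(** The Jacobian matrix of [push]. *)
Definition push_jacobian e (p : R * R) : 'M[R]_2 :=
  \matrix_(i, j) Defs.coord i (push_diff e (toC p) (dirC j)).

Lemma ctsat_coord (T : topologicalType) (i : 'I_2) (g : T -> C) (t : T) :
  ctsat g t -> ctsat (fun s => Defs.coord i (g s)) t.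
Proof.
by move=> gc; rewrite /Defs.coord; case: eqP => _; [exact: contC_re|exact: contC_im].
Qed.

Lemma is_derive_coord (i : 'I_2) (g : R -> C) (t : R) (d : C) : rder g t d ->
  is_derive t 1 (fun s => Defs.coord i (g s)) (Defs.coord i d).
Proof.
by move=> gd; rewrite /Defs.coord; case: eqP => _; [exact: rder_re|exact: rder_im].
Qed.

Lemma open_toC_preimage : open (@toC R @^-1` Om).
Proof. by apply: open_comp => // p _; exact: toC_cont. Qed.

Lemma ctsat_toC (p : R * R) : ctsat (@toC R) p.
Proof. by apply: Ctsat; exact: toC_cont. Qed.

Lemma toC_line (p : R * R) (h : R) (j : 'I_2) :
  toC (p + h *: dir R j) = toC p + inC h * dirC j.
Proof.
by case: p => x y; apply: cplx_eqP; rewrite !reimE /dirC /dir; case: eqP => _ /=;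
  rewrite /GRing.scale /=; ring.
Qed.

Lemma W12_push e : W12_loc Om (f e) (push_jacobian e).
Proof.
have oU := open_toC_preimage.
have uc i p : Om (toC p) -> ctsat (fun q => Defs.coord i (f e (toC q))) p.
  move=> Op; apply: ctsat_coord; apply: (ctsat_comp (g := f e) (ctsat_toC p)).
  exact: (ctsat_push cPhi).
have gE i j p : push_jacobian e p i j = Defs.coord i (push_diff e (toC p) (dirC j)).
  by rewrite mxE.
have gc i j p : Om (toC p) -> ctsat (fun q => push_jacobian e q i j) p.
  move=> Op; have -> : (fun q => push_jacobian e q i j) =
     (fun q => Defs.coord i (push_diff e (toC q) (dirC j))) by apply/funext => q; rewrite gE.
  apply: ctsat_coord; apply: (ctsat_comp (g := fun z => push_diff e z (dirC j)) (ctsat_toC p)).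
  exact: ctsat_push_diff.
move=> i j; split.
- by apply: L2_loc_cont => // p; exact: uc.
- by apply: L2_loc_cont => // p; exact: gc.
- apply: weak_derive_C1 => //; [exact: uc|exact: gc|move=> p Op].
  have -> : (fun h : R => Defs.coord i (f e (toC (p + h *: dir R j)))) =
      (fun h => Defs.coord i (f e (toC p + inC h * dirC j))).
    by apply/funext => h; rewrite toC_line.
  have ld := rder_line (toC p) (dirC j) 0.
  have p0 : toC p + inC 0 * dirC j = toC p by rewrite inC0 mul0r addr0.
  have Ol : Om (toC p + inC 0 * dirC j) by rewrite p0.
  have := is_derive_coord i (rder_push e ld Ol).
  by rewrite p0 gE.
Qed.

Lemma push_distortion e p : Om (toC p) ->
  opnorm (push_jacobian e p) ^+ 2 <= expR `|e| * \det (push_jacobian e p).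
Proof.
move=> Op; set A := push_jacobian e p; set z := toC p.
set B := outer_factor e z; set b := inner_factor z.
set l := shift_stretch e (Psi z).
have l0 : 0 < l by exact: shift_stretch_gt0.
have l1 : l <= expR `|e| by exact: shift_stretch_le.
have l2 : 1 <= expR `|e| * l.
  have := shift_stretch_ge e (Psi z); rewrite -/l expRN => h.
  by rewrite -(ler_pdivrMl _ _ (expR_gt0 _)) mulr1.
have E0 : push_diff e z (dirC 0) = B * mkc (re b) (l * im b).
  congr (_ * _); rewrite (_ : dirC 0 = 1); last by rewrite /dirC /dir eqxx.
  by rewrite mulr1 mkcE.
have E1 : push_diff e z (dirC 1) = B * mkc (- im b) (l * re b).
  congr (_ * _); rewrite (_ : dirC 1 = iC); last by rewrite /dirC /dir.
  by rewrite mkcE reM imM /= !mulr0 !mulr1 sub0r addr0.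
have A00 : A 0 0 = re B * re b - im B * (l * im b).
  by rewrite mxE /Defs.coord eqxx E0 -/(re _) reM.
have A10 : A 1 0 = re B * (l * im b) + im B * re b.
  by rewrite mxE /Defs.coord /= E0 -/(im _) imM.
have A01 : A 0 1 = re B * - im b - im B * (l * re b).
  by rewrite mxE /Defs.coord eqxx E1 -/(re _) reM.
have A11 : A 1 1 = re B * (l * re b) + im B * - im b.
  by rewrite mxE /Defs.coord /= E1 -/(im _) imM.
apply: opnorm_sqr_le => x y; rewrite det2 A00 A01 A10 A11.
set K := expR _ in l1 l2 *.
set B1 := re B; set B2 := im B; set b1 := re b; set b2 := im b.
have K0 : 0 < K by exact: expR_gt0.
have -> : (B1 * b1 - B2 * (l * b2)) * (B1 * (l * b1) + B2 * - b2) -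
   (B1 * - b2 - B2 * (l * b1)) * (B1 * (l * b2) + B2 * b1) =
   (B1 ^+ 2 + B2 ^+ 2) * (b1 ^+ 2 + b2 ^+ 2) * l by ring.
pose s := b1 * x - b2 * y; pose t := b2 * x + b1 * y.
have -> : ((B1 * b1 - B2 * (l * b2)) * x + (B1 * - b2 - B2 * (l * b1)) * y) ^+ 2 +
  ((B1 * (l * b2) + B2 * b1) * x + (B1 * (l * b1) + B2 * - b2) * y) ^+ 2 =
  (B1 ^+ 2 + B2 ^+ 2) * (s ^+ 2 + l ^+ 2 * t ^+ 2) by rewrite /s /t; ring.
have -> : K * ((B1 ^+ 2 + B2 ^+ 2) * (b1 ^+ 2 + b2 ^+ 2) * l) * (x ^+ 2 + y ^+ 2) =
  (B1 ^+ 2 + B2 ^+ 2) * (K * l * s ^+ 2 + K * l * t ^+ 2) by rewrite /s /t; ring.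
apply: ler_wpM2l; first by rewrite addr_ge0 ?sqr_ge0.
apply: lerD.
  by rewrite -[leLHS]mul1r; apply: ler_wpM2r => //; exact: sqr_ge0.
apply: ler_wpM2r; first exact: sqr_ge0.
by rewrite expr2; apply: ler_wpM2r => //; exact: ltW.
Qed.

Lemma push_homeo e : homeo_on Om Om (f e).
Proof.
have fc d : {within Om, continuous (f d)}.
  rewrite continuous_open_subspace// => z; rewrite inE => Oz.
  by case: (ctsat_push cPhi d Oz).
exists (f (- e)); split=> //.
- by move=> z Oz; split; [exact: (push_Om cPhi)|exact: (pushK cPhi)].
- move=> z Oz; split; first exact: (push_Om cPhi).
  by have := pushK cPhi (- e) Oz; rewrite opprK.
Qed.

Lemma push_quasiconformal e : quasiconformal (expR `|e|) Om Om (f e).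
Proof.
split; first by rewrite -expR0 ler_expR.
  exact: push_homeo.
exists (push_jacobian e); first exact: W12_push.
by apply: aeW => p; exact: push_distortion.
Qed.

(** A point of [Om] close to a point [zeta] outside of [Om] stays close to it:
    along the orbit of the flow, [ln M - ln |f - zeta|] decays at rate at most 1
    with respect to hyperbolic arc length. *)
Lemma push_near_omitted e z zeta (M : R) : ~ Om zeta ->
  (forall v, Om v -> cm (v - zeta) < M) -> Om z ->
  expR (- `|e|) * (ln M - ln (cm (z - zeta))) <= ln M - ln (cm (f e z - zeta)).
Proof.
move=> nz bM Oz; have wP := Psi_rhp cPhi Oz.
have r0 := rhp_cm_gt0 wP.
set r := cm (Psi z) in r0 *; set s := sdist (Psi z).
pose h t : R := s + t * e.
have hd (t : R) : is_derive t 1 h e.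
  have H := rdD (is_derive_cst s t (1 : R)) (rdM (is_derive_id t (1 : R)) (is_derive_cst e t (1 : R))).
  by apply: (is_derive_eq H); rewrite add0r mul1r mulr0 addr0.
pose g t := pol r (h t).
have gP t : rhp (g t) by exact: pol_rhp.
pose d t := inC e * (iC * inC (sech (h t)) * g t).
have gd t : rder g t (d t) by exact: (rder_compR (hd t) (pol_der_s r (h t))).
have Fd t : rder (fun u => Phi (g u) - zeta) t (der Phi (g t) * d t).
  rewrite -[_ * d t]subr0; apply: cderivB; last exact: cderiv_cst.
  exact: rder_comp (gd t) (holo_der (Phi_holo cPhi) (gP t)).
have F0 t : Phi (g t) - zeta != 0.
  rewrite subr_eq0; apply/eqP => E; apply: nz; rewrite -E; exact: Phi_Om cPhi _ (gP t).
pose A t := ln M - ln (cm (Phi (g t) - zeta)).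
have Ad (t : R) : is_derive t 1 A (0 - re (der Phi (g t) * d t / (Phi (g t) - zeta))).
  exact: (rdB (is_derive_cst (ln M) t (1 : R)) (rd_ln_cm (Fd t) (F0 t))).
have A0 t : 0 < A t.
  have := bM _ (Phi_Om cPhi (gP t)) => lM.
  have c0 : 0 < cm (Phi (g t) - zeta) by rewrite cm_gt0.
  by rewrite subr_gt0 ltr_ln ?posrE// (lt_trans c0).
have Ab t : `|0 - re (der Phi (g t) * d t / (Phi (g t) - zeta))| <= `|e| * A t.
  rewrite sub0r normrN; apply: le_trans (re_le_cm _) _.
  have := omitted_point_bound oO cPhi nz bM (gP t).
  have -> : der Phi (g t) * d t / (Phi (g t) - zeta) =
    inC e * (iC * inC (sech (h t)) * g t * (der Phi (g t) / (Phi (g t) - zeta))).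
    by rewrite /d; ring.
  rewrite (cmM (inC e)) cm_inC => ob; apply: ler_wpM2l => //.
  apply: le_trans ob; rewrite (cmM (iC * _ * _)) mulrC.
  apply: ler_wpM2l => //; rewrite (cmM (iC * _)) (cmM iC) cm_iC cm_inC mul1r.
  rewrite (ger0_norm (ltW (sech_gt0 _))) (cm_pol (h t) (ltW r0)).
  have -> : re (g t) = sech (h t) * r by exact: mulrC.
  exact: lexx.
have g0 : g 0 = Psi z by rewrite /g /h mul0r addr0 pol_sdist.
have g1 : g 1 = shift e (Psi z) by rewrite /g /h mul1r.
have A0E : A 0 = ln M - ln (cm (z - zeta)) by rewrite /A g0 (PsiK cPhi).
have A1E : A 1 = ln M - ln (cm (f e z - zeta)) by rewrite /A g1.
rewrite -A0E -A1E.
exact: (exp_decay A0 Ad Ab).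
Qed.

(** The extension of [push] by the identity. *)
Definition push_ext e (z : C) : C := if `[< Om z >] then f e z else z.

Lemma push_extE e z : Om z -> push_ext e z = f e z.
Proof. by move=> Oz; rewrite /push_ext; case: asboolP. Qed.
Lemma push_ext_out e z : ~ Om z -> push_ext e z = z.
Proof. by move=> nz; rewrite /push_ext; case: asboolP. Qed.

Hypothesis bO : exists N : R, forall z, Om z -> cm z <= N.

Lemma ctsat_push_ext e z : ctsat (push_ext e) z.
Proof.
have [Oz|nz] := pselect (Om z).
  apply: ctsat_near (ctsat_push cPhi e Oz).
  have : \forall v \near z, Om v by exact: open_nbhs_nbhs.
  by apply: filterS => v Ov; rewrite push_extE.
have [N ON] := bO.
pose M := `|N| + cm z + 1.
have M0 : 0 < M by rewrite ltr_wpDl// addr_ge0.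
have bM v : Om v -> cm (v - z) < M.
  move=> /ON vN; apply: le_lt_trans (cmB _ _) _.
  by have := ler_norm N; rewrite /M; lra.
apply: Ctsat; rewrite push_ext_out//.
apply/(cvgC (F := nbhs z)) => eps eps0.
apply/nbhsC; exists (Num.min eps (expR (ln M - expR `|e| * (ln M - ln eps)))).
  by rewrite lt_min eps0 expR_gt0.
move=> v; rewrite lt_min => /andP[v1 v2].
have [Ov|nv] := pselect (Om v); last by rewrite push_ext_out.
rewrite push_extE//.
have n0 u : Om u -> 0 < cm (u - z).
  by move=> Ou; rewrite cm_gt0 subr_eq0; apply/eqP => E; apply: nz; rewrite -E.
have fO := push_Om cPhi e Ov.
rewrite -ltr_ln ?posrE ?n0//.
have := push_near_omitted e nz bM Ov.
have {}v2 : ln (cm (v - z)) < ln M - expR `|e| * (ln M - ln eps).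
  by rewrite -[ltRHS]expRK ltr_ln ?posrE ?expR_gt0 ?n0.
move=> h.
have E1 : expR (- `|e|) * expR `|e| = 1 by rewrite -expRD addNr expR0.
have := expR_gt0 (- `|e|) => p0.
have : expR (- `|e|) * (expR `|e| * (ln M - ln eps)) < expR (- `|e|) * (ln M - ln (cm (v - z))).
  by rewrite ltr_pM2l//; lra.
by rewrite mulrA E1 mul1r; lra.
Qed.

Lemma push_ext_homeo e : homeo_on (closure Om) (closure Om) (push_ext e).
Proof.
have Fc d : {within closure Om, continuous (push_ext d)}.
  by apply: continuous_subspaceT => z; case: (ctsat_push_ext d z).
have FK d z : push_ext (- d) (push_ext d z) = z.
  have [Oz|nz] := pselect (Om z); last by rewrite !push_ext_out.
  rewrite (push_extE d Oz) push_extE; last exact: (push_Om cPhi).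
  exact: (pushK cPhi).
have FO d z : closure Om z -> closure Om (push_ext d z).
  move=> cz; have [Oz|nz] := pselect (Om z); last by rewrite push_ext_out.
  by rewrite (push_extE d Oz); apply: subset_closure; exact: (push_Om cPhi).
exists (push_ext (- e)); split.
- by move=> z cz; split; [exact: FO|exact: FK].
- by move=> z cz; split; [exact: FO|have := FK (- e) z; rewrite opprK].
- exact: Fc.
- exact: Fc.
Qed.
End PushQuasiconformal.

Lemma bounded_cm (R : realType) (Om : set (cplx R)) : bounded_set Om ->
  exists N : R, forall z, Om z -> cm z <= N.
Proof.
move=> [M [Mreal HM]]; exists (cm M + 1) => z Oz.
have := HM (inC (cm M + 1)).
have Ml : M < inC (cm M + 1).
  have := real_ler_norm Mreal; rewrite normE => Mn; apply: le_lt_trans Mn _.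
  by rewrite /inC complex.ltcR ltrDl.
move=> /(_ Ml z Oz) /=; rewrite normE.
by rewrite complex.lecR.
Qed.

(** The Cayley transform carries the positive real axis to the diameter. *)
Lemma segment_axis (R : realType) (phi : cplx R -> cplx R) :
  [set phi (toC (x, 0)) | x in [set x : R | -1 < x < 1]] =
  (fun w => phi (cay w)) @` [set w | rhp w /\ im w = 0].
Proof.
apply/seteqP; split=> [_ [x /= /andP[x1 x2] <-]|_ [w [wP w0] <-]].
  have xD : unit_disk (toC (x, 0)).
    by apply/unit_diskE; rewrite (cm_inC x) ltr_norml x1.
  exists (cayi (toC (x, 0))); last by rewrite cayiK.
  split; first exact: cayi_rhp.
  have -> : toC (x, 0) = inC x by [].
  by rewrite /cayi imM reV imV !imD !reD imN reN /= oppr0 !addr0 oppr0 !mul0r mulr0 addr0.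
have wD := cay_disk wP.
have i0 : im (cay w) = 0.
  by rewrite /cay imM reV imV !imD !reD imN /= w0 oppr0 !addr0 oppr0 !mul0r mulr0 addr0.
exists (re (cay w)).
  move/unit_diskE: wD; rewrite -[cay w]mkcK i0 => h.
  by move: h; rewrite (cm_inC (re (cay w))) ltr_norml.
congr phi; rewrite -[RHS]mkcK i0; by [].
Qed.

Theorem theorem2 (R : realType) (Omega gamma : set (cplx R)) (c : R)
    (alpha : set (cplx R)) :
  jordan_domain Omega -> hyperbolic_line Omega gamma -> 0 <= c ->
  level_line Omega gamma c alpha ->
  exists (K : R) (f F : cplx R -> cplx R),
    [/\ quasiconformal K Omega Omega f,
        homeo_on (closure Omega) (closure Omega) F,
        (forall z, Omega z -> F z = f z)
      & [/\ f @` gamma = alpha,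
            (forall z, frontier Omega z -> F z = z)
          & K <= expR c]].
Proof.
move=> [[_ oO _] bO _] [phi [phiC gE]] c0 [z0 [Oz0 dz0] aE].
have [phi' cphi] := conformal_homeoP (@disk_open R) oO phiC.
pose Phi w := phi (cay w); pose Psi z := cayi (phi' z).
have cPhi : conf (@rhp R) Omega Phi Psi by exact: conf_comp (@cay_conf R) cphi.
have [psi' cpsi] : exists psi', conf Omega (@unit_disk R) (to_disk Omega) psi'.
  apply: (conformal_homeoP oO (@disk_open R)).
  apply: (@getPex _ [set psi | conformal_homeo Omega (@unit_disk R) psi]).
  by exists phi'; exact: conf_conformal_homeo oO (@disk_open R) (conf_sym cphi).
have gE' : gamma = Phi @` [set w | rhp w /\ im w = 0] by rewrite gE segment_axis.
have dE z : Omega z -> hyp_dist_set Omega z gamma = `|sdist (Psi z)|.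
  by move=> Oz; rewrite gE'; exact: (dist_to_axis cpsi cPhi Oz).
pose e := sdist (Psi z0).
have ec : `|e| = c by rewrite -dE.
have aE' : alpha = Phi @` [set w | rhp w /\ sdist w = e].
  rewrite aE -(level_component cPhi Oz0 ec); congr (connected_component _ z0).
  by apply/seteqP; split=> z [Oz /= zc]; split=> //; [rewrite -dE|rewrite dE].
exists (expR c), (push Phi Psi e), (push_ext Omega Phi Psi e); split.
- by rewrite -ec; exact: (push_quasiconformal oO cPhi).
- by apply: (push_ext_homeo oO cPhi); exact: bounded_cm.
- by move=> z Oz; rewrite push_extE.
- split; last exact: lexx.
    by rewrite gE' aE'; exact: (push_axis cPhi).
  move=> z [_ nz]; rewrite push_ext_out// => Oz; apply: nz.
  by have := oO; rewrite openE => /(_ z Oz).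
Qed.
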